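(* Let $\alpha\neq1$. The geodesics of the Amari--Čencov $\alpha$-connection $\overline\nabla^{(\alpha)}$ on $\operatorname{Prob}(M)$ are obtained by pulling back the geodesics of $\tilde\nabla^\alpha$ on $S_\alpha$ via the map $\Phi_\alpha$, i.e. they are exactly the curves $\mu(t)=\Phi_\alpha^{-1}(\gamma(t))$ with $\gamma$ a geodesic of $\tilde\nabla^\alpha$. In particular: (1) This gives the general solution of the geodesic equation: the geodesic of $\overline\nabla^{(\alpha)}$ with $\mu(0)=\mu_0\in\operatorname{Prob}(M)$ and $\dot\mu(0)=a\in T_{\mu_0}\operatorname{Prob}(M)$ is $\mu(t)=\Phi_\alpha^{-1}(\gamma(t))$, where, with $f=\Phi_\alpha(\mu_0)$ and $\xi=T_{\mu_0}\Phi_\alpha(a)$, $$\gamma(t)=\frac{2}{|1-\alpha|}\,\frac{f+\tau(t)\xi}{\left(\int_M(f+\tau(t)\xi)^{\frac{2}{1-\alpha}}\,\lambda\right)^{\frac{1-\alpha}{2}}}$$ and $\tau$ solves, as long as $f+\tau(t)\xi>0$, $$\ddot\tau(t)=2\,\frac{\int_M(f+\tau(t)\xi)^{\frac{1+\alpha}{1-\alpha}}\,\xi\,\lambda}{\int_M(f+\tau(t)\xi)^{\frac{2}{1-\alpha}}\,\lambda}\,\dot\tau(t)^2,\qquad\tau(0)=0,\quad\dot\tau(0)=1.$$ (2) $(\operatorname{Prob}(M),\overline\nabla^{(\alpha)})$ is uniquely geodesically convex: any two probability densities in $\operatorname{Prob}(M)$ can be connected by a unique geodesic of $\overline\nabla^{(\alpha)}$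 (unique up to affine reparametrization).
   Context: $M$ is a closed, oriented, $n$-dimensional smooth manifold and $\lambda$ is a fixed smooth positive density on $M$. $\operatorname{Prob}(M)=\{\mu\in\Omega^n(M):\mu>0,\ \int_M\mu=1\}$ is the Fr\'echet manifold of smooth probability densities, with $T_\mu\operatorname{Prob}(M)=\{a\in\Omega^n(M):\int_M a=0\}$; $\frac{a}{\mu}$ denotes the Radon--Nikodym derivative and $Db.a|_\mu=D_\mu b(a_\mu)$ the directional derivative of a vector field $b$. The Amari--Čencov $\alpha$-connection on $\operatorname{Prob}(M)$ is $$\overline\nabla^{(\alpha)}_a b=Db.a-\frac{1+\alpha}{2}\left(\frac{a}{\mu}b-\left(\int_M\frac{a}{\mu}\frac{b}{\mu}\,\mu\right)\mu\right).$$ For $\alpha\neq1$ let $\Phi_\alpha(\mu)=\frac{2}{|1-\alpha|}\left(\frac{\mu}{\lambda}\right)^{\frac{1-\alpha}{2}}$, so $T_\mu\Phi_\alpha(a)=\operatorname{sgn}(1-\alpha)\left(\frac{\mu}{\lambda}\right)^{-\frac{1+\alpha}{2}}\frac{a}{\lambda}$. It maps $\operatorname{Prob}(M)$ bijectively onto $$S_\alpha=\left\{f\in C^\infty(M): f>0,\ \int_M f^{\frac{2}{1-\alpha}}\,\lambda=\left(\frac{2}{|1-\alpha|}\right)^{\frac{2}{1-\alpha}}\right\},$$ a smooth submanifold of $C^\infty(M)$ with $T_fS_\alpha=\{\xi\in C^\infty(M):\int_M f^{\frac{1+\alpha}{1-\alpha}}\xi\,\lambda=0\}$. Let $\pi^\alpha_f$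 be the projection of $T_fC^\infty(M)=T_fS_\alpha\oplus\operatorname{span}\{f\}$ onto $T_fS_\alpha$, and let $\tilde\nabla^\alpha$ be the connection on $S_\alpha$ given by $(\tilde\nabla^\alpha_\xi\eta)_f=\pi^\alpha_f(\nabla_\xi\eta)$ with $\nabla$ the trivial connection on $C^\infty(M)$; its geodesics are the curves $\gamma$ in $S_\alpha$ with $\ddot\gamma(t)\in\operatorname{span}\{\gamma(t)\}$. *)

(* Defs.v *)
From mathcomp Require Import all_boot all_order all_algebra.
From mathcomp Require Import all_classical all_reals all_analysis.

Set Implicit Arguments.
Unset Strict Implicit.
Unset Printing Implicit Defensive.

Import Order.TTheory GRing.Theory Num.Theory.
Import numFieldNormedType.Exports.
Local Open Scope classical_set_scope.
Local Open Scope ring_scope.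

Section EuclideanCalculus.
Variables (R : realType) (n : nat).

Definition iter_partial (s : seq 'I_n) (u : 'rV[R]_n -> R) : 'rV[R]_n -> R :=
  foldr (fun j v => 'D_(delta_mx 0 j) v) u s.

(* Used for open [V] only, where it is the usual notion of a C^oo function:
   differentiability of the partial derivatives of order k + 1 gives the
   continuity of those of order k + 1. *)
Definition smooth_on (V : set 'rV[R]_n) (u : 'rV[R]_n -> R) :=
  forall s x, V x -> differentiable (iter_partial s u) x.

End EuclideanCalculus.

(* n-dimensional Lebesgue integral as an iterated integral; it is only applied
   to smooth compactly supported integrands, for which Fubini applies. *)
Fixpoint eucl_int (R : realType) (n : nat) : ('rV[R]_n -> R) -> R :=
  match n return ('rV[R]_n -> R) -> R with
  | 0%N => fun u => u 0
  | n'.+1 => fun u =>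
      \int[@lebesgue_measure R]_x
        eucl_int (fun v : 'rV[R]_n' => u (row_mx (const_mx x : 'rV[R]_1) v))
  end.

(* Values of [chart i] outside [dom i], and of [param i] outside the image of
   the chart, are irrelevant. [chart_at] only selects a chart around each
   point. For a compact M, second countability follows from the charts. *)
Record oriented_atlas (R : realType) (n : nat) (M : topologicalType) :=
  OrientedAtlas {
  idx : Type ;
  dom : idx -> set M ;
  chart : idx -> M -> 'rV[R]_n ;
  param : idx -> 'rV[R]_n -> M ;
  chart_at : M -> idx ;
  dom_open : forall i, open (dom i) ;
  image_open : forall i, open (chart i @` dom i) ;
  chartK : forall i m, dom i m -> param i (chart i m) = m ;
  chart_continuous : forall i m, dom i m -> {for m, continuous (chart i)} ;
  param_continuous : forall i x, (chart i @` dom i) x ->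
    {for x, continuous (param i)} ;
  dom_chart_at : forall m, dom (chart_at m) m ;
  transition_smooth : forall i j k,
    smooth_on (chart i @` (dom i `&` dom j))
              (fun x => chart j (param i x) 0 k) ;
  transition_oriented : forall i j m, dom i m -> dom j m ->
    0 < \det (jacobian (chart j \o param i) (chart i m))
}.

Section Manifold.
Variables (R : realType) (n : nat) (M : topologicalType).
Variable A : oriented_atlas R n M.

Definition cod (i : idx A) : set 'rV[R]_n := chart i @` dom i.

Definition loc_fun (f : M -> R) (i : idx A) : 'rV[R]_n -> R := f \o param i.

Definition Cinfty : set (M -> R) :=
  [set f | forall i, smooth_on (cod i) (loc_fun f i)].

(* A top-degree form is given by its coefficients: [a i m] is the coefficient
   of dx^1 /\ ... /\ dx^n at m in the chart i, set to 0 when m is outside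
   the domain so that equal forms are Leibniz-equal. *)
Definition topform := idx A -> M -> R.

Definition loc_form (a : topform) (i : idx A) : 'rV[R]_n -> R := a i \o param i.

Definition Omega : set topform :=
  [set a | [/\ forall i m, ~ dom i m -> a i m = 0,
    forall i j m, dom i m -> dom j m ->
      a i m = \det (jacobian (chart j \o param i) (chart i m)) * a j m
    & forall i, smooth_on (cod i) (loc_form a i)]].

Definition form_pos (a : topform) := forall i m, dom i m -> 0 < a i m.

Definition fmul (f : M -> R) (a : topform) : topform := fun i m => f m * a i m.

(* Radon-Nikodym derivative a / mu; the quotient of the coefficients does not
   depend on the chart. *)
Definition rn (a mu : topform) : M -> R :=
  fun m => a (chart_at A m) m / mu (chart_at A m) m.

Record partition_of_unity := PartitionOfUnity {
  pu_size : nat ;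
  pu_idx : 'I_pu_size -> idx A ;
  pu : 'I_pu_size -> M -> R ;
  pu_smooth : forall j, Cinfty (pu j) ;
  pu_ge0 : forall j m, 0 <= pu j m ;
  pu_supp : forall j, closure [set m | pu j m != 0] `<=` dom (pu_idx j) ;
  pu_sum : forall m, \sum_j pu j m = 1
}.

Arguments pu : clear implicits.
Arguments pu_idx : clear implicits.

(* Integral of an n-form over the oriented manifold. On a closed manifold
   partitions of unity exist and the value does not depend on the choice. *)
Definition integral_form (rho : partition_of_unity) (a : topform) : R :=
  \sum_j eucl_int (loc_form (fmul (pu rho j) a) (pu_idx rho j)
                     \_ (cod (pu_idx rho j))).

(* [d] is the derivative at [t] of the curve [c] on the interval [I]
   (one-sided at an endpoint in [I]), the limit of the difference quotient
   being taken in the Frechet C^oo topology: uniform convergence of all partial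
   derivatives on the compact subsets of every chart. *)
Definition frechet_deriv (V : lmodType R) (rep : V -> idx A -> 'rV[R]_n -> R)
    (I : set R) (c : R -> V) (t : R) (d : V) :=
  forall (i : idx A) (K : set 'rV[R]_n) (s : seq 'I_n) (e : R),
    compact K -> K `<=` cod i -> 0 < e ->
    \forall r \near within I t^', forall x, K x ->
      `|iter_partial s (rep ((r - t)^-1 *: (c r - c t) - d) i) x| < e.

(* [c] is a smooth curve in [X] on [I], with k-th derivative [D k]. *)
Definition smooth_curve (V : lmodType R) (rep : V -> idx A -> 'rV[R]_n -> R)
    (X : set V) (I : set R) (c : R -> V) (D : nat -> R -> V) :=
  (forall t, I t -> D 0%N t = c t) /\
  (forall k t, I t -> X (D k t) /\ frechet_deriv rep I (D k) t (D k.+1 t)).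

Variable rho : partition_of_unity.
Local Notation intM := (integral_form rho).

Definition Prob : set topform :=
  [set mu | [/\ Omega mu, form_pos mu & intM mu = 1]].

Definition TProb : set topform := [set a | Omega a /\ intM a = 0].

(* Value at [mu] of the alpha-connection, [Dba] standing for the directional
   derivative D_mu b(a). For a field b along a curve with velocity a,
   D_mu b(a) is its derivative with respect to the time. *)
Definition AC_nabla (alpha : R) (mu a b Dba : topform) : topform :=
  Dba - ((1 + alpha) / 2) *:
    (fmul (rn a mu) b - intM (fmul (rn a mu \* rn b mu) mu) *: mu).

Definition AC_geodesic (alpha : R) (I : set R) (mu : R -> topform) :=
  (forall t, I t -> Prob (mu t)) /\
  exists D : nat -> R -> topform,
    smooth_curve loc_form Omega I mu D /\
    forall t, I t -> AC_nabla alpha (mu t) (D 1%N t) (D 1%N t) (D 2%N t) = 0.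

Definition AC_velocity (I : set R) (mu : R -> topform) (t : R) (a : topform) :=
  frechet_deriv loc_form I mu t a.

Variable lambda : topform.

Definition Phi (alpha : R) (mu : topform) : M -> R :=
  fun m => 2 / `|1 - alpha| * rn mu lambda m `^ ((1 - alpha) / 2).

Definition TPhi (alpha : R) (mu a : topform) : M -> R :=
  fun m => Num.sg (1 - alpha) * rn mu lambda m `^ (- ((1 + alpha) / 2)) *
           rn a lambda m.

(* Inverse of the bijection from Prob onto S_alpha; the default value
   [lambda] is only taken outside S_alpha. *)
Definition Phi_inv (alpha : R) : (M -> R) -> topform :=
  'pinv_(fun=> lambda) Prob (Phi alpha).

(* The form f^p lambda. *)
Definition powl (f : M -> R) (p : R) : topform :=
  fmul (fun m => f m `^ p) lambda.

Definition S_alpha (alpha : R) : set (M -> R) :=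
  [set f | [/\ Cinfty f, forall m, 0 < f m
    & intM (powl f (2 / (1 - alpha))) =
      (2 / `|1 - alpha|) `^ (2 / (1 - alpha))]].

Definition TS_alpha (alpha : R) (f : M -> R) : set (M -> R) :=
  [set xi | Cinfty xi /\
    intM (fmul xi (powl f ((1 + alpha) / (1 - alpha)))) = 0].

(* [k] is the projection of [h] onto T_f S_alpha along span {f}. *)
Definition is_proj (alpha : R) (f h k : M -> R) :=
  TS_alpha alpha f k /\ exists c : R, h - k = c *: f.

(* Geodesics of the connection pi^alpha o nabla: the projection of the
   acceleration vanishes. *)
Definition S_geodesic (alpha : R) (I : set R) (gamma : R -> M -> R) :=
  (forall t, I t -> S_alpha alpha (gamma t)) /\
  exists D : nat -> R -> M -> R,
    smooth_curve loc_fun Cinfty I gamma D /\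
    forall t, I t -> is_proj alpha (gamma t) (D 2%N t) 0.

Definition real_deriv (I : set R) (u : R -> R) (t d : R) :=
  (fun r => (u r - u t) / (r - t)) @ within I t^' --> d.

(* The function gamma(t) of the explicit solution, as a function of
   [tau = tau(t)]. *)
Definition explicit_geodesic (alpha : R) (f xi : M -> R) (tau : R) : M -> R :=
  fun m => 2 / `|1 - alpha| *
    ((f m + tau * xi m) /
     (intM (powl (f + tau *: xi) (2 / (1 - alpha)))) `^ ((1 - alpha) / 2)).

Definition tau_solution (alpha : R) (f xi : M -> R) (I : set R)
    (tau : R -> R) :=
  exists tau1 tau2 : R -> R,
    [/\ tau 0 = 0, tau1 0 = 1
      & forall t, I t ->
        [/\ real_deriv I tau t (tau1 t), real_deriv I tau1 t (tau2 t),
            forall m, 0 < f m + tau t * xi m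
          & tau2 t =
            2 * (intM (fmul xi (powl (f + tau t *: xi)
                                      ((1 + alpha) / (1 - alpha)))) /
                 intM (powl (f + tau t *: xi) (2 / (1 - alpha)))) *
            tau1 t ^+ 2]].

End Manifold.

(* Intervals with more than one point, so that derivatives are unique. *)
Definition proper_interval (R : realType) (I : set R) :=
  is_interval I /\ exists s t, [/\ I s, I t & s < t].

(* Main.v *)
Require Import Defs.
From mathcomp Require Import all_boot all_order all_algebra.
From mathcomp Require Import all_classical all_reals all_analysis.
From mathcomp Require Import ring lra.
Import Order.TTheory GRing.Theory Num.Theory.
Import numFieldNormedType.Exports.
Local Open Scope classical_set_scope.
Local Open Scope ring_scope.
Set Implicit Arguments.
Unset Strict Implicit.
Unset Printing Implicit Defensive.

(** Multiplication by the reference density lambda identifies top-degree forms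
    with functions: a form a is (a / lambda) lambda, and a density mu becomes a
    positive smooth function g with J g = 1, where J h is the integral of
    h lambda. In these terms, with q = (1 - alpha) / 2 and C = 2 / |1 - alpha|,
    the geodesic equation of the alpha-connection reads
      g'' = (1 - q) (g'^2 / g - J (g'^2 / g) g),
    and the substitution gamma = C g^q turns it into gamma'' = c(t) gamma with a
    scalar c(t): the terms in g'^2 / g cancel. Conversely, gamma'' = c gamma
    leads back to the first equation because the value of c is forced by
    J g'' = 0, which follows from J g = 1 (lemmas AC_S_geodesic and
    S_AC_geodesic).

    The equation gamma'' = c gamma is a linear ordinary differential equation
    at each point of the manifold, with the same coefficient at all points.
    Hence the Wronskians of its values at two points are constant, the curve
    stays in the plane spanned by gamma(0) = f and gamma'(0) = xi, say
    gamma = A f + B xi, and A is positive since pairing with f^(p-1), p = 1/q,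
    annihilates the tangent vector xi. So gamma is the normalization of the
    straight line f + tau xi with tau = B / A, and the tangency of gamma' gives
    the equation of tau (lemmas geodesic_span and geodesic_tau).

    In the other direction put w = f + tau xi, G = J (w^p) and
    N = J (w^(p-1) xi), so that G' = p N tau'. The equation of tau says that
    tau' G^(-2q) is constant; it is therefore the autonomous equation
    tau' = k G^(2q). For gamma = C w / G^q this gives
      gamma' = C k (xi G^q - w G^(q-1) N),
    and in gamma'' the terms in xi cancel, leaving a multiple of w (lemma
    explicit_S_geodesic). The autonomous equation is solved by inverting the
    primitive Theta of the inverse of its right-hand side; Theta (tau t) - t is
    constant for every solution, which gives uniqueness (lemma clock). For the
    two-point problem the direction xi is the tangent vector k f1 - f0, so that
    the line reaches a multiple of f1 at time 1, and the initial speed is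
    Theta 1. Any other connecting geodesic has a velocity proportional to xi,
    and Theta identifies the parametrizations (lemma first_order_reach).

    Smoothness of curves is understood in the Frechet topology of uniform
    convergence of all partial derivatives. The product and power rules for
    this topology are proved by induction on the order of the partial
    derivatives, using d_j (u v) = d_j u v + u d_j v and
    d_j u^p = p u^(p-1) d_j u. All curves that occur belong to an inductively
    defined class of expressions which is closed under the derivation, and this
    makes them infinitely often differentiable (lemma
    curve_expr_smooth_curve). *)

(** * Powers of positive numbers and uniform difference quotients *)

Section PowerFunction.
Variable R : realType.

Lemma powR_mvt (p a b : R) : 0 < a -> 0 < b ->
  exists2 z, Num.min a b <= z <= Num.max a b &
    a `^ p - b `^ p = p * z `^ (p - 1) * (a - b).
Proof.
have step x y : 0 < x -> x < y -> exists2 z, x <= z <= y &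
    y `^ p - x `^ p = p * z `^ (p - 1) * (y - x).
  move=> x0 xy.
  have [||z] := @MVT R (@powR R ^~ p) (fun x => p * x `^ (p - 1)) x y xy.
  - by move=> z /[!in_itv]/= /andP[/(lt_trans x0) z0 _]; exact: is_derive1_powR.
  - apply: derivable_within_continuous => z /[!in_itv]/= /andP[xz _].
    by apply: derivable_powR; rewrite in_itv/= andbT (lt_le_trans x0).
  - by rewrite in_itv/= => /andP[/ltW ? /ltW ?] ?; exists z => //; apply/andP.
move=> a0 b0; have [ab|ba|<-] := ltgtP a b.
- have [z zab E] := step _ _ a0 ab; exists z => //.
  by rewrite -[LHS]opprB E; ring.
- by have [z zab E] := step _ _ b0 ba; exists z.
- by exists a; rewrite ?lexx// !subrr mulr0.
Qed.

Lemma powR_le_ends (p c1 c2 x : R) : 0 < c1 -> c1 <= x <= c2 ->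
  x `^ p <= c1 `^ p + c2 `^ p.
Proof.
move=> c10 /andP[c1x xc2]; have x0 : 0 < x by exact: lt_le_trans c1x.
have c20 : 0 < c2 by exact: lt_le_trans xc2.
have [p0|p0] := leP 0 p.
  apply: (@le_trans _ _ (c2 `^ p)); last by rewrite lerDr powR_ge0.
  by rewrite ge0_ler_powR// nnegrE ltW.
rewrite -[p]opprK !(powRN _ (- p)).
rewrite (@le_trans _ _ ((c1 `^ (- p))^-1))//.
  rewrite lef_pV2 ?posrE ?powR_gt0//.
  by rewrite ge0_ler_powR ?nnegrE ?oppr_ge0 ?(ltW p0) ?(ltW c10) ?(ltW x0).
by rewrite lerDl invr_ge0 powR_ge0.
Qed.

(** Two applications of the mean value theorem; the constant only depends on
    the compact interval [c1, c2], which makes the estimate usable uniformly. *)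
Lemma powR_taylor1 (p c1 c2 : R) : 0 < c1 -> exists2 C, 0 <= C &
  forall a b, c1 <= a <= c2 -> c1 <= b <= c2 ->
    `|a `^ p - b `^ p - p * b `^ (p - 1) * (a - b)| <= C * `|a - b| ^+ 2.
Proof.
move=> c10; exists (`|p * (p - 1)| * (c1 `^ (p - 1 - 1) + c2 `^ (p - 1 - 1))).
  by rewrite mulr_ge0// addr_ge0// powR_ge0.
move=> a b ac bc.
have a0 : 0 < a by case/andP: ac => + _; exact: lt_le_trans.
have b0 : 0 < b by case/andP: bc => + _; exact: lt_le_trans.
have [z zab ->] := powR_mvt p a0 b0.
have z0 : 0 < z by case/andP: zab => + _; apply: lt_le_trans; rewrite lt_min a0.
have [w wzb E] := powR_mvt (p - 1) z0 b0.
rewrite -mulrBl -mulrBr E.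
have -> : p * ((p - 1) * w `^ (p - 1 - 1) * (z - b)) * (a - b) =
  p * (p - 1) * w `^ (p - 1 - 1) * (z - b) * (a - b) by ring.
rewrite expr2 mulrA [leLHS]normrM; apply: ler_wpM2r => //.
rewrite normrM [X in X * _]normrM; have zc : c1 <= z <= c2.
  move: ac bc zab => /andP[? ?] /andP[? ?] /andP[h1 h2]; apply/andP; split.
    by apply: le_trans h1; rewrite le_min; apply/andP.
  by apply: (le_trans h2); rewrite ge_max; apply/andP.
have wc : c1 <= w <= c2.
  move: zc bc wzb => /andP[? ?] /andP[? ?] /andP[h1 h2]; apply/andP; split.
    by apply: le_trans h1; rewrite le_min; apply/andP.
  by apply: (le_trans h2); rewrite ge_max; apply/andP.
apply: ler_pM => //.
  apply: ler_wpM2l => //.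
  by rewrite ger0_norm ?powR_ge0//; exact: powR_le_ends.
move: zab; rewrite ge_min le_max => /andP[/orP[az|bz] /orP[za|zb]].
- by have -> : z = a by apply/eqP; rewrite eq_le za.
- by rewrite [`|z - b|]distrC [`|a - b|]distrC !ger0_norm; lra.
- by rewrite !ger0_norm; lra.
- have -> : z = b by apply/eqP; rewrite eq_le zb.
  by rewrite subrr normr0.
Qed.

End PowerFunction.

Section UniformLimits.
Variables (R : realType) (X : Type) (I : set R) (t : R) (K : set X).
Implicit Types h b : R -> X -> R.
Local Notation F := (within I t^').

Definition ulim0 h :=
  forall e, 0 < e -> \forall r \near F, forall x, K x -> `|h r x| < e.

Definition ubounded h :=
  exists B, \forall r \near F, forall x, K x -> `|h r x| <= B.

Lemma ulim0_le h h' :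
  (\forall r \near F, forall x, K x -> `|h' r x| <= `|h r x|) ->
  ulim0 h -> ulim0 h'.
Proof.
move=> hh' h0 e e0; apply: filterS2 hh' (h0 _ e0) => r le lt x Kx.
exact: le_lt_trans (le _ Kx) (lt _ Kx).
Qed.

Lemma ulim0_eq h h' :
  (\forall r \near F, forall x, K x -> h r x = h' r x) -> ulim0 h -> ulim0 h'.
Proof. by move=> E; apply: ulim0_le; apply: filterS E => r E x /E ->. Qed.

Lemma ulim0D h h' : ulim0 h -> ulim0 h' -> ulim0 (fun r x => h r x + h' r x).
Proof.
move=> h0 h0' e e0; have e20 : 0 < e / 2 by rewrite divr_gt0.
apply: filterS2 (h0 _ e20) (h0' _ e20) => r le le' x Kx.
by rewrite (le_lt_trans (ler_normD _ _))// (splitr e) ltrD ?le ?le'.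
Qed.

Lemma ulim0M h b : ulim0 h -> ubounded b -> ulim0 (fun r x => h r x * b r x).
Proof.
move=> h0 [B bB] e e0; have B0 : 0 < `|B| + 1 by rewrite ltr_wpDl.
apply: filterS2 (h0 (e / (`|B| + 1)) _) bB;
  rewrite ?divr_gt0// => r le leB x Kx.
rewrite normrM -[e](@divfK _ (`|B| + 1)) ?gt_eqF// ltr_pM ?le//.
by rewrite (le_lt_trans (leB _ Kx))// (le_lt_trans (ler_norm B))// ltrDl.
Qed.

Lemma ulim0_bounded h : ulim0 h -> ubounded h.
Proof.
by move=> /(_ _ ltr01) h1; exists 1; apply: filterS h1 => r h1 x /h1 /ltW.
Qed.

Lemma uboundedD h h' :
  ubounded h -> ubounded h' -> ubounded (fun r x => h r x + h' r x).
Proof.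
move=> [B hB] [B' hB']; exists (B + B');
  apply: filterS2 hB hB' => r hB hB' x Kx.
by rewrite (le_trans (ler_normD _ _))// lerD ?hB ?hB'.
Qed.

Lemma ubounded_cst (f : X -> R) (B : R) :
  (forall x, K x -> `|f x| <= B) -> ubounded (fun=> f).
Proof. by move=> fB; exists B; apply: nearW. Qed.

End UniformLimits.

Section UniformSlopes.
Variables (R : realType) (X : Type) (I : set R) (t : R) (K : set X).
Implicit Types (u v : R -> X -> R) (d : X -> R).

Definition bounded_by (f : X -> R) := exists B, forall x, K x -> `|f x| <= B.

Definition uslope u d :=
  ulim0 I t K (fun r x => (u r x - u t x) / (r - t) - d x).

Local Notation F := (within I t^').

Lemma near_slope_domain : \forall r \near F, I r /\ r - t != 0.
Proof.
rewrite near_withinE; near=> r => Ir; split => //.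
by rewrite subr_eq0; near: r; exact: nbhs_dnbhs_neq.
Unshelve. all: by end_near. Qed.

Lemma bounded_by_ubounded f : bounded_by f -> ubounded I t K (fun=> f).
Proof. by case=> B fB; exact: ubounded_cst fB. Qed.

Lemma bounded_byM f g : bounded_by f -> bounded_by g ->
  bounded_by (fun x => f x * g x).
Proof.
move=> [B fB] [C gC]; exists (B * C) => x Kx.
by rewrite normrM ler_pM// ?fB ?gC.
Qed.

Lemma bounded_byZ (k : R) f : bounded_by f -> bounded_by (fun x => k * f x).
Proof. by apply: bounded_byM; exists `|k|. Qed.

Lemma uslope_eq u v d e :
  (forall r x, I r -> K x -> u r x = v r x) ->
  (forall x, K x -> u t x = v t x) -> (forall x, K x -> d x = e x) ->
  uslope u d -> uslope v e.
Proof.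
move=> uv uvt de; apply: ulim0_eq.
apply: filterS near_slope_domain => r [Ir _] x Kx.
by rewrite -uv// -uvt// de.
Qed.

Lemma uslope_ubounded u d : bounded_by d -> uslope u d ->
  ubounded I t K (fun r x => (u r x - u t x) / (r - t)).
Proof.
move=> /bounded_by_ubounded bd /ulim0_bounded /uboundedD /(_ bd) [B uB].
by exists B; apply: filterS uB => r uB x /uB; rewrite subrK.
Qed.

Lemma ulim0_id : ulim0 I t K (fun r _ => r - t).
Proof.
move=> e e0; rewrite near_withinE; near=> r => _ x _; rewrite distrC.
near: r; apply: nbhs_dnbhs; exact: (@cvgr_dist_lt _ _ _ (nbhs t) _ id t).
Unshelve. all: by end_near. Qed.

Lemma uslope_ulim0 u d : bounded_by d -> uslope u d ->
  ulim0 I t K (fun r x => u r x - u t x).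
Proof.
move=> bd /(uslope_ubounded bd) /(ulim0M ulim0_id); apply: ulim0_eq.
by apply: filterS near_slope_domain => r [_ rt] x Kx; rewrite mulrC divfK.
Qed.

Lemma uslope_cst (f : X -> R) : uslope (fun=> f) (fun=> 0).
Proof.
by move=> e e0; apply: nearW => r x _; rewrite subrr mul0r subrr normr0.
Qed.

Lemma uslopeD u v d e : uslope u d -> uslope v e ->
  uslope (fun r x => u r x + v r x) (fun x => d x + e x).
Proof.
move=> du dv; apply: ulim0_eq (ulim0D du dv); apply: nearW => r x _.
by ring.
Qed.

(** The usual proof of the product rule; all the factors left over are bounded
    on K. *)
Lemma uslopeM u v d e : bounded_by (u t) -> bounded_by (v t) ->
  bounded_by d -> bounded_by e -> uslope u d -> uslope v e ->
  uslope (fun r x => u r x * v r x) (fun x => d x * v t x + u t x * e x).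
Proof.
move=> bu bv bd be du dv.
have bvr : ubounded I t K v.
  have /ulim0_bounded/uboundedD := uslope_ulim0 be dv.
  move=> /(_ _ (bounded_by_ubounded bv)) [B vB].
  by exists B; apply: filterS vB => r vB x /vB; rewrite subrK.
have h1 := ulim0M du bvr.
have h2 := ulim0M (uslope_ulim0 be dv) (bounded_by_ubounded bd).
have h3 := ulim0M dv (bounded_by_ubounded bu).
apply: (ulim0_eq _ (ulim0D (ulim0D h1 h2) h3)).
by apply: filterS near_slope_domain => r [_ rt] x _; field.
Qed.

(** The remainder of the first order expansion is at most a constant times
    (u r x - u t x)^2, and one of the two factors tends to 0 after division by
    r - t. *)
Lemma uslope_powR (p c : R) u d : 0 < c ->
  (forall x, K x -> c <= u t x) -> bounded_by (u t) -> bounded_by d ->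
  uslope u d ->
  uslope (fun r x => u r x `^ p) (fun x => p * u t x `^ (p - 1) * d x).
Proof.
move=> c0 cu [B uB] bd du; have c20 : 0 < c / 2 by rewrite divr_gt0.
have [C C0 HC] := powR_taylor1 p (B + c / 2) c20.
have ucvg := uslope_ulim0 bd du.
have ur := ucvg _ c20.
have bp : bounded_by (fun x => p * u t x `^ (p - 1)).
  apply: bounded_byZ; exists (c `^ (p - 1) + B `^ (p - 1)) => x Kx.
  rewrite ger0_norm ?powR_ge0//; apply: powR_le_ends => //.
  by rewrite cu// (le_trans (ler_norm _))// uB.
have h1 := ulim0M du (bounded_by_ubounded bp).
have bC : bounded_by (fun=> C) by exists `|C|.
have h2 := ulim0M (ulim0M ucvg (uslope_ubounded bd du))
  (bounded_by_ubounded bC).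
have h3 : ulim0 I t K (fun r x =>
    (u r x `^ p - u t x `^ p - p * u t x `^ (p - 1) * (u r x - u t x)) /
    (r - t)).
  apply: ulim0_le h2; apply: filterS2 near_slope_domain ur => r [_ rt] ur x Kx.
  rewrite normrM normfV; set q := u r x - u t x.
  have -> : `|q * (q / (r - t)) * C| = C * `|q| ^+ 2 / `|r - t|.
    by rewrite !normrM normfV (ger0_norm C0); ring.
  rewrite ler_wpM2r ?invr_ge0//.
  have /andP[ux1 ux2] : u t x - c / 2 < u r x < u t x + c / 2.
    by rewrite -ltr_distlC distrC ur.
  have ux3 := cu x Kx; have ux4 := le_trans (ler_norm _) (uB x Kx).
  apply: HC; first by lra.
  by lra.
apply: (ulim0_eq _ (ulim0D h1 h3)).
by apply: filterS near_slope_domain => r [_ rt] x _; field.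
Qed.

End UniformSlopes.

(** * Smooth functions on an open subset of a Euclidean space *)

(** The differential of f also is a first order approximation of g. *)
Lemma near_eq_differentiable (R : numFieldType) (V W : normedModType R)
    (f g : V -> W) (x : V) :
  {near x, f =1 g} -> differentiable f x -> differentiable g x.
Proof.
move=> fg df; have dfc := diff_continuous df.
have E : g \o shift x = cst (g x) + 'd f x +o_ 0 id.
  have /eqaddoP fo := diff_locally df; apply/eqaddoP => e e0.
  have fg0 : {near 0, f \o shift x =1 g \o shift x}.
    by move: fg; rewrite /= (near_shift 0) subr0.
  have fgx : f x = g x by exact: nbhs_singleton fg.
  by apply: filterS2 fg0 (fo _ e0) => y /= Ey; rewrite !fctE /= -Ey -fgx.
apply/diff_locallyP; have Ed := diff_unique dfc E.
by split; rewrite ?Ed.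
Qed.

Section Smooth.
Variables (R : realType) (n : nat) (V : set 'rV[R]_n).
Hypothesis openV : open V.
Implicit Types (u v : 'rV[R]_n -> R) (s : seq 'I_n) (j : 'I_n).

Local Notation pd j u := ('D_(delta_mx 0 j) u).

Lemma near_open x (P : 'rV[R]_n -> Prop) :
  V x -> (forall y, V y -> P y) -> \forall y \near x, P y.
Proof.
move=> Vx VP; have : nbhs x V by exact: open_nbhs_nbhs.
exact: filterS.
Qed.

Lemma iter_partial_rcons s j u :
  iter_partial (rcons s j) u = iter_partial s (pd j u).
Proof. exact: foldr_rcons. Qed.

(** Partial derivatives are local, so identities between functions only need
    to be known on the open set V. *)
Lemma eq_iter_partial u v s : (forall x, V x -> u x = v x) ->
  forall x, V x -> iter_partial s u x = iter_partial s v x.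
Proof.
move=> uv; elim: s => [|j s IH] x Vx /=; first exact: uv.
by apply: near_eq_derive; exact: near_open.
Qed.

Lemma eq_smooth_on u v : (forall x, V x -> u x = v x) ->
  smooth_on V u -> smooth_on V v.
Proof.
move=> uv su s x Vx; apply: near_eq_differentiable (su s x Vx).
by apply: near_open => // y; exact: eq_iter_partial.
Qed.

Lemma smooth_differentiable u x : smooth_on V u -> V x -> differentiable u x.
Proof. by move=> /(_ [::] x). Qed.

Lemma smooth_derivable u x j : smooth_on V u -> V x ->
  derivable u x (delta_mx 0 j).
Proof. by move=> su Vx; exact/diff_derivable/smooth_differentiable. Qed.

Lemma smooth_partial u j : smooth_on V u -> smooth_on V (pd j u).
Proof. by move=> su s x Vx; rewrite -iter_partial_rcons; exact: su. Qed.

(** Coinduction for smoothness: a class of differentiable functions that is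
    closed, up to equality on V, under partial derivatives consists of smooth
    functions. *)
Lemma smooth_on_coind (P : ('rV[R]_n -> R) -> Prop) :
  (forall u, P u -> forall x, V x -> differentiable u x) ->
  (forall u j, P u -> exists2 v, P v & forall x, V x -> pd j u x = v x) ->
  forall u, P u -> smooth_on V u.
Proof.
move=> Pd Pj u + s; elim/last_ind: s u => [|s j IH] u Pu x Vx; first exact: Pd.
have [v Pv uv] := Pj u j Pu; rewrite iter_partial_rcons.
apply: near_eq_differentiable (IH v Pv x Vx); apply: near_open => // y Vy.
by apply: eq_iter_partial => // z Vz; rewrite uv.
Qed.

Lemma partialD u v j x : smooth_on V u -> smooth_on V v -> V x ->
  pd j (fun x => u x + v x) x = pd j u x + pd j v x.
Proof. by move=> su sv Vx; apply: deriveD; exact: smooth_derivable. Qed.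

Lemma partialM u v j x : differentiable u x -> differentiable v x ->
  pd j (fun x => u x * v x) x = pd j u x * v x + u x * pd j v x.
Proof.
move=> du dv; rewrite [LHS]deriveM; try exact: diff_derivable.
by rewrite addrC; congr (_ + _); rewrite -/(_ * _) mulrC.
Qed.

Lemma differentiable_powR u p x : differentiable u x -> 0 < u x ->
  differentiable (fun x => u x `^ p) x.
Proof.
move=> du ux; apply: (@differentiable_comp _ _ _ _ u (@powR R ^~ p)) => //.
by apply/derivable1_diffP/derivable_powR; rewrite in_itv/= ux.
Qed.

Lemma partial_powR u p j x : differentiable u x -> 0 < u x ->
  pd j (fun x => u x `^ p) x = p * u x `^ (p - 1) * pd j u x.
Proof.
move=> du ux.
have dp : differentiable (@powR R ^~ p) (u x).
  by apply/derivable1_diffP/derivable_powR; rewrite in_itv/= ux.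
rewrite (@deriveE _ _ _ ((@powR R ^~ p) \o u)); last exact: differentiable_comp.
have scale c : 'D_c (@powR R ^~ p) (u x) = p * u x `^ (p - 1) * c.
  rewrite -(@derive_val _ _ _ _ _ _ _ (@is_derive1_powR R p (u x) ux)).
  by rewrite !deriveE// -[in LHS](mulr1 c) [LHS]linearZ mulrC.
by rewrite diff_comp//= -scale !deriveE.
Qed.

(** The closure of the smooth functions under sums, products and powers; it is
    closed under partial derivatives, as smooth_on_coind requires. *)
Inductive smooth_expr : ('rV[R]_n -> R) -> Prop :=
| SmoothAtom u of smooth_on V u : smooth_expr u
| SmoothAdd u v of smooth_expr u & smooth_expr v :
    smooth_expr (fun x => u x + v x)
| SmoothMul u v of smooth_expr u & smooth_expr v :
    smooth_expr (fun x => u x * v x)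
| SmoothPow u p of smooth_expr u & (forall x, V x -> 0 < u x) :
    smooth_expr (fun x => u x `^ p).

Lemma smooth_cst (k : R) : smooth_on V (fun=> k).
Proof.
apply: (@smooth_on_coind (fun u => exists k, u = fun=> k)); last by exists k.
  by move=> _ [c ->] x _; exact: differentiable_cst.
move=> _ j [c ->]; exists (fun=> 0); first by exists 0.
by move=> x _; exact: derive_cst.
Qed.

Lemma smooth_expr_smooth u : smooth_expr u -> smooth_on V u.
Proof.
have diffe v : smooth_expr v -> forall x, V x -> differentiable v x.
  elim=> {v} [v sv|v w _ IHv _ IHw|v w _ IHv _ IHw|v p _ IHv v0] x Vx.
  - exact: smooth_differentiable.
  - by apply: differentiableD; [exact: IHv|exact: IHw].
  - by apply: differentiableM; [exact: IHv|exact: IHw].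
  - by apply: differentiable_powR; [exact: IHv|exact: v0].
apply: smooth_on_coind => // {}u j; elim=> {u}.
- move=> u su; exists (pd j u) => //; apply: SmoothAtom; exact: smooth_partial.
- move=> u v eu [du edu duE] ev [dv edv dvE].
  exists (fun x => du x + dv x); first exact: SmoothAdd.
  move=> x Vx; rewrite -duE// -dvE//.
  by apply: deriveD; apply/diff_derivable/diffe.
- move=> u v eu [du edu duE] ev [dv edv dvE].
  exists (fun x => du x * v x + u x * dv x).
    by apply: SmoothAdd; exact: SmoothMul.
  by move=> x Vx; rewrite -duE// -dvE// partialM//; exact: diffe.
- move=> u p eu [du edu duE] u0.
  exists (fun x => p * u x `^ (p - 1) * du x).
    apply: SmoothMul => //; apply: SmoothMul; last exact: SmoothPow.
    exact/SmoothAtom/smooth_cst.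
  by move=> x Vx; rewrite -duE// partial_powR//; [exact: diffe|exact: u0].
Qed.

Lemma smoothD u v : smooth_on V u -> smooth_on V v ->
  smooth_on V (fun x => u x + v x).
Proof.
by move=> su sv; apply/smooth_expr_smooth/SmoothAdd; exact: SmoothAtom.
Qed.

Lemma smoothM u v : smooth_on V u -> smooth_on V v ->
  smooth_on V (fun x => u x * v x).
Proof.
by move=> su sv; apply/smooth_expr_smooth/SmoothMul; exact: SmoothAtom.
Qed.

Lemma smooth_powR u p : smooth_on V u -> (forall x, V x -> 0 < u x) ->
  smooth_on V (fun x => u x `^ p).
Proof.
by move=> su u0; apply/smooth_expr_smooth/SmoothPow => //; exact: SmoothAtom.
Qed.

Lemma smoothZ k u : smooth_on V u -> smooth_on V (fun x => k * u x).
Proof. by move=> su; apply: smoothM => //; exact: smooth_cst. Qed.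

Lemma iter_partialD u v s x : smooth_on V u -> smooth_on V v -> V x ->
  iter_partial s (fun x => u x + v x) x =
  iter_partial s u x + iter_partial s v x.
Proof.
elim/last_ind: s u v => [//|s j IH] u v su sv Vx; rewrite !iter_partial_rcons.
rewrite -IH//; try exact: smooth_partial.
by apply: eq_iter_partial => // y Vy; exact: partialD.
Qed.

Lemma iter_partialZ k u s x : smooth_on V u -> V x ->
  iter_partial s (fun x => k * u x) x = k * iter_partial s u x.
Proof.
elim/last_ind: s u => [//|s j IH] u su Vx; rewrite !iter_partial_rcons -IH//.
  apply: eq_iter_partial => // y Vy; apply: deriveZ; exact: smooth_derivable.
exact: smooth_partial.
Qed.

Lemma smooth_bounded_by u s (K : set 'rV[R]_n) : compact K -> K `<=` V ->
  smooth_on V u -> bounded_by K (iter_partial s u).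
Proof.
move=> cK KV su; have [->|/set0P K0] := eqVneq K set0; first by exists 0.
have cont : {within K, continuous (fun x => `|iter_partial s u x|)}.
  apply: continuous_in_subspaceT => x /set_mem Kx.
  apply: continuous_comp; last exact: norm_continuous.
  by apply: differentiable_continuous; apply: su; exact: KV.
have [c cKc cm] := compact_EVT_max K0 cK cont.
by exists `|iter_partial s u c| => x Kx; apply: cm; exact: mem_set.
Qed.

Lemma smooth_pos_lower u (K : set 'rV[R]_n) : compact K -> K `<=` V ->
  smooth_on V u -> (forall x, V x -> 0 < u x) ->
  exists2 c, 0 < c & forall x, K x -> c <= u x.
Proof.
move=> cK KV su u0; have [->|/set0P K0] := eqVneq K set0; first by exists 1.
have cont : {within K, continuous u}.
  apply: continuous_in_subspaceT => x /set_mem Kx.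
  by apply: differentiable_continuous; apply: (su [::]); exact: KV.
have [c cKc cm] := compact_EVT_min K0 cK cont.
by exists (u c) => [|x Kx]; [exact/u0/KV/set_mem|apply: cm; exact: mem_set].
Qed.

End Smooth.

(** * Product and power rules for locally smooth curves of functions *)

Section LocalSlopes.
Variables (R : realType) (n : nat) (V K : set 'rV[R]_n) (I : set R) (t : R).
Hypotheses (openV : open V) (compactK : compact K) (KV : K `<=` V) (It : I t).
Implicit Types (u v : R -> 'rV[R]_n -> R) (d e : 'rV[R]_n -> R).

Local Notation pd j u := ('D_(delta_mx 0 j) u).

(** Derivative at t of a curve of functions, seen through the partial
    derivatives of order at most k on the compact K. The bound k is the
    induction parameter of the product and power rules. *)
Definition smooth_slope (k : nat) u d := forall s : seq 'I_n, (size s <= k)%N ->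
  uslope I t K (fun r => iter_partial s (u r)) (iter_partial s d).

Lemma eq_smooth_slope k u v d e :
  (forall r x, I r -> V x -> u r x = v r x) -> (forall x, V x -> d x = e x) ->
  smooth_slope k u d -> smooth_slope k v e.
Proof.
move=> uv de sl s sk; apply: uslope_eq (sl s sk).
- by move=> r x Ir /KV Vx; apply: (eq_iter_partial openV) => // y; exact: uv.
- by move=> x /KV Vx; apply: (eq_iter_partial openV) => // y; exact: uv.
- by move=> x /KV Vx; exact: (eq_iter_partial openV).
Qed.

Lemma smooth_slope_partial k u d j : smooth_slope k.+1 u d ->
  smooth_slope k (fun r => pd j (u r)) (pd j d).
Proof.
move=> sl s sk; have := sl (rcons s j).
by rewrite size_rcons => /(_ sk); apply: uslope_eq => *;
  rewrite iter_partial_rcons.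
Qed.

Lemma smooth_slopeS k u d : smooth_slope k.+1 u d -> smooth_slope k u d.
Proof. by move=> sl s sk; exact: sl (leqW sk). Qed.

Lemma smooth_slopeD k u v d e :
  (forall r, I r -> smooth_on V (u r)) ->
    (forall r, I r -> smooth_on V (v r)) ->
  smooth_on V d -> smooth_on V e -> smooth_slope k u d -> smooth_slope k v e ->
  smooth_slope k (fun r x => u r x + v r x) (fun x => d x + e x).
Proof.
move=> su sv sd se slu slv s sk.
apply: uslope_eq (uslopeD (slu s sk) (slv s sk)).
- by move=> r x Ir /KV Vx; rewrite (iter_partialD openV)//;
    [exact: su|exact: sv].
- by move=> x /KV Vx; rewrite (iter_partialD openV)//; [exact: su|exact: sv].
- by move=> x /KV Vx; rewrite (iter_partialD openV).
Qed.

(** Induction on k: a partial derivative of order k + 1 of u v is one of order k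
    of d_j u v + u d_j v, to which the induction hypothesis applies. *)
Lemma smooth_slopeM k u v d e :
  (forall r, I r -> smooth_on V (u r)) ->
    (forall r, I r -> smooth_on V (v r)) ->
  smooth_on V d -> smooth_on V e -> smooth_slope k u d -> smooth_slope k v e ->
  smooth_slope k (fun r x => u r x * v r x)
                 (fun x => d x * v t x + u t x * e x).
Proof.
elim: k u v d e => [|k IH] u v d e su sv sd se slu slv s; last first.
  case/lastP: s => [_|s j]; first by apply: (IH _ _ _ _ su sv sd se) => //;
    exact: smooth_slopeS.
  rewrite size_rcons ltnS => sk.
  have spu r : I r -> smooth_on V (pd j (u r)) by move=> /su;
    exact: smooth_partial.
  have spv r : I r -> smooth_on V (pd j (v r)) by move=> /sv;
    exact: smooth_partial.
  have spd : smooth_on V (pd j d) by exact: smooth_partial.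
  have spe : smooth_on V (pd j e) by exact: smooth_partial.
  have h1 := IH _ _ _ _ spu sv spd se (smooth_slope_partial j slu)
    (smooth_slopeS slv).
  have h2 := IH _ _ _ _ su spv sd spe (smooth_slopeS slu)
    (smooth_slope_partial j slv).
  have h := smooth_slopeD (fun r Ir => smoothM openV (spu r Ir) (sv r Ir))
    (fun r Ir => smoothM openV (su r Ir) (spv r Ir))
    (smoothD openV (smoothM openV spd (sv t It)) (smoothM openV (spu t It) se))
    (smoothD openV (smoothM openV sd (spv t It)) (smoothM openV (su t It) spe))
      h1 h2.
  have pdM r x : I r -> V x ->
      pd j (u r) x * v r x + u r x * pd j (v r) x = pd j
        (fun x => u r x * v r x) x.
    by move=> Ir Vx; rewrite partialM//; apply: smooth_differentiable Vx => //;
      [exact: su|exact: sv].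
  apply: uslope_eq (h s sk).
  - move=> r x Ir /KV Vx; rewrite iter_partial_rcons.
    by apply: (eq_iter_partial openV) => // y Vy; exact: pdM.
  - move=> x /KV Vx; rewrite iter_partial_rcons.
    by apply: (eq_iter_partial openV) => // y Vy; exact: pdM.
  - move=> x /KV Vx; rewrite iter_partial_rcons.
    apply: (eq_iter_partial openV) => // y Vy.
    rewrite (partialD j (smoothM openV sd (sv t It))
      (smoothM openV (su t It) se))//.
    rewrite !partialM; do ?[by apply: smooth_differentiable Vy => //;
      [exact: su|exact: sv]|
      by apply: smooth_differentiable Vy => //; [exact: su]|
      by apply: smooth_differentiable Vy => //; exact: sv|
      by exact: smooth_differentiable Vy].
    by ring.
rewrite leqn0 size_eq0 => /eqP ->.
have bd f : smooth_on V f -> bounded_by K f by exact: (smooth_bounded_by [::]).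
by apply: uslopeM; [exact/bd/su|exact/bd/sv|exact: bd|exact: bd|exact: (slu
  [::])|exact: (slv [::])].
Qed.

Lemma smooth_slope_cst k (f : 'rV[R]_n -> R) : smooth_slope k (fun=> f)
  (fun=> 0).
Proof.
move=> s _; apply: uslope_eq (uslope_cst I t K (iter_partial s f)) => //.
move=> x Kx; have Vx := KV Kx.
have E := iter_partialZ openV 0 s (smooth_cst openV 0) Vx.
rewrite [RHS]mul0r in E; rewrite -[LHS]E.
by apply: (eq_iter_partial openV) => // y Vy; rewrite mul0r.
Qed.

Lemma smooth_slopeZ k c u d :
  (forall r, I r -> smooth_on V (u r)) -> smooth_on V d ->
  smooth_slope k u d -> smooth_slope k (fun r x => c * u r x)
    (fun x => c * d x).
Proof.
move=> su sd sl; have sc := smooth_cst openV c.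
have := smooth_slopeM (fun _ _ => sc) su (smooth_cst openV 0) sd
  (smooth_slope_cst _) sl.
by apply: eq_smooth_slope => // x _; rewrite mul0r add0r.
Qed.

(** Induction on k, for all exponents at once: d_j u^p is the product of
    p u^(p-1), covered by the induction hypothesis, and of d_j u. *)
Lemma smooth_slope_powR k p u d :
  (forall r, I r -> smooth_on V (u r)) ->
    (forall r x, I r -> V x -> 0 < u r x) ->
  smooth_on V d -> smooth_slope k u d ->
  smooth_slope k (fun r x => u r x `^ p)
                 (fun x => p * u t x `^ (p - 1) * d x).
Proof.
move=> su u0 sd; have sp q r : I r -> smooth_on V (fun x => u r x `^ q).
  by move=> Ir; apply: smooth_powR => // [|x]; [exact: su|exact: u0].
elim: k p => [|k IH] p sl s; last first.
  case/lastP: s => [_|s j]; first by apply: IH => //; exact: smooth_slopeS.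
  rewrite size_rcons ltnS => sk.
  have spu r : I r -> smooth_on V (pd j (u r)) by move=> /su;
    exact: smooth_partial.
  have spd : smooth_on V (pd j d) by exact: smooth_partial.
  have sq r : I r -> smooth_on V (fun x => p * u r x `^ (p - 1)).
    by move=> Ir; apply: smoothZ => //; exact: sp.
  have sqd : smooth_on V (fun x => (p - 1) * u t x `^ (p - 1 - 1) * d x).
    by apply: smoothM => //; apply: smoothZ => //; exact: sp.
  have hq := smooth_slopeZ p (sp _) sqd (IH (p - 1) (smooth_slopeS sl)).
  have h := smooth_slopeM sq spu (smoothZ openV p sqd) spd hq
    (smooth_slope_partial j sl).
  have pdX r x : I r -> V x ->
      p * u r x `^ (p - 1) * pd j (u r) x = pd j (fun x => u r x `^ p) x.
    move=> Ir Vx; rewrite partial_powR//; last exact: u0.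
    by apply: smooth_differentiable Vx => //; exact: su.
  apply: uslope_eq (h s sk).
  - move=> r x Ir /KV Vx; rewrite iter_partial_rcons.
    by apply: (eq_iter_partial openV) => // y Vy; exact: pdX.
  - move=> x /KV Vx; rewrite iter_partial_rcons.
    by apply: (eq_iter_partial openV) => // y Vy; exact: pdX.
  - move=> x /KV Vx; rewrite iter_partial_rcons.
    apply: (eq_iter_partial openV) => // y Vy.
    have dfu : differentiable (u t) y by apply: smooth_differentiable Vy => //;
      exact: su.
    have dfp q : differentiable (fun x => u t x `^ q) y.
      by apply: smooth_differentiable Vy => //; exact: sp.
    have dfc : differentiable (fun=> p) y by exact: differentiable_cst.
    rewrite partialM; last 2 first.
    - exact: differentiableM.
    - exact: smooth_differentiable Vy.
    rewrite partialM// partial_powR//; last exact: u0.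
    by rewrite derive_cst; ring.
rewrite leqn0 size_eq0 => /eqP ->.
have [c c0 cu] := smooth_pos_lower compactK KV (su t It) (fun x => u0 t x It).
apply: uslope_powR c0 cu _ _ (sl [::] (leqnn 0)).
  exact: (smooth_bounded_by [::] compactK KV (su t It)).
exact: (smooth_bounded_by [::] compactK KV sd).
Qed.

Lemma smooth_slope_scalar k (c : R -> R) (c' : R) :
  uslope I t [set: unit] (fun r _ => c r) (fun=> c') ->
  smooth_slope k (fun r _ => c r) (fun=> c').
Proof.
move=> cc' s _; have c1 x a : V x ->
  iter_partial s (fun=> a) x = a * iter_partial s (fun=> 1) x.
  move=> Vx; rewrite -(iter_partialZ openV a s (smooth_cst openV 1) Vx).
  by apply: (eq_iter_partial openV) => // y; rewrite mulr1.
have cK : uslope I t K (fun r _ => c r) (fun=> c').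
  by move=> e e0; apply: filterS (cc' e e0) => r /(_ tt Logic.I) h x _.
have b1 := smooth_bounded_by s compactK KV (smooth_cst openV 1).
have bc (a : R) : bounded_by K (fun=> a) by exists `|a|.
have := uslopeM (bc _) b1 (bc _) (bc _) cK
  (uslope_cst I t K (iter_partial s (fun=> 1))).
apply: uslope_eq.
- by move=> r x _ /KV Vx; rewrite [RHS]c1.
- by move=> x /KV Vx; rewrite [RHS]c1.
- by move=> x /KV Vx; rewrite [RHS]c1// mulr0 addr0.
Qed.

End LocalSlopes.

(** * The iterated Lebesgue integral of continuous functions *)

Section EuclideanIntegral.
Variable R : realType.
Implicit Types (L B : R).

Definition cons_row n (x : R) (v : 'rV[R]_n) : 'rV[R]_n.+1 :=
  row_mx (const_mx x : 'rV[R]_1) v.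

Definition box n L : set 'rV[R]_n :=
  [set v | forall i, `[- L, L]%classic (v ord0 i)].

Lemma compact_box n L : compact (@box n L).
Proof.
have := @rV_compact R n (fun=> `[- L, L]%classic).
by apply=> i; exact: segment_compact.
Qed.

Lemma cons_row_tail n x (v : 'rV[R]_n) i :
  cons_row x v ord0 (rshift 1 i) = v ord0 i.
Proof. exact: row_mxEr. Qed.

Lemma cons_row_head n x (v : 'rV[R]_n) : cons_row x v ord0
  (lshift n (ord0 : 'I_1)) = x.
Proof. by rewrite [LHS]row_mxEl mxE. Qed.

Lemma cons_row_continuous n (z : R * 'rV[R]_n) :
  {for z, continuous (fun p : R * 'rV[R]_n => cons_row p.1 p.2)}.
Proof.
apply/cvg_ballP => e e0; exists (ball z.1 e, ball z.2 e).
  by split; exact: nbhsx_ballx.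
move=> [x v] /= [zx [_ zv]]; split=> // i j; rewrite /cons_row !mxE.
by case: splitP => k _; rewrite ?mxE//; exact: zv.
Qed.

Lemma continuous_section n (u : 'rV[R]_n.+1 -> R) x :
  continuous u -> continuous (fun v => u (cons_row x v)).
Proof.
move=> cu v; apply: (@continuous_comp _ _ _ (cons_row x) u); last exact: cu.
apply: (@continuous_comp _ _ _ (fun v => (x, v)) (fun p => cons_row p.1 p.2)).
  apply: (@cvg_pair _ _ _ (nbhs v) (nbhs x) (nbhs v) _ _ _ (fun=> x) id).
    exact: cvg_cst.
  exact: cvg_id.
exact: cons_row_continuous.
Qed.

(** On these functions the iterated integral is linear and bounded. They are
    stable under fixing the first coordinate. *)
Definition cont_supp n L (u : 'rV[R]_n -> R) :=
  continuous u /\ forall v, ~ box L v -> u v = 0.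

Lemma cont_supp_section n L (u : 'rV[R]_n.+1 -> R) x :
  cont_supp L u -> cont_supp L (fun v => u (cons_row x v)).
Proof.
move=> [cu u0]; split; first exact: continuous_section.
move=> v bv; apply: u0 => buv; apply: bv => i.
by have := buv (rshift 1 i); rewrite cons_row_tail.
Qed.

Lemma cont_supp_lin n L (u v : 'rV[R]_n -> R) a :
  cont_supp L u -> cont_supp L v -> cont_supp L (fun x => a * u x + v x).
Proof.
move=> [cu u0] [cv v0]; split=> [x|x bx]; last by rewrite u0// v0// mulr0 addr0.
apply: (@continuousD _ _ _ (fun x => a * u x) v); last exact: cv.
apply: (@continuousM _ _ (cst a) u); last exact: cu.
exact: cst_continuous.
Qed.

(** The compactness of the box turns continuity at each point of the slice
    above x into a uniform estimate. *)
Lemma section_unif n L (u : 'rV[R]_n.+1 -> R) x e : cont_supp L u -> 0 < e ->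
  \forall y \near x, forall v, `|u (cons_row y v) - u (cons_row x v)| <= e.
Proof.
move=> [cu u0] e0.
have /compact_near_coveringP cb := @compact_box n L.
have := cb R (nbhs x)
  (fun y v => `|u (cons_row y v) - u (cons_row x v)| <= e) (nbhs_filter x).
have h : forall v, box L v -> \forall v' \near v & y \near x,
    `|u (cons_row y v') - u (cons_row x v')| <= e.
  move=> v _; have e20 : 0 < e / 2 by rewrite divr_gt0.
  have cx := @continuous_section n u x cu v.
  have cxy : {for (x, v), continuous (fun p => u (cons_row p.1 p.2))}.
    apply: (@continuous_comp _ _ _ (fun p => cons_row p.1 p.2) u);
      last exact: cu.
    exact: cons_row_continuous.
  have /cvgr_distC_lt/(_ _ e20)[[A B] /= [xA vB] AB] := cxy.
  have /cvgr_dist_lt/(_ _ e20) vC := cx.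
  exists (B `&` [set w | `|u (cons_row x v) - u (cons_row x w)| < e / 2], A).
    by split => //; exact: filterI.
  move=> [v' y] /= [[Bv' lt1] Ay]; have lt2 := AB (y, v') (conj Ay Bv').
  rewrite (splitr e); apply: ltW; apply: le_lt_trans (ltrD lt2 lt1).
  exact: ler_distD.
move=> /(_ h); apply: filterS => y hy v.
have [bv|bv] := pselect (box L v); first exact: hy.
have nb z : ~ box L (cons_row z v).
  by move=> bz; apply: bv => i; have := bz (rshift 1 i); rewrite cons_row_tail.
by rewrite !u0// subrr normr0 ltW.
Qed.

Lemma itv_supported_integrable L (g : R -> R) : continuous g ->
  (forall x, ~ `[- L, L]%classic x -> g x = 0) ->
  (@lebesgue_measure R).-integrable setT (EFin \o g).
Proof.
move=> cg g0; have -> : EFin \o g = (EFin \o g) \_ `[- L, L].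
  apply/funext => x; rewrite patchE; case: ifPn => // xL.
  by rewrite /= g0// => ?; move/negP: xL; apply; exact: mem_set.
have mL := @measurable_itv R `[- L, L].
apply (integrable_mkcond (mu := lebesgue_measure) (EFin \o g) mL).1.
apply: continuous_compact_integrable; first exact: segment_compact.
exact: continuous_subspaceT.
Qed.

Lemma eucl_intS n (u : 'rV[R]_n.+1 -> R) :
  eucl_int u =
  \int[@lebesgue_measure R]_x eucl_int (fun v => u (cons_row x v)).
Proof. by []. Qed.

Lemma eucl_int_ge0 n (u : 'rV[R]_n -> R) : (forall x, 0 <= u x) ->
  0 <= eucl_int u.
Proof.
elim: n u => [|n IH] u u0; first exact: u0.
by rewrite eucl_intS; apply: Rintegral_ge0 => x _; exact: IH.
Qed.

(** Induction on the dimension. The bound on the integral is part of the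
    induction because it makes the integral over a slice continuous in the first
    coordinate, hence integrable. *)
Lemma eucl_int_lin_bound n L : 0 <= L ->
  (forall u v a, @cont_supp n L u -> cont_supp L v ->
    eucl_int (fun x => a * u x + v x) = a * eucl_int u + eucl_int v) /\
  (forall u B, @cont_supp n L u -> (forall x, `|u x| <= B) ->
    `|eucl_int u| <= B * (2 * L) ^+ n).
Proof.
move=> L0; elim: n => [|n [IHl IHb]].
  by split=> [u v a _ _|u B _ uB]; [|rewrite expr0 mulr1; exact: uB].
have cut0 u x : @cont_supp n.+1 L u -> ~ `[- L, L]%classic x ->
    eucl_int (fun v => u (cons_row x v)) = 0.
  move=> cu xL; have [_ u0] := cu.
  have u00 v : u (cons_row x v) = 0.
    by apply: u0 => bx; apply: xL; have := bx (lshift n (ord0 : 'I_1));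
      rewrite cons_row_head.
  apply/eqP; rewrite -normr_le0 -(mul0r ((2 * L) ^+ n)).
  apply: IHb; first exact: cont_supp_section.
  by move=> v; rewrite u00 normr0.
have sect u : @cont_supp n.+1 L u ->
    continuous (fun x => eucl_int (fun v => u (cons_row x v))).
  move=> cu x; apply/cvgrPdistC_le => e e0.
  have c0 : 0 < (2 * L) ^+ n + 1 by rewrite ltr_wpDl// exprn_ge0// mulr_ge0.
  have : 0 < e / ((2 * L) ^+ n + 1) by rewrite divr_gt0.
  move=> /(section_unif x cu); apply: filterS => y uy.
  have := IHl _ _ (-1) (cont_supp_section x cu) (cont_supp_section y cu).
  rewrite mulN1r addrC => <-.
  apply: le_trans (IHb _ (e / ((2 * L) ^+ n + 1)) _ _) _.
  - by apply: cont_supp_lin; exact: cont_supp_section.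
  - by move=> v; rewrite mulN1r addrC.
  - rewrite mulrAC ler_pdivrMr// ler_pM2l// lerDl//.
have intg u : @cont_supp n.+1 L u -> (@lebesgue_measure R).-integrable setT
    (EFin \o (fun x => eucl_int (fun v => u (cons_row x v)))).
  by move=> cu; apply: (@itv_supported_integrable L);
    [exact: sect|move=> x; exact: cut0].
split=> [u v a cu cv|u B cu uB].
- pose f w x := eucl_int (fun y : 'rV[R]_n => w (cons_row x y)).
  have mu_u := intg u cu; have mu_v := intg v cv.
  have -> : eucl_int (fun x => a * u x + v x) =
      \int[@lebesgue_measure R]_x (a * f u x + f v x).
    rewrite eucl_intS; apply: eq_Rintegral => x _.
    by apply: IHl; exact: cont_supp_section.
  rewrite RintegralD//; first by rewrite RintegralZl.
  exact: integrableZl mu_u.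
- have mL := @measurable_itv R `[- L, L].
  have cK : compact `[- L, L]%classic by exact: segment_compact.
  have integrableL (g : R -> R) : continuous g ->
      (@lebesgue_measure R).-integrable `[- L, L] (EFin \o g).
    by move=> cg; apply: continuous_compact_integrable => //;
      exact: continuous_subspaceT.
  have -> : eucl_int u = \int[@lebesgue_measure R]_(x in `[- L, L])
      eucl_int (fun v => u (cons_row x v)).
    rewrite eucl_intS [RHS]Rintegral_mkcond; apply: eq_Rintegral => x _.
    rewrite patchE; case: ifPn => // xL.
    by rewrite cut0// => xL'; move/negP: xL; apply; exact: mem_set.
  have := @le_normr_Rintegral _ _ R (@lebesgue_measure R) _ _ mL
    (integrableL _ (sect u cu)).
  move/le_trans; apply.
  apply: (@le_trans _ _ (\int[@lebesgue_measure R]_(x in `[- L, L])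
      (B * (2 * L) ^+ n))).
    apply: le_Rintegral => //.
    + exact: (integrable_norm (integrableL _ (sect u cu))).
    + by apply: integrableL => x; exact: cvg_cst.
    + by move=> x _; apply: IHb => //; exact: cont_supp_section.
  have B0 : 0 <= B by exact: le_trans (uB 0).
  have LE : fine (@lebesgue_measure R `[- L, L]%classic) <= 2 * L.
    rewrite lebesgue_measure_itv/=.
    by case: ifP => _ /=; [rewrite opprK mulr2n mulrDl mul1r|rewrite mulr_ge0].
  rewrite (@Rintegral_cst _ _ _ (@lebesgue_measure R) _ mL) exprSr mulrA.
  by apply: (ler_wpM2l _ LE); rewrite mulr_ge0 ?exprn_ge0 ?mulr_ge0.
Qed.

End EuclideanIntegral.

(** * Smooth functions, densities and the integral on the manifold *)

Section ManifoldStatics.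
Variables (R : realType) (n : nat) (M : topologicalType).
Variable A : oriented_atlas R n M.
Implicit Types (h k : M -> R) (a b : topform A) (i : idx A) (m : M).

Lemma cod_open i : open (cod i).
Proof. exact: image_open. Qed.

Lemma cod_param i x : cod i x -> dom i (param i x).
Proof. by case=> m dm <-; rewrite chartK. Qed.

Lemma CinftyD h k : Cinfty A h -> Cinfty A k -> Cinfty A (fun m => h m + k m).
Proof. by move=> sh sk i; apply: (smoothD (cod_open (i := i)));
  [exact: sh|exact: sk]. Qed.

Lemma CinftyM h k : Cinfty A h -> Cinfty A k -> Cinfty A (fun m => h m * k m).
Proof. by move=> sh sk i; apply: (smoothM (cod_open (i := i)));
  [exact: sh|exact: sk]. Qed.

Lemma Cinfty_cst (c : R) : Cinfty A (fun=> c).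
Proof. by move=> i; exact: (smooth_cst (cod_open (i := i))). Qed.

Lemma CinftyZ c h : Cinfty A h -> Cinfty A (fun m => c * h m).
Proof. by apply: CinftyM; exact: Cinfty_cst. Qed.

Lemma Cinfty_powR h p : Cinfty A h -> (forall m, 0 < h m) ->
  Cinfty A (fun m => h m `^ p).
Proof.
by move=> sh h0 i; apply: (smooth_powR (cod_open (i := i))) => [|x _];
  [exact: sh|exact: h0].
Qed.

Variable lambda : topform A.
Hypotheses (lambda_smooth : Omega lambda) (lambda_pos : form_pos lambda).

(** Both coefficients are multiplied by the same positive Jacobian determinant
    under a change of charts. *)
Lemma rn_chart a i m : Omega a -> dom i m -> rn a lambda m = a i m / lambda i m.
Proof.
move=> [_ ac _] dm; have [_ lc _] := lambda_smooth.
have dcm := dom_chart_at A m; rewrite /rn (ac _ _ _ dcm dm) (lc _ _ _ dcm dm).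
have /gt_eqF/negbT := transition_oriented dcm dm.
have /gt_eqF/negbT := lambda_pos dm.
by move=> l0 d0; field; apply/andP.
Qed.

Lemma rnK a : Omega a -> fmul (rn a lambda) lambda = a.
Proof.
move=> Oa; have [a0 _ _] := Oa; have [l0 _ _] := lambda_smooth.
apply/funext => i; apply/funext => m; rewrite /fmul.
have [dm|dm] := pselect (dom i m); last by rewrite a0// l0// mulr0.
by rewrite (rn_chart Oa dm) divfK// gt_eqF// lambda_pos.
Qed.

Lemma rn_fmul h : rn (fmul h lambda) lambda = h.
Proof.
apply/funext => m; rewrite /rn /fmul mulfK// gt_eqF//.
exact/lambda_pos/dom_chart_at.
Qed.

Lemma loc_lambda_gt0 i x : cod i x -> 0 < loc_form lambda i x.
Proof. by move=> /cod_param/lambda_pos. Qed.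

Lemma loc_lambda_smooth i : smooth_on (cod i) (loc_form lambda i).
Proof. by case: lambda_smooth. Qed.

(** The quotient is written as a product with a power, in order to use the rules
    for products and powers. *)
Lemma loc_rn a i x : Omega a -> cod i x ->
  loc_form a i x * loc_form lambda i x `^ (-1) = loc_fun (rn a lambda) i x.
Proof.
move=> Oa cx; rewrite powR_inv1; last exact/ltW/loc_lambda_gt0.
by rewrite /loc_fun /= (rn_chart Oa (cod_param cx)).
Qed.

Lemma Cinfty_rn a : Omega a -> Cinfty A (rn a lambda).
Proof.
move=> Oa i; have openi := cod_open (i := i).
apply: (eq_smooth_on openi (fun x => loc_rn Oa (x := x))).
apply: (smoothM openi); first by case: Oa.
exact: (smooth_powR openi (-1) (loc_lambda_smooth (i := i))
  (loc_lambda_gt0 (i := i))).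
Qed.

Lemma Omega_fmul h : Cinfty A h -> Omega (fmul h lambda).
Proof.
move=> sh; have [l0 lc ls] := lambda_smooth; split.
- by move=> i m dm; rewrite /fmul l0// mulr0.
- by move=> i j m di dj; rewrite /fmul (lc _ _ _ di dj) mulrCA.
- by move=> i; apply: (smoothM (cod_open (i := i))); [exact: sh|exact: ls].
Qed.

End ManifoldStatics.

Section SupportedPatch.
Variables (R : realType) (n : nat).

Lemma near_eq_continuous (T U : topologicalType) (f g : T -> U) (x : T) :
  {near x, f =1 g} -> {for x, continuous f} -> {for x, continuous g}.
Proof.
move=> fg cf; have fgx : f x = g x := nbhs_singleton fg.
rewrite /prop_for /continuous_at -fgx.
exact: cvg_trans (near_eq_cvg fg) cf.
Qed.

(** Extending by 0 outside V keeps continuity, as the function already vanishes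
    outside a compact subset of V. The box does not depend on the function. *)
Lemma cont_supp_patch (V K : set 'rV[R]_n) : open V -> compact K -> K `<=` V ->
  exists2 L, 0 <= L & forall w : 'rV[R]_n -> R,
    (forall x, V x -> {for x, continuous w}) ->
    (forall x, V x -> ~ K x -> w x = 0) -> cont_supp L (w \_ V).
Proof.
move=> oV cK KV; have /compact_bounded[B [_ Bb]] := cK.
have HK : hausdorff_space 'rV[R]_n by exact: norm_hausdorff.
have clK := compact_closed HK cK.
exists (`|B| + 1); first by rewrite addr_ge0.
move=> w cw w0; split=> x.
- have [Vx|Vx] := pselect (V x).
    apply: near_eq_continuous (cw x Vx);
      have : nbhs x V by exact: open_nbhs_nbhs.
    by apply: filterS => y Vy; rewrite patchE mem_set.
  apply: (@near_eq_continuous _ _ (cst 0)); last exact: cst_continuous.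
  have : nbhs x (~` K).
    by apply: open_nbhs_nbhs; split; [exact: closed_openC|move=> /KV].
  apply: filterS => y nKy; rewrite patchE.
  by case: ifPn => // /set_mem Vy; rewrite w0.
- move=> bx; rewrite patchE; case: ifPn => // /set_mem Vx.
  apply: w0 => // Kx; apply: bx => i /=; rewrite in_itv/= -ler_norml.
  apply: (@le_trans _ _ `|x|); last first.
    apply: (Bb (`|B| + 1)) => //; rewrite (le_lt_trans (ler_norm B))//.
    by rewrite ltrDl.
  rewrite [leRHS]mx_normrE; exact: (le_bigmax _ (fun ij => `|x ij.1 ij.2|)
    (ord0, i)).
Qed.

End SupportedPatch.

Section Integral.
Variables (R : realType) (n : nat) (M : topologicalType).
Variable A : oriented_atlas R n M.
Hypothesis compactM : compact [set: M].
Variables (rho : partition_of_unity A) (lambda : topform A).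
Hypotheses (lambda_smooth : Omega lambda) (lambda_pos : form_pos lambda).
Implicit Types (h k : M -> R) (m : M).

(** With lambda fixed, forms are replaced by functions; only the linearity and
    positivity of this functional are used below. *)
Definition integral_fun h : R := integral_form rho (fmul h lambda).
Local Notation J := integral_fun.

Definition pu_support (j : 'I_(pu_size rho)) : set 'rV[R]_n :=
  chart (pu_idx j) @` closure [set m | pu j m != 0].

Lemma compact_pu_support j : compact (pu_support j).
Proof.
apply: continuous_compact.
  apply: continuous_in_subspaceT => m /set_mem /(pu_supp (j := j)).
  exact: chart_continuous.
apply: (subclosed_compact _ compactM) => //; exact: closed_closure.
Qed.

Lemma pu_support_cod j : pu_support j `<=` cod (pu_idx j).
Proof. by move=> _ [m /(pu_supp (j := j)) dm <-]; exists m. Qed.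

(** Since the partition sums to 1, the supports of its members are a finite
    cover of M by compact sets that lie in charts. *)
Lemma pu_cover m : exists j, pu_support j (chart (@pu_idx _ _ _ _ rho j) m) /\
  dom (@pu_idx _ _ _ _ rho j) m.
Proof.
have [j pm] : exists j, pu (p := rho) j m != 0.
  apply/not_existsP => p0; have := pu_sum rho m.
  rewrite big1 => [/eqP|j _]; first by rewrite eq_sym oner_eq0.
  by apply/eqP/negPn/negP; exact: p0.
have cm : closure [set m | pu j m != 0] m by exact: subset_closure.
by exists j; split; [exists m|exact: pu_supp cm].
Qed.

Definition pu_density j h : 'rV[R]_n -> R :=
  loc_form (fmul (pu (p := rho) j) (fmul h lambda)) (pu_idx j) \_
    (cod (pu_idx j)).

Lemma pu_density_supp j : exists2 L, 0 <= L &
  forall h, Cinfty A h -> cont_supp L (pu_density j h).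
Proof.
have openj := cod_open (i := pu_idx j).
have [L L0 HL] := cont_supp_patch openj (@compact_pu_support j)
  (@pu_support_cod j).
exists L => // h sh; apply: HL => x cx.
  have [_ _ ls] := lambda_smooth.
  apply: differentiable_continuous; apply: smooth_differentiable cx.
  apply: (smoothM openj); first exact: pu_smooth.
  by apply: (smoothM openj); [exact: sh|exact: ls].
move=> nKx; rewrite /loc_form /= /fmul; have [->|pm] :=
  eqVneq (pu j (param (pu_idx j) x)) 0.
  by rewrite mul0r.
case: nKx; case: cx => m dm xE; exists m => //; apply: subset_closure => /=.
by move: pm; rewrite -xE chartK.
Qed.

Lemma integral_funE h : J h = \sum_j eucl_int (pu_density j h).
Proof. by []. Qed.

Lemma integral_fun_lin c h k : Cinfty A h -> Cinfty A k ->
  J (fun m => c * h m + k m) = c * J h + J k.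
Proof.
move=> sh sk; rewrite !integral_funE mulr_sumr -big_split/=.
apply: eq_bigr => j _; have [L L0 HL] := pu_density_supp j.
have [lin _] := eucl_int_lin_bound n L0.
rewrite -(lin _ _ c (HL h sh) (HL k sk)); congr eucl_int; apply/funext => x.
rewrite /pu_density !patchE; case: ifP => _; last by rewrite mulr0 addr0.
by rewrite /loc_form /= /fmul; ring.
Qed.

Lemma integral_fun_ge0 h : (forall m, 0 <= h m) -> 0 <= J h.
Proof.
move=> h0; rewrite integral_funE; apply: sumr_ge0 => j _.
apply: eucl_int_ge0 => x; rewrite /pu_density patchE;
  case: ifPn => // /set_mem cx.
rewrite /loc_form /= /fmul !mulr_ge0//; first exact: pu_ge0.
exact/ltW/lambda_pos/cod_param.
Qed.

Lemma eq_integral_fun h k : (forall m, h m = k m) -> J h = J k.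
Proof. by move=> /funext ->. Qed.

Lemma integral_fun0 : J (fun=> 0) = 0.
Proof.
have C0 := @Cinfty_cst R n M A 0.
have := integral_fun_lin 1 C0 C0; rewrite (eq_integral_fun (k := fun=> 0)).
  by move=> E; apply: (addrI (J (fun=> 0))); rewrite addr0 [RHS]E mul1r.
by move=> m; rewrite mulr0 addr0.
Qed.

Lemma integral_funZ c h : Cinfty A h -> J (fun m => c * h m) = c * J h.
Proof.
move=> sh; have := integral_fun_lin c sh (@Cinfty_cst R n M A 0).
by rewrite integral_fun0 addr0 => <-; apply: eq_integral_fun => m;
  rewrite addr0.
Qed.

Lemma integral_funB h k : Cinfty A h -> Cinfty A k ->
  J (fun m => h m - k m) = J h - J k.
Proof.
move=> sh sk; rewrite addrC -[- J k]mulN1r -integral_fun_lin//.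
by apply: eq_integral_fun => m; rewrite mulN1r addrC.
Qed.

Lemma le_integral_fun h k : Cinfty A h -> Cinfty A k ->
  (forall m, h m <= k m) ->
  J h <= J k.
Proof.
move=> sh sk hk; rewrite -subr_ge0 -integral_funB//.
by apply: integral_fun_ge0 => m; rewrite subr_ge0.
Qed.

Lemma integral_fun_norm_le B h : Cinfty A h -> (forall m, `|h m| <= B) ->
  `|J h| <= B * J (fun=> 1).
Proof.
move=> sh hB; have C1 := @Cinfty_cst R n M A 1.
rewrite ler_norml -mulNr -!integral_funZ//; apply/andP; split;
  apply: le_integral_fun; try exact: CinftyZ; move=> //= m; rewrite mulr1;
  by have := hB m; rewrite ler_norml => /andP[].
Qed.

End Integral.

(** * Smooth curves of smooth functions *)

Section FrechetRep.
Variables (R : realType) (n : nat) (M : topologicalType).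
Variable A : oriented_atlas R n M.
Variables (V : lmodType R) (rep : V -> idx A -> 'rV[R]_n -> R).
Hypothesis repE : forall k a b d i x,
  rep (k *: (a - b) - d) i x = k * (rep a i x - rep b i x) - rep d i x.

(** Separates the difference quotient into the quotients of the partial
    derivatives, to which the local rules apply. The hypothesis on rep expresses
    its linearity, for functions and for forms alike. *)
Lemma frechet_derivP (I : set R) (c : R -> V) t d :
  (forall r, I r -> forall i, smooth_on (cod i) (rep (c r) i)) ->
  (forall i, smooth_on (cod i) (rep d i)) -> I t ->
  frechet_deriv rep I c t d <->
  (forall (i : idx A) (K : set 'rV[R]_n) k, compact K -> K `<=` cod i ->
    smooth_slope K I t k (fun r => rep (c r) i) (rep d i)).
Proof.
move=> sc sd It.
have E r i s x : I r -> cod i x ->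
    iter_partial s (rep ((r - t)^-1 *: (c r - c t) - d) i) x =
    (iter_partial s (rep (c r) i) x - iter_partial s (rep (c t) i) x) / (r - t)
      -
    iter_partial s (rep d i) x.
  move=> Ir cx; have oi := cod_open (i := i).
  pose u x := (r - t)^-1 * (rep (c r) i x + -1 * rep (c t) i x).
  have su : smooth_on (cod i) (fun x => rep (c r) i x + -1 * rep (c t) i x).
    by apply: smoothD => //; [exact: sc|apply: smoothZ => //; exact: sc].
  rewrite (eq_iter_partial oi (v := fun x => u x + -1 * rep d i x) s)//.
    rewrite (iter_partialD oi)//; try exact: smoothZ.
    rewrite !(iter_partialZ oi)// (iter_partialD oi)//; last 2 first.
    - exact: sc.
    - by apply: smoothZ => //; exact: sc.
    - by rewrite (iter_partialZ oi)//; [ring|exact: sc].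
  by move=> y _; rewrite repE /u !mulN1r.
split=> [fd i K k cK Ki s _ e e0|sl i K s e cK Ki e0].
  have := fd i K s e cK Ki e0; apply: filterS2 (near_slope_domain I t) => r
    [Ir _].
  by move=> h x Kx; rewrite -E//; [exact: h|exact: Ki].
have := sl i K (size s) cK Ki s (leqnn _) e e0.
apply: filterS2 (near_slope_domain I t) => r [Ir _] h x Kx.
by rewrite E//; [exact: h|exact: Ki].
Qed.

End FrechetRep.

Section Curves.
Variables (R : realType) (n : nat) (M : topologicalType).
Variable A : oriented_atlas R n M.
Hypothesis compactM : compact [set: M].
Variables (rho : partition_of_unity A) (lambda : topform A).
Hypotheses (lambda_smooth : Omega lambda) (lambda_pos : form_pos lambda).
Variable I : set R.
Implicit Types (c u v : R -> M -> R) (d e f : M -> R) (t : R).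

Local Notation J := (integral_fun rho lambda).

Definition smooth_family c := forall r, I r -> Cinfty A (c r).

Definition fderiv c t d := frechet_deriv (@loc_fun R n M A) I c t (d : M -> R).

Lemma fderivP c t d : smooth_family c -> Cinfty A d -> I t ->
  fderiv c t d <->
  (forall (i : idx A) (K : set 'rV[R]_n) k, compact K -> K `<=` cod i ->
    smooth_slope K I t k (fun r => loc_fun (c r) i) (loc_fun d i)).
Proof.
move=> sc sd It; apply: frechet_derivP => // r Ir i; exact: sc.
Qed.

Lemma eq_fderiv c c' t d d' : smooth_family c -> Cinfty A d -> I t ->
  (forall r, I r -> c r = c' r) -> d = d' -> fderiv c t d -> fderiv c' t d'.
Proof.
move=> sc sd It cc <- /(fderivP sc sd It) fd.
have sc' : smooth_family c' by move=> r Ir; rewrite -cc//; exact: sc.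
apply/(fderivP sc' sd It) => i K k cK Ki.
by apply: (eq_smooth_slope (cod_open (i := i)) Ki It) (fd i K k cK Ki) => // r x
  /cc ->.
Qed.

Lemma fderiv_cst f t : Cinfty A f -> I t -> fderiv (fun=> f) t (fun=> 0).
Proof.
move=> sf It; apply/fderivP => //; first exact: Cinfty_cst.
by move=> i K k cK Ki; exact: (smooth_slope_cst I t (cod_open (i := i)) Ki).
Qed.

Lemma fderivD c c' t d d' : smooth_family c -> smooth_family c' ->
  Cinfty A d -> Cinfty A d' -> I t -> fderiv c t d -> fderiv c' t d' ->
  fderiv (fun r m => c r m + c' r m) t (fun m => d m + d' m).
Proof.
move=> sc sc' sd sd' It /(fderivP sc sd It) fd /(fderivP sc' sd' It) fd'.
apply/fderivP => //.
- by move=> r Ir; apply: CinftyD; [exact: sc|exact: sc'].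
- exact: CinftyD.
move=> i K k cK Ki.
apply: (smooth_slopeD (cod_open (i := i)) Ki It _ _ _ _ (fd i K k cK Ki)
  (fd' i K k cK Ki)).
- by move=> r Ir; exact: sc.
- by move=> r Ir; exact: sc'.
- exact: sd.
- exact: sd'.
Qed.

Lemma fderivM c c' t d d' : smooth_family c -> smooth_family c' ->
  Cinfty A d -> Cinfty A d' -> I t -> fderiv c t d -> fderiv c' t d' ->
  fderiv (fun r m => c r m * c' r m) t (fun m => d m * c' t m + c t m * d' m).
Proof.
move=> sc sc' sd sd' It /(fderivP sc sd It) fd /(fderivP sc' sd' It) fd'.
apply/fderivP => //.
- by move=> r Ir; apply: CinftyM; [exact: sc|exact: sc'].
- by apply: CinftyD; apply: CinftyM => //; [exact: sc'|exact: sc].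
move=> i K k cK Ki.
apply: (smooth_slopeM (cod_open (i := i)) cK Ki It _ _ _ _ (fd i K k cK Ki)
  (fd' i K k cK Ki)).
- by move=> r Ir; exact: sc.
- by move=> r Ir; exact: sc'.
- exact: sd.
- exact: sd'.
Qed.

Lemma fderiv_powR p c t d : smooth_family c ->
  (forall r m, I r -> 0 < c r m) -> Cinfty A d -> I t -> fderiv c t d ->
  fderiv (fun r m => c r m `^ p) t (fun m => p * c t m `^ (p - 1) * d m).
Proof.
move=> sc c0 sd It /(fderivP sc sd It) fd; apply/fderivP => //.
- by move=> r Ir; apply: Cinfty_powR => [|m]; [exact: sc|exact: c0].
- apply: CinftyM => //; apply: CinftyZ; apply: Cinfty_powR => [|m];
    [exact: sc|exact: c0].
move=> i K k cK Ki.
apply: (smooth_slope_powR (cod_open (i := i)) cK Ki It p _ _ _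
  (fd i K k cK Ki)).
- by move=> r Ir; exact: sc.
- by move=> r x Ir _; exact: c0.
- exact: sd.
Qed.

(** A real curve is a curve of functions on a one-point set. *)
Lemma real_derivP (u : R -> R) t a :
  real_deriv I u t a <-> uslope I t [set: unit] (fun r _ => u r) (fun=> a).
Proof.
split=> [/cvgrPdistC_lt h e e0|h].
  by apply: filterS (h e e0) => r hr x _.
by apply/cvgrPdistC_lt => e e0; apply: filterS (h e e0) => r /(_ tt Logic.I).
Qed.

Lemma fderiv_scalar (u : R -> R) t a : I t -> real_deriv I u t a ->
  fderiv (fun r _ => u r) t (fun=> a).
Proof.
move=> It /real_derivP ua; apply/fderivP => //.
- by move=> r _; exact: Cinfty_cst.
- exact: Cinfty_cst.
by move=> i K k cK Ki; exact: (smooth_slope_scalar (cod_open (i := i)) cK Ki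
  ua).
Qed.

(** Convergence on each of the finitely many compact supports of the partition
    of unity gives uniform convergence on M. *)
Lemma fderiv_unif c t d : smooth_family c -> Cinfty A d -> I t ->
  fderiv c t d -> uslope I t [set: M] c d.
Proof.
move=> sc sd It /(fderivP sc sd It) fd e e0.
have : \forall r \near within I t^', forall j : 'I_(pu_size rho), forall x,
    pu_support j x -> `|(loc_fun (c r) (pu_idx j) x - loc_fun (c t) (pu_idx j)
      x) / (r - t) -
      loc_fun d (pu_idx j) x| < e.
  apply: filter_forall => j.
  exact: (fd _ _ 0 (compact_pu_support compactM (j := j))
    (@pu_support_cod _ _ _ _ _ j) [::]).
apply: filterS => r h m _.
have [j [sm dm]] := pu_cover rho m.
by have := h j _ sm; rewrite /loc_fun /= chartK.
Qed.

Lemma fderiv_at m c t d : smooth_family c -> Cinfty A d -> I t ->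
  fderiv c t d -> real_deriv I (c ^~ m) t (d m).
Proof.
move=> sc sd It /(fderiv_unif sc sd It) fd; apply/real_derivP => e e0.
by apply: filterS (fd e e0) => r h _ _; exact: h.
Qed.

(** Positivity of J bounds J h by the supremum of h, so J is continuous for
    uniform convergence. *)
Lemma fderiv_integral c t d : smooth_family c -> Cinfty A d -> I t ->
  fderiv c t d -> real_deriv I (fun r => J (c r)) t (J d).
Proof.
move=> sc sd It /(fderiv_unif sc sd It) fd; apply/real_derivP => e e0.
have J10 : 0 < `|J (fun=> 1)| + 1 by rewrite ltr_wpDl.
have e20 : 0 < e / (`|J (fun=> 1)| + 1) by rewrite divr_gt0.
apply: filterS2 (near_slope_domain I t) (fd _ e20) => r [Ir _] h _ _.
have scr := sc r Ir; have sct := sc t It.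
have sB f g : Cinfty A f -> Cinfty A g -> Cinfty A (fun m => f m - g m).
  move=> sf sg; have := CinftyD sf (CinftyZ (-1) sg).
  by congr (Cinfty _); apply/funext => m; rewrite mulN1r.
have sq : Cinfty A (fun m => (r - t)^-1 * (c r m - c t m)).
  by apply: CinftyZ; exact: sB.
have -> : (J (c r) - J (c t)) / (r - t) - J d =
    J (fun m => (r - t)^-1 * (c r m - c t m) - d m).
  rewrite (integral_funB compactM rho lambda_smooth sq sd).
  rewrite (integral_funZ compactM rho lambda_smooth); last exact: sB.
  by rewrite (integral_funB compactM rho lambda_smooth scr sct) mulrC.
have hB m : `|(r - t)^-1 * (c r m - c t m) - d m| <= e / (`|J (fun=> 1)| + 1).
  by rewrite mulrC ltW// h.
have := integral_fun_norm_le compactM rho lambda_smooth lambda_pos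
  (sB _ _ sq sd) hB.
move=> /le_lt_trans; apply; rewrite mulrAC ltr_pdivrMr// ltr_pM2l//.
by rewrite (le_lt_trans (ler_norm _))// ltrDl.
Qed.

(** Passing from a form to its density with respect to lambda is the
    multiplication by a fixed smooth function in each chart. *)
Lemma form_derivP (a : R -> topform A) t b : (forall r, I r -> Omega (a r)) ->
  Omega b -> I t ->
  frechet_deriv (@loc_form R n M A) I a t b <->
  fderiv (fun r => rn (a r) lambda) t (rn b lambda).
Proof.
move=> Oa Ob It.
have sa : smooth_family (fun r => rn (a r) lambda).
  by move=> r Ir; apply: Cinfty_rn => //; exact: Oa.
have sb : Cinfty A (rn b lambda) by exact: Cinfty_rn.
have soa r i : I r -> smooth_on (cod i) (loc_form (a r) i) by move=> /Oa [].
have sob i : smooth_on (cod i) (loc_form b i) by case: Ob.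
have sl i := loc_lambda_smooth lambda_smooth (i := i).
have l0 i x := loc_lambda_gt0 lambda_pos (i := i) (x := x).
split.
- move=> /frechet_derivP fd; apply/fderivP => // i K k cK Ki.
  have oi := cod_open (i := i).
  have sv : smooth_on (cod i) (fun x => loc_form lambda i x `^ (-1)).
    by apply: (smooth_powR oi) => // x; exact: l0.
  have := smooth_slopeM oi cK Ki It (fun r => soa r i) (fun _ _ => sv) (sob i)
    (smooth_cst oi 0) (fd (fun _ _ _ _ _ _ => erefl) (fun r Ir i => soa r i Ir)
      sob It i K k cK Ki)
    (smooth_slope_cst I t oi Ki _).
  apply: (eq_smooth_slope oi Ki It).
    by move=> r x Ir cx; apply: loc_rn => //; exact: Oa.
  by move=> x cx; rewrite mulr0 addr0; exact: loc_rn.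
- move=> /(fderivP sa sb It) fd; apply/frechet_derivP => //.
    by move=> r Ir i; exact: soa.
  move=> i K k cK Ki; have oi := cod_open (i := i).
  have := smooth_slopeM oi cK Ki It (fun r Ir => sa r Ir i) (fun _ _ => sl i)
    (sb i)
    (smooth_cst oi 0) (fd i K k cK Ki) (smooth_slope_cst I t oi Ki _).
  have locE (g : topform A) x : Omega g ->
      loc_fun (rn g lambda) i x * loc_form lambda i x = loc_form g i x.
    by move=> Og; rewrite -[in RHS](rnK lambda_smooth lambda_pos Og).
  apply: (eq_smooth_slope oi Ki It).
    by move=> r x Ir cx; apply: locE; exact: Oa.
  by move=> x cx; rewrite mulr0 addr0; exact: locE.
Qed.

(** Curves of functions built from the curves in base. All the constructors are
    compatible with the derivation in time; CurveInt turns the integral into a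
    constant function. *)
Inductive curve_expr (base : set (R -> M -> R)) : (R -> M -> R) -> Prop :=
| CurveBase u of base u : curve_expr base u
| CurveCst f of Cinfty A f : curve_expr base (fun=> f)
| CurveAdd u v of curve_expr base u & curve_expr base v :
    curve_expr base (fun r m => u r m + v r m)
| CurveMul u v of curve_expr base u & curve_expr base v :
    curve_expr base (fun r m => u r m * v r m)
| CurvePow u p of curve_expr base u & (forall r m, I r -> 0 < u r m) :
    curve_expr base (fun r m => u r m `^ p)
| CurveInt u of curve_expr base u : curve_expr base (fun r _ => J (u r)).

Definition curve_deriv u v := forall t, I t -> fderiv u t (v t).

Section CurveExpr.
Variable base : set (R -> M -> R).
Hypothesis base_smooth : forall u, base u -> smooth_family u.
Hypothesis base_deriv :
  forall u, base u -> exists2 v, curve_expr base v & curve_deriv u v.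

Lemma curve_expr_family u : curve_expr base u -> smooth_family u.
Proof.
elim=> {u} [u|f sf|u v _ IHu _ IHv|u v _ IHu _ IHv|u p _ IHu u0|u _ _] r Ir.
- by move/base_smooth; exact.
- exact: sf.
- by apply: CinftyD; [exact: IHu|exact: IHv].
- by apply: CinftyM; [exact: IHu|exact: IHv].
- by apply: Cinfty_powR => [|m]; [exact: IHu|exact: u0].
- exact: Cinfty_cst.
Qed.

Lemma curve_expr_deriv u : curve_expr base u ->
  exists2 v, curve_expr base v & curve_deriv u v.
Proof.
elim=> {u} [u|f sf|u v eu [u' eu' uu'] ev [v' ev' vv']
  |u v eu [u' eu' uu'] ev [v' ev' vv']|u p eu [u' eu' uu'] u0|u eu
    [u' eu' uu']].
- exact: base_deriv.
- exists (fun _ _ => 0); first exact/CurveCst/Cinfty_cst.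
  by move=> t It; exact: fderiv_cst.
- exists (fun r m => u' r m + v' r m); first exact: CurveAdd.
  move=> t It; have su := curve_expr_family eu; have sv := curve_expr_family ev.
  have su' := curve_expr_family eu' It; have sv' := curve_expr_family ev' It.
  by apply: fderivD => //; [exact: uu'|exact: vv'].
- exists (fun r m => u' r m * v r m + u r m * v' r m).
    by apply: CurveAdd; exact: CurveMul.
  move=> t It; have su := curve_expr_family eu; have sv := curve_expr_family ev.
  have su' := curve_expr_family eu' It; have sv' := curve_expr_family ev' It.
  by apply: fderivM => //; [exact: uu'|exact: vv'].
- exists (fun r m => p * u r m `^ (p - 1) * u' r m).
    apply: CurveMul => //; apply: CurveMul; first exact/CurveCst/Cinfty_cst.
    exact: CurvePow.
  move=> t It; have su' := curve_expr_family eu' It.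
  by apply: fderiv_powR => //; [exact: curve_expr_family|exact: uu'].
- exists (fun r _ => J (u' r)); first exact: CurveInt.
  move=> t It; have su' := curve_expr_family eu' It.
  apply: fderiv_scalar => //; apply: fderiv_integral => //; last exact: uu'.
  exact: curve_expr_family.
Qed.

(** Each member of the class has a derivative in the class, so choice provides
    derivatives of all orders; the first two can be prescribed. *)
Lemma curve_expr_smooth_curve u v w : curve_expr base w -> curve_expr base u ->
  curve_expr base v -> curve_deriv u v -> curve_deriv v w ->
  exists D, [/\ smooth_curve (@loc_fun R n M A) (Cinfty A) I u D,
    D 1%N = v & D 2%N = w].
Proof.
move=> ew eu ev uv vw.
have /choice[next nextP] : forall x, exists y,
    curve_expr base x -> curve_expr base y /\ curve_deriv x y.
  move=> x; have [/curve_expr_deriv[y ey xy]|nx] := pselect (curve_expr base x).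
    by exists y.
  by exists x.
pose D k := match k with 0%N => u | 1%N => v | k.+2 => iter k next w end.
have De k : curve_expr base (D k).
  case: k => // -[|k] //=; elim: k => // k IH; exact: (nextP _ IH).1.
exists D; split => //; split=> // k t It; split;
  first exact: curve_expr_family (De k) _ It.
by move: k => [|[|k]]; [exact: uv|exact: vw|exact: (nextP _ (De k.+2)).2].
Qed.

End CurveExpr.

End Curves.

(** * Derivatives on intervals and autonomous equations on the line *)

Section RealDerivatives.
Variable R : realType.
Implicit Types (I : set R) (u v : R -> R) (t a b d : R).

Lemma bounded_by_unit (f : unit -> R) : bounded_by [set: unit] f.
Proof. by exists `|f tt| => -[]. Qed.
Local Hint Resolve bounded_by_unit : core.

Lemma real_deriv_cst I t a : real_deriv I (fun=> a) t 0.
Proof. by apply/real_derivP; exact: uslope_cst. Qed.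

Lemma real_deriv_id I t : real_deriv I id t 1.
Proof.
apply/real_derivP => e e0; apply: filterS (near_slope_domain I t) => r [_ rt] _
  _.
by rewrite divff// subrr normr0.
Qed.

Lemma eq_real_deriv I u v t d e : I t -> (forall r, I r -> u r = v r) ->
  d = e ->
  real_deriv I u t d -> real_deriv I v t e.
Proof.
move=> It uv <- /real_derivP h; apply/real_derivP.
by apply: uslope_eq h => // [r _ /uv|_ _]//; exact: uv.
Qed.

Lemma real_derivD I u v t d e : real_deriv I u t d -> real_deriv I v t e ->
  real_deriv I (fun r => u r + v r) t (d + e).
Proof. by move=> /real_derivP h /real_derivP k; apply/real_derivP;
  exact: uslopeD h k. Qed.

Lemma real_derivM I u v t d e : real_deriv I u t d -> real_deriv I v t e ->
  real_deriv I (fun r => u r * v r) t (d * v t + u t * e).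
Proof.
move=> /real_derivP h /real_derivP k; apply/real_derivP.
exact: (uslopeM (bounded_by_unit _) (bounded_by_unit _) _ _ h k).
Qed.

Lemma real_derivZ I c u t d : real_deriv I u t d ->
  real_deriv I (fun r => c * u r) t (c * d).
Proof.
move=> h; have := real_derivM (@real_deriv_cst I t c) h.
by rewrite mul0r add0r.
Qed.

Lemma real_derivB I u v t d e : real_deriv I u t d -> real_deriv I v t e ->
  real_deriv I (fun r => u r - v r) t (d - e).
Proof.
move=> h /(real_derivZ (c := -1)) k; have := real_derivD h k.
rewrite mulN1r; congr (real_deriv _ _ _ _); apply/funext => r.
by rewrite mulN1r.
Qed.

Lemma real_deriv_powR I p u t d : 0 < u t -> real_deriv I u t d ->
  real_deriv I (fun r => u r `^ p) t (p * u t `^ (p - 1) * d).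
Proof.
move=> u0 /real_derivP h; apply/real_derivP.
exact: (uslope_powR p u0 _ (bounded_by_unit _) _ h).
Qed.

Lemma real_derivV I u t d : 0 < u t -> (forall r, I r -> 0 < u r) -> I t ->
  real_deriv I u t d -> real_deriv I (fun r => (u r)^-1) t (- d / u t ^+ 2).
Proof.
move=> u0 uI It /(real_deriv_powR (p := -1) u0).
apply: eq_real_deriv => // [r Ir|]; first by rewrite powR_inv1// ltW ?uI.
rewrite (_ : -1 - 1 = - 2%:R); last by ring.
by rewrite powR_invn ?ltW// mulrC mulN1r mulrN mulNr.
Qed.

Lemma is_derive_real_deriv I u t d : is_derive t 1 u d -> real_deriv I u t d.
Proof.
move=> /is_derive1_caratheodory[g [ug gc gt]].
apply/real_derivP => e e0.
have /cvgr_distC_lt/(_ _ e0) h := gc.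
have : \forall r \near within I t^', `|g r - g t| < e.
  by rewrite near_withinE; apply: nbhs_dnbhs; apply: filterS h => r ? _.
apply: filterS2 (near_slope_domain I t) => r [_ rt] gr _ _.
by rewrite ug mulfK// -gt.
Qed.

(** By the Caratheodory form of the derivative of g. *)
Lemma real_deriv_comp I (g : R -> R) u t dg d : is_derive (u t) 1 g dg ->
  real_deriv I u t d -> real_deriv I (g \o u) t (dg * d).
Proof.
move=> /is_derive1_caratheodory[h [gh hc ht]] /[dup] ud /real_derivP us.
have hu : ulim0 I t [set: unit] (fun r _ => h (u r) - h (u t)).
  move=> e e0; have /cvgr_distC_lt/(_ _ e0)/nbhs_ballP[f /= f0 fP] := hc.
  have := uslope_ulim0 (bounded_by_unit _) us f0; apply: filterS => r ur _ _.
  by apply: fP; rewrite /ball/= distrC; exact: (ur tt).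
apply/real_derivP.
have h1 := ulim0M hu (uslope_ubounded (bounded_by_unit _) us).
have h2 := ulim0M us (bounded_by_ubounded I t (bounded_by_unit (fun=> dg))).
apply: (ulim0_eq _ (ulim0D h1 h2)).
apply: filterS (near_slope_domain I t) => r [_ rt] _ _ /=.
by rewrite gh ht; field.
Qed.

Lemma real_deriv_is_derive I u t d : nbhs t I -> real_deriv I u t d ->
  is_derive t 1 u d.
Proof.
move=> It /real_derivP h; apply/is_derive1_caratheodory.
exists (fun z => if z == t then d else (u z - u t) / (z - t)); split.
- move=> z; case: eqVneq => [->|zt]; first by rewrite !subrr mulr0.
  by rewrite divfK// subr_eq0.
- apply/cvgrPdistC_lt => e e0; rewrite eqxx.
  have := h e e0; rewrite !near_withinE.
  apply: filterS2 It => r Ir ur; case: eqVneq => [_|rt];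
    first by rewrite subrr normr0.
  exact: (ur rt Ir tt).
- by rewrite eqxx.
Qed.

Lemma real_deriv_continuous I u t d e : real_deriv I u t d -> 0 < e ->
  \forall r \near within I (nbhs t), `|u r - u t| < e.
Proof.
move=> /real_derivP h e0.
have := uslope_ulim0 (bounded_by_unit _) h e0.
rewrite !near_withinE; apply: filterS => r ur Ir.
have [->|rt] := eqVneq r t; first by rewrite subrr normr0.
exact: (ur rt Ir tt).
Qed.

Lemma real_derivS I I' u t d : I' `<=` I -> real_deriv I u t d ->
  real_deriv I' u t d.
Proof.
move=> II /real_derivP h; apply/real_derivP => e /h; rewrite !near_withinE.
by apply: filterS => r ur rt /II; exact: ur.
Qed.

Lemma real_deriv_within_continuous a b u (d : R -> R) :
  (forall t, t \in `[a, b] -> real_deriv `[a, b] u t (d t)) ->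
  {within `[a, b], continuous u}.
Proof.
move=> ud; apply/subspace_continuousP => t tab.
by apply/cvgrPdistC_lt => e e0; exact: real_deriv_continuous (ud t tab) e0.
Qed.

Lemma sub_interval I a b : is_interval I -> I a -> I b -> `[a, b] `<=` I.
Proof.
by move=> II Ia Ib r /=; rewrite in_itv/= => arb; exact: II Ia Ib r arb.
Qed.

Lemma real_deriv_mvt I u (d : R -> R) a b : is_interval I -> I a -> I b ->
  a < b -> (forall t, I t -> real_deriv I u t (d t)) ->
  exists2 c, I c & u b - u a = d c * (b - a).
Proof.
move=> II Ia Ib ab ud; have abI := sub_interval II Ia Ib.
have [||c] := @MVT R u d a b ab.
- move=> x xab; apply: (@real_deriv_is_derive `[a, b]).
    have : nbhs x `]a, b[%classic.
      by apply: open_nbhs_nbhs; split => //; exact: interval_open.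
    by apply: filterS => y; exact: subset_itv_oo_cc.
  apply: (real_derivS abI); apply: ud; apply: abI => /=.
  exact: subset_itv_oo_cc.
- apply: (@real_deriv_within_continuous a b u d) => t tab.
  by apply: (real_derivS abI); apply: ud; exact: abI.
- by move=> cab E; exists c => //; apply: abI; exact: subset_itv_oo_cc.
Qed.

Lemma real_deriv0_cst I u a b : is_interval I ->
  (forall t, I t -> real_deriv I u t 0) -> I a -> I b -> u a = u b.
Proof.
move=> II u0; have lt c d : I c -> I d -> c < d -> u c = u d.
  move=> Ic Id cd; have [_ _] := real_deriv_mvt II Ic Id cd u0.
  by rewrite mul0r => /eqP; rewrite subr_eq0 => /eqP.
by move=> Ia Ib; have [ab|ba|->//] := ltgtP a b;
  [exact: lt|apply/esym; exact: lt].
Qed.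

Lemma real_deriv_incr I u (d : R -> R) a b : is_interval I ->
  (forall t, I t -> real_deriv I u t (d t)) -> (forall t, I t -> 0 < d t) ->
  I a -> I b -> a < b -> u a < u b.
Proof.
move=> II ud d0 Ia Ib ab; have [c Ic E] := real_deriv_mvt II Ia Ib ab ud.
by rewrite -subr_gt0 E mulr_gt0 ?d0// subr_gt0.
Qed.

(** Each point of a proper interval is the limit of other points of it, so that
    one-sided derivatives at its ends are unique. *)
Lemma proper_interval_limit I t : proper_interval I -> I t ->
  ProperFilter (within I t^').
Proof.
move=> [II [a [b [Ia Ib ab]]]] It; split; last exact: within_filter.
rewrite -[within _ _ _]/(\forall r \near within I t^', False) near_withinE.
rewrite near_withinE => /nbhs_ballP[e /= e0 eP].
have [at_|ta] := ltP a t.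
- pose r := Num.max a (t - e / 2); have e20 : 0 < e / 2 by rewrite divr_gt0.
  have rt : r < t by rewrite gt_max at_ ltrBlDr ltrDl.
  apply: (eP r).
  + rewrite /ball/= gtr0_norm ?subr_gt0// ltrBlDr -ltrBlDl lt_max.
    apply/orP; right; rewrite ltrD2l ltrN2 [ltRHS](splitr e) ltrDl//.
  + by rewrite lt_eqF.
  + by apply: (II a t) => //; rewrite (ltW rt) andbT le_max lexx.
- have tb : t < b by exact: le_lt_trans ab.
  pose r := Num.min b (t + e / 2); have e20 : 0 < e / 2 by rewrite divr_gt0.
  have tr : t < r by rewrite lt_min tb ltrDl.
  apply: (eP r).
  + rewrite /ball/= distrC gtr0_norm ?subr_gt0// ltrBlDl gt_min.
    apply/orP; right; rewrite ltrD2l [ltRHS](splitr e) ltrDl//.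
  + by rewrite gt_eqF.
  + by apply: (II t b) => //; rewrite (ltW tr)/= ge_min lexx.
Qed.

Lemma real_deriv_unique I u t d e : proper_interval I -> I t ->
  real_deriv I u t d -> real_deriv I u t e -> d = e.
Proof.
move=> PI It; have FF := proper_interval_limit PI It.
exact: cvg_unique.
Qed.

Lemma itvoo_nbhs a b x : x \in `]a, b[ -> nbhs x `]a, b[%classic.
Proof. by move=> xab; apply: open_nbhs_nbhs; split => //;
  exact: interval_open. Qed.

Lemma antiderivative a b (h dh : R -> R) :
  (forall x, x \in `[a, b] -> real_deriv `[a, b] h x (dh x)) ->
  exists F : R -> R, forall x, x \in `]a, b[ -> is_derive x 1 F (h x).
Proof.
move=> hd; exists (fun x => \int[@lebesgue_measure R]_(t in `[a, x]) h t) => x.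
move=> /[dup] xab /[!in_itv]/= /andP[ax xb].
have hint : (@lebesgue_measure R).-integrable `[a, b] (EFin \o h).
  apply: continuous_compact_integrable; first exact: segment_compact.
  exact: real_deriv_within_continuous hd.
have hx : is_derive x 1 h (dh x).
  apply: (real_deriv_is_derive (I := `[a, b]%classic)).
    by apply: filterS (itvoo_nbhs xab) => y; exact: subset_itv_oo_cc.
  by apply: hd; exact: subset_itv_oo_cc.
have hc : {for x, continuous h}.
  by apply: differentiable_continuous; apply/derivable1_diffP; exact: ex_derive.
have [dF F'] := continuous_FTC1_closed xb hint ax hc.
split; first exact: dF.
by rewrite -derive1E; exact: F'.
Qed.

(** Theta is the primitive of 1 / H and tau its inverse function: tau is the
    solution of tau' = H (tau), and Theta x is the time at which it reaches x.
    *)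
Lemma autonomous_ode a b (H dH : R -> R) : a < 0 -> 0 < b ->
  (forall x, x \in `[a, b] -> 0 < H x) ->
  (forall x, x \in `[a, b] -> real_deriv `[a, b] H x (dH x)) ->
  exists Theta tau : R -> R,
    [/\ Theta 0 = 0, forall x, x \in `]a, b[ -> tau (Theta x) = x,
      forall x, x \in `]a, b[ -> is_derive x 1 Theta (H x)^-1
    & forall x y, x \in `]a, b[ -> y \in `]a, b[ -> x < y ->
        Theta x < Theta y /\
        forall t, Theta x <= t <= Theta y ->
          [/\ x <= tau t <= y, Theta (tau t) = t
            & is_derive t 1 tau (H (tau t))]].
Proof.
move=> a0 b0 H0 Hd.
have oc x : x \in `]a, b[ -> x \in `[a, b] by exact: subset_itv_oo_cc.
have Hinv x : x \in `[a, b] ->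
    real_deriv `[a, b] (fun x => (H x)^-1) x (- dH x / H x ^+ 2).
  move=> xab; apply: real_derivV; [exact: H0|exact: H0|exact: xab|exact: Hd].
have [F Fd] := antiderivative Hinv.
pose Th x := F x - F 0.
have Thd x : x \in `]a, b[ -> is_derive x 1 Th (H x)^-1.
  by move=> /Fd ?; rewrite -[X in is_derive _ _ _ X]subr0; exact: is_deriveB.
have Thr x : x \in `]a, b[ -> real_deriv `]a, b[ Th x (H x)^-1.
  by move=> /Thd; exact: is_derive_real_deriv.
have Thinc x y : x \in `]a, b[ -> y \in `]a, b[ -> x < y -> Th x < Th y.
  move=> xab yab; apply: (real_deriv_incr (I := `]a, b[%classic)
    (d := fun x => (H x)^-1)) => //.
    exact: interval_is_interval.
  by move=> z zab /=; rewrite invr_gt0; exact/H0/oc.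
have Thinj x y : x \in `]a, b[ -> y \in `]a, b[ -> Th x = Th y -> x = y.
  move=> xab yab E; have [xy|yx|//] := ltgtP x y.
    by have := Thinc _ _ xab yab xy; rewrite E ltxx.
  by have := Thinc _ _ yab xab yx; rewrite E ltxx.
have [tau tauP] : exists tau : R -> R, forall t x, x \in `]a,
  b[ -> Th x = t -> tau t = x.
  have /choice[tau tauP] : forall t, exists y, forall x, x \in `]a,
    b[ -> Th x = t -> y = x.
    move=> t; have [[y [yab yt]]|n] :=
      pselect (exists y, (y \in `]a, b[) /\ Th y = t).
      by exists y => x xab xt; apply: Thinj => //; rewrite yt.
    by exists 0 => x xab xt; case: n; exists x.
  by exists tau.
have z0 : (0 : R) \in `]a, b[ by rewrite in_itv/= a0.
exists Th, tau; split => //; first by rewrite /Th subrr.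
  by move=> x xab; exact: tauP.
move=> x y xab yab xy; split; first exact: Thinc.
have sub z : z \in `[x, y] -> z \in `]a, b[.
  move: xab yab; rewrite !in_itv/= => /andP[ax _] /andP[_ yb] /andP[xz zy].
  by rewrite (lt_le_trans ax xz) (le_lt_trans zy yb).
have Thc z : z \in `]a, b[ -> {for z, continuous Th}.
  move=> zab; apply: differentiable_continuous; apply/derivable1_diffP.
  by have := Thd z zab => -[].
move=> t txy; have [||z zxy zt] := @IVT R Th x y t (ltW xy).
- apply: continuous_in_subspaceT => z; rewrite inE/= => zxy.
  by apply: Thc; exact: sub.
- have /ltW lexy := Thinc x y xab yab xy.
  by rewrite (min_l lexy) (max_r lexy).
have zab := sub z zxy; have tz : tau t = z by exact: tauP.
rewrite tz; split => //.
rewrite -zt -[X in is_derive _ _ _ X]invrK; apply: is_derive_inverse.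
- apply: filterS (itvoo_nbhs zab) => w wab; exact: tauP.
- by apply: filterS (itvoo_nbhs zab) => w wab; exact: Thc.
- exact: Thd.
- by rewrite invr_neq0// gt_eqF//; exact/H0/oc.
Qed.

End RealDerivatives.

(** * The power map between densities and functions *)

Section PowerLaws.
Variable R : realType.
Implicit Types x y a b : R.

Lemma powR_add x a b : 0 < x -> x `^ (a + b) = x `^ a * x `^ b.
Proof. by move=> x0; rewrite powRD//; apply/implyP => _; rewrite gt_eqF. Qed.

Lemma powR_mulK x a b : 0 < x -> a * b = 1 -> (x `^ a) `^ b = x.
Proof. by move=> x0 ab; rewrite -powRrM ab powRr1// ltW. Qed.

Lemma powR_div x y a : 0 < x -> 0 < y -> (x / y) `^ a = x `^ a / y `^ a.
Proof.
move=> x0 y0; rewrite powRM ?invr_ge0 ?ltW//; congr (_ * _).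
by rewrite -powR_inv1 ?ltW// -powRrM mulN1r powRN.
Qed.

End PowerLaws.

Section Density.
Variables (R : realType) (n : nat) (M : topologicalType).
Variable A : oriented_atlas R n M.
Hypothesis compactM : compact [set: M].
Variables (rho : partition_of_unity A) (lambda : topform A).
Hypotheses (lambda_smooth : Omega lambda) (lambda_pos : form_pos lambda).
Implicit Types (h k f g : M -> R) (m : M) (mu : topform A).

Local Notation J := (integral_fun rho lambda).

Lemma Cinfty_bounded h : Cinfty A h -> exists2 B, 0 < B & forall m, `|h m| <= B.
Proof.
move=> sh; have bj (j : 'I_(pu_size rho)) : exists B, forall x,
  pu_support j x ->
    `|loc_fun h (pu_idx j) x| <= B.
  exact: (smooth_bounded_by [::] (compact_pu_support compactM (j := j))
    (@pu_support_cod _ _ _ _ _ j) (sh _)).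
have [B hB] := choice bj.
exists (1 + \sum_j `|B j|); first by rewrite ltr_wpDr// sumr_ge0.
move=> m; have [j [sm dm]] := pu_cover rho m.
have := hB j _ sm; rewrite /loc_fun /= chartK// => /le_trans; apply.
rewrite (le_trans (ler_norm _))// (bigD1 j)//= addrCA lerDl addr_ge0//.
by rewrite sumr_ge0.
Qed.

(** An upper bound of the inverse function, which is smooth as well. *)
Lemma Cinfty_pos_lower h : Cinfty A h -> (forall m, 0 < h m) ->
  exists2 c, 0 < c & forall m, c <= h m.
Proof.
move=> sh h0.
have [B B0 hB] := Cinfty_bounded (Cinfty_powR (-1) sh h0).
exists B^-1; first by rewrite invr_gt0.
move=> m; rewrite -[leRHS]invrK lef_pV2 ?posrE ?invr_gt0//.
have := hB m; rewrite powR_inv1; last exact/ltW/h0.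
by rewrite gtr0_norm// invr_gt0.
Qed.

Lemma integral_fun_gt0 h : 0 < J (fun=> 1) -> Cinfty A h ->
  (forall m, 0 < h m) -> 0 < J h.
Proof.
move=> J1 sh h0; have [c c0 ch] := Cinfty_pos_lower sh h0.
have C1 := @Cinfty_cst _ _ _ A 1.
apply: (@lt_le_trans _ _ (c * J (fun=> 1))); first by rewrite mulr_gt0.
rewrite -(integral_funZ compactM)//; apply: le_integral_fun => //;
  first exact: CinftyZ.
by move=> m; rewrite mulr1.
Qed.

(** A function with positive integral is dominated by a constant. The total
    volume can vanish only if M is empty, and the hypothesis excludes it. *)
Lemma integral_fun1_gt0 h : Cinfty A h -> 0 < J h -> 0 < J (fun=> 1).
Proof.
move=> sh Jh; have C1 := @Cinfty_cst _ _ _ A 1.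
have [B B0 hB] := Cinfty_bounded sh.
rewrite -(pmulr_rgt0 _ B0); apply: (lt_le_trans Jh).
rewrite -(integral_funZ compactM)//; apply: le_integral_fun => //;
  first exact: CinftyZ.
by move=> m; rewrite mulr1 (le_trans (ler_norm _)).
Qed.

Lemma integral_formE a : Omega a -> integral_form rho a = J (rn a lambda).
Proof. by move=> Oa; rewrite /integral_fun rnK. Qed.

Lemma integral_fmul h k : integral_form rho (fmul h (fmul k lambda)) =
  J (fun m => h m * k m).
Proof.
rewrite /integral_fun; congr integral_form; apply/funext => i;
  apply/funext => m.
by rewrite /fmul mulrA.
Qed.

Lemma Prob_rn mu : Prob rho mu -> [/\ Cinfty A (rn mu lambda),
  forall m, 0 < rn mu lambda m, J (rn mu lambda) = 1 &
  mu = fmul (rn mu lambda) lambda].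
Proof.
move=> [Om pm im]; split.
- exact: Cinfty_rn.
- by move=> m; have dm := dom_chart_at A m; rewrite divr_gt0//;
    [exact: pm|exact: lambda_pos].
- by rewrite -integral_formE.
- by rewrite rnK.
Qed.

Lemma fmul_Prob g : Cinfty A g -> (forall m, 0 < g m) -> J g = 1 ->
  Prob rho (fmul g lambda).
Proof.
move=> sg g0 Jg; split => //; first exact: Omega_fmul.
by move=> i m dm; rewrite mulr_gt0// lambda_pos.
Qed.

Section Alpha.
Variable alpha : R.
Hypothesis alpha_neq1 : alpha != 1.

Local Notation p := (2 / (1 - alpha)).
Local Notation q := ((1 - alpha) / 2).
Local Notation C := (2 / `|1 - alpha|).

Let oneBalpha : 1 - alpha != 0. Proof. by rewrite subr_eq0 eq_sym. Qed.

Lemma mulqp : q * p = 1.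
Proof. by field. Qed.

Lemma mulpq : p * q = 1.
Proof. by field. Qed.

Lemma p_neq0 : p != 0.
Proof. by rewrite mulf_neq0// invr_neq0. Qed.

Lemma C_gt0 : 0 < C.
Proof. by rewrite divr_gt0// normr_gt0. Qed.

(** The inverse of Phi on S_alpha. *)
Definition Psi f : topform A := fmul (fun m => (f m / C) `^ p) lambda.

(** The exponent of the constraint defining S_alpha is the inverse of that of
    Phi, so that the constraint is the total mass of the density. *)
Lemma Phi_S mu : Prob rho mu -> S_alpha rho lambda alpha (Phi lambda alpha mu).
Proof.
move=> /Prob_rn[sg g0 Jg _]; have C0 := C_gt0; split.
- by apply: CinftyZ; exact: Cinfty_powR.
- by move=> m; rewrite mulr_gt0// powR_gt0.
- rewrite /powl -/(J _) -[RHS]mulr1 -[X in _ = _ * X]Jg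
    -(integral_funZ compactM)//.
  apply: eq_integral_fun => m; rewrite /Phi powRM ?powR_ge0 ?ltW//.
  by rewrite powR_mulK// mulqp.
Qed.

Lemma Phi_Psi f : (forall m, 0 < f m) -> Phi lambda alpha (Psi f) = f.
Proof.
move=> f0; apply/funext => m; have C0 := C_gt0; rewrite /Phi /Psi rn_fmul//.
have fC : 0 < f m / C by rewrite divr_gt0.
by rewrite (powR_mulK fC mulpq) mulrC divfK// gt_eqF.
Qed.

Lemma Psi_Prob f : S_alpha rho lambda alpha f -> Prob rho (Psi f).
Proof.
move=> [sf f0 Jf]; have C0 := C_gt0.
have sfC : Cinfty A (fun m => f m / C).
  have := CinftyZ C^-1 sf; congr (Cinfty _ _).
  by apply/funext => m; rewrite mulrC.
apply: fmul_Prob.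
- by apply: Cinfty_powR => // m; rewrite divr_gt0.
- by move=> m; rewrite powR_gt0// divr_gt0.
rewrite (eq_integral_fun _ _ (k := fun m => (C `^ p)^-1 * f m `^ p));
  last first.
  by move=> m; rewrite powR_div// mulrC.
rewrite (integral_funZ compactM)//; last exact: Cinfty_powR.
by rewrite [J _]Jf mulVf// gt_eqF// powR_gt0.
Qed.

Lemma Psi_Phi mu : Prob rho mu -> Psi (Phi lambda alpha mu) = mu.
Proof.
move=> /Prob_rn[_ g0 _ mE]; have C0 := C_gt0; rewrite /Psi [RHS]mE.
congr fmul; apply/funext => m; rewrite /Phi mulrC mulKf ?gt_eqF//.
by rewrite powR_mulK// mulqp.
Qed.

Lemma Phi_invK mu : Prob rho mu ->
  Phi_inv rho lambda alpha (Phi lambda alpha mu) = mu.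
Proof.
move=> Pmu; apply: pinvKV; last exact/mem_set.
move=> mu1 mu2 /set_mem P1 /set_mem P2 E.
by rewrite -(Psi_Phi P1) -(Psi_Phi P2) E.
Qed.

Lemma Phi_invE f : S_alpha rho lambda alpha f ->
  Phi_inv rho lambda alpha f = Psi f.
Proof.
by move=> Sf; rewrite -{1}(@Phi_Psi f) ?Phi_invK//; [exact: Psi_Prob|case: Sf].
Qed.

Lemma S_integral1_gt0 f : S_alpha rho lambda alpha f -> 0 < J (fun=> 1).
Proof.
move=> [sf f0 Jf]; apply: (integral_fun1_gt0 (Cinfty_powR p sf f0)).
by rewrite [J _]Jf powR_gt0// C_gt0.
Qed.

End Alpha.
End Density.

(** * Correspondence of geodesics *)

Section Geodesics.
Variables (R : realType) (n : nat) (M : topologicalType).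
Variable A : oriented_atlas R n M.
Hypothesis compactM : compact [set: M].
Variables (rho : partition_of_unity A) (lambda : topform A).
Hypotheses (lambda_smooth : Omega lambda) (lambda_pos : form_pos lambda).
Variable alpha : R.
Hypothesis alpha_neq1 : alpha != 1.
Implicit Types (f g h : M -> R) (m : M) (mu : R -> topform A).

Local Notation J := (integral_fun rho lambda).
Local Notation p := (2 / (1 - alpha)).
Local Notation q := ((1 - alpha) / 2).
Local Notation C := (2 / `|1 - alpha|).
Local Notation smooth_fun_curve := (smooth_curve (@loc_fun R n M A) (Cinfty A)).

Let oneBalpha : 1 - alpha != 0. Proof. by rewrite subr_eq0 eq_sym. Qed.
Let C0 : 0 < C. Proof. exact: C_gt0. Qed.
Let qp : q * p = 1. Proof. exact: mulqp. Qed.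
Let pq : p * q = 1. Proof. exact: mulpq. Qed.

Lemma fderivZ I k (c : R -> M -> R) t (d : M -> R) : smooth_family A I c ->
  Cinfty A d -> I t ->
  fderiv A I c t d -> fderiv A I (fun r m => k * c r m) t (fun m => k * d m).
Proof.
move=> sc sd It fd.
have Ck : Cinfty A (fun=> k) by exact: Cinfty_cst.
have C00 : Cinfty A (fun=> 0 : R) by exact: Cinfty_cst.
have := fderivM (fun _ _ => Ck) sc C00 sd It (fderiv_cst Ck It) fd.
apply: eq_fderiv => //.
- by move=> r Ir; apply: CinftyM => //; exact: sc.
- by apply: CinftyD; apply: CinftyM => //; exact: sc.
- by apply/funext => m; rewrite mul0r add0r.
Qed.

Lemma fderiv_unique I (c : R -> M -> R) t (d e : M -> R) : proper_interval I ->
  smooth_family A I c -> Cinfty A d -> Cinfty A e -> I t ->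
  fderiv A I c t d -> fderiv A I c t e -> d = e.
Proof.
move=> PI sc sd se It fd fe; apply/funext => m.
have h1 : real_deriv I (c ^~ m) t (d m) :=
  fderiv_at compactM rho sc sd It fd.
have h2 : real_deriv I (c ^~ m) t (e m) :=
  fderiv_at compactM rho sc se It fe.
exact: real_deriv_unique PI It h1 h2.
Qed.

Section PowerCurve.
Variables (I : set R) (base : set (R -> M -> R)).
Hypothesis base_smooth : forall u, base u -> smooth_family A I u.
Hypothesis base_deriv : forall u, base u ->
  exists2 v, curve_expr rho lambda I base v & curve_deriv A I u v.

Local Notation expr := (curve_expr rho lambda I base).

(** Used with s = q to pass from densities to functions, and with s = p = 1/q to
    pass back. *)
Lemma power_curve u v w k s : expr u -> expr v -> expr w ->
  curve_deriv A I u v -> curve_deriv A I v w ->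
    (forall r m, I r -> 0 < u r m) ->
  exists D, [/\ smooth_fun_curve I (fun r m => k * u r m `^ s) D,
    D 1%N = (fun r m => k * (s * u r m `^ (s - 1) * v r m)) &
    D 2%N = (fun r m => k * (s * ((s - 1) * u r m `^ (s - 1 - 1) * v r m) * v r
      m +
                             s * u r m `^ (s - 1) * w r m))].
Proof.
move=> eu ev ew uv vw u0.
have fam x : expr x -> smooth_family A I x by exact: curve_expr_family.
have ecst a : expr (fun _ _ => a) by exact/CurveCst/Cinfty_cst.
have ep a : expr (fun r m => u r m `^ a) by exact: CurvePow.
have e1 : expr (fun r m => s * u r m `^ (s - 1) * v r m).
  by apply: CurveMul => //; exact: CurveMul.
have e2 : expr (fun r m => s * ((s - 1) * u r m `^ (s - 1 - 1) * v r m) * v r m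
  +
    s * u r m `^ (s - 1) * w r m).
  apply: CurveAdd; apply: CurveMul => //; apply: CurveMul => //.
  by apply: CurveMul => //; exact: CurveMul.
have dp a t : I t ->
    fderiv A I (fun r m => u r m `^ a) t
      (fun m => a * u t m `^ (a - 1) * v t m).
  by move=> It; apply: fderiv_powR => //; [exact: fam|exact: fam|exact: uv].
have e1' : expr (fun r m => (s - 1) * u r m `^ (s - 1 - 1) * v r m).
  by apply: CurveMul => //; exact: CurveMul.
apply: (curve_expr_smooth_curve compactM lambda_smooth lambda_pos base_smooth
  base_deriv).
- exact: CurveMul.
- exact: CurveMul.
- exact: CurveMul.
- move=> t It; apply: fderivZ => //; [exact: fam|exact: fam e1 _ It|exact: dp].
- move=> t It; apply: fderivZ => //; [exact: fam|exact: fam e2 _ It|].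
  apply: (@fderivM _ _ _ _ _ (fun r m => s * u r m `^ (s - 1)) v t
      (fun m => s * ((s - 1) * u t m `^ (s - 1 - 1) * v t m)) (w t)) => //.
  + by apply: fam; exact: CurveMul.
  + exact: fam.
  + by apply: CinftyZ; exact: fam e1' _ It.
  + exact: fam ew _ It.
  + apply: fderivZ => //; [exact: fam|exact: fam e1' _ It|exact: dp].
  + exact: vw.
Qed.

End PowerCurve.

(** The connection in terms of densities with respect to lambda; note that
    (1 + alpha) / 2 = 1 - q. *)
Lemma AC_nabla_fmul g h1 h2 : (forall m, 0 < g m) ->
  AC_nabla rho alpha (fmul g lambda) (fmul h1 lambda) (fmul h1 lambda)
    (fmul h2 lambda) =
  fmul (fun m => h2 m - (1 - q) *
    (h1 m ^+ 2 / g m - J (fun m => h1 m ^+ 2 / g m) * g m)) lambda.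
Proof.
move=> g0.
have rnE : rn (fmul h1 lambda) (fmul g lambda) = (fun m => h1 m / g m).
  apply/funext => m; rewrite /rn /fmul.
  have /gt_eqF/negbT l0 := lambda_pos (dom_chart_at A m).
  have /gt_eqF/negbT g00 := g0 m.
  by field; apply/andP.
rewrite /AC_nabla rnE -[X in integral_form _ X]/(fmul _ (fmul _ _))
  integral_fmul.
rewrite (eq_integral_fun _ _ (k := fun m => h1 m ^+ 2 / g m)); last first.
  move=> m; have /gt_eqF/negbT g00 := g0 m.
  by rewrite -[(_ \* _) m]/(_ * _); field.
have -> : 1 - q = (1 + alpha) / 2 by field.
apply/funext => i; apply/funext => m; rewrite /fmul.
set K := J _.
rewrite -[LHS]/(h2 m * lambda i m - (1 + alpha) / 2 *
  (h1 m / g m * (h1 m * lambda i m) - K * (g m * lambda i m))).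
by ring.
Qed.

Lemma fmul_eq0 h : fmul h lambda = 0 <-> forall m, h m = 0.
Proof.
split=> [h0 m|h0].
  have := congr1 (fun a : topform A => a (chart_at A m) m) h0.
  rewrite /fmul -[RHS]/(0 : R) => /eqP.
  by rewrite mulf_eq0 (gt_eqF (lambda_pos (dom_chart_at A m))) orbF => /eqP.
by apply/funext => i; apply/funext => m; rewrite /fmul h0 mul0r.
Qed.

(** The factor C q is the sign of 1 - alpha. *)
Lemma Phi_deriv I mu t a : (forall r, I r -> Prob rho (mu r)) -> I t ->
  Omega a ->
  frechet_deriv (@loc_form R n M A) I mu t a ->
  fderiv A I (fun r => Phi lambda alpha (mu r)) t (TPhi lambda alpha (mu t) a).
Proof.
move=> Pmu It Oa; have Om r : I r -> Omega (mu r) by move=> /Pmu[].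
move=> /(form_derivP lambda_smooth lambda_pos Om Oa It) fd.
have sg : smooth_family A I (fun r => rn (mu r) lambda) by move=> r /Pmu
  /(Prob_rn lambda_smooth lambda_pos)[].
have g0 r m : I r -> 0 < rn (mu r) lambda m.
  by move=> /Pmu /(Prob_rn lambda_smooth lambda_pos)[].
have sh : Cinfty A (rn a lambda) by exact: Cinfty_rn.
have sp b r : I r -> Cinfty A (fun m => rn (mu r) lambda m `^ b).
  by move=> Ir; apply: Cinfty_powR => [|m]; [exact: sg|exact: g0].
have sd : Cinfty A (fun m => q * rn (mu t) lambda m `^ (q - 1) * rn a lambda m).
  by apply: CinftyM => //; apply: CinftyZ; exact: sp.
have := fderivZ C (fun r => sp q r) sd It (fderiv_powR q sg g0 sh It fd).
apply: eq_fderiv => //.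
- by move=> r Ir; apply: CinftyZ; exact: sp.
- exact: CinftyZ.
apply/funext => m; rewrite /TPhi.
have -> : q - 1 = - ((1 + alpha) / 2) by field.
have <- : C * q = Num.sg (1 - alpha) by rewrite [X in _ * (X / 2)]numEsg; field;
  rewrite normr_eq0.
by ring.
Qed.

(** With gamma = C g^q one has
    gamma'' = C q g^(q-1) (g'' - (1 - q) g'^2 / g), and the geodesic equation
    makes the last factor a multiple of g by a scalar. *)
Lemma AC_S_geodesic I mu : proper_interval I -> AC_geodesic rho alpha I mu ->
  S_geodesic rho lambda alpha I (fun t => Phi lambda alpha (mu t)).
Proof.
move=> PI [Pmu [D [[D0 Dd] ac]]]; split=> [t /Pmu|]; first exact: Phi_S.
pose g k r := rn (D k r) lambda.
have OD k r : I r -> Omega (D k r) by move=> /(Dd k)[].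
pose base := [set b | exists k, b = g k].
have sg k : smooth_family A I (g k) by move=> r Ir; apply: Cinfty_rn => //;
  exact: OD.
have gd k : curve_deriv A I (g k) (g k.+1).
  move=> t It; have O1 := OD k.+1 t It.
  by apply/(form_derivP lambda_smooth lambda_pos (OD k) O1 It); have [] :=
    Dd k t It.
have eg k : curve_expr rho lambda I base (g k) by apply: CurveBase; exists k.
have bs u : base u -> smooth_family A I u by move=> [k ->].
have bd u : base u -> exists2 v, curve_expr rho lambda I base v &
  curve_deriv A I u v.
  by move=> [k ->]; exists (g k.+1).
have g0 r m : I r -> 0 < g 0%N r m.
  by move=> Ir; rewrite /g D0//; have [] :=
    Prob_rn lambda_smooth lambda_pos (Pmu r Ir).
have [E [[E0 Ed] E1 E2]] := power_curve bs bd C q (eg 0%N) (eg 1%N) (eg 2)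
  (gd 0%N) (gd 1%N) g0.
exists E; split.
  by split=> // t It; rewrite E0// /Phi /g D0.
move=> t It; split.
  split; first exact: Cinfty_cst.
  rewrite (_ : fmul 0 _ = fmul (fun=> 0) lambda); first exact: integral_fun0.
  by apply/funext => i; apply/funext => m;
    rewrite /fmul -[(0 : M -> R) m]/(0 : R) !mul0r.
pose K := J (fun m => g 1%N t m ^+ 2 / g 0%N t m).
exists (- q * (1 - q) * K); rewrite subr0 E2; apply/funext => m.
have := ac t It; have [_ gt _ muE] :=
  Prob_rn lambda_smooth lambda_pos (Pmu t It).
rewrite muE -(rnK lambda_smooth lambda_pos (OD 1%N t It))
  -(rnK lambda_smooth lambda_pos (OD 2 t It)).
rewrite AC_nabla_fmul// => /fmul_eq0/(_ m)/eqP; rewrite subr_eq0 => /eqP.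
rewrite -(D0 t It) -/(g 0%N t) -/(g 1%N t) -/(g 2 t) -/K => ->.
rewrite -[RHS]/(- q * (1 - q) * K *
  (C * rn (fmul (g 0%N t) lambda) lambda m `^ q)) rn_fmul//.
have gm := g0 t m It; have /gt_eqF/negbT gm0 := gm.
have -> : g 0%N t m `^ q = g 0%N t m `^ (q - 1 - 1) * (g 0%N t m * g 0%N t m).
  by rewrite -{3 4}(powRr1 (ltW gm)) -!powR_add//; congr (_ `^ _); ring.
have -> : g 0%N t m `^ (q - 1) = g 0%N t m `^ (q - 1 - 1) * g 0%N t m.
  by rewrite -{3}(powRr1 (ltW gm)) -powR_add//; congr (_ `^ _); ring.
have alg (c a P x y k : R) : x != 0 ->
    c * (a * ((a - 1) * P * y) * y + a * (P * x) *
      ((1 - a) * (y ^+ 2 / x - k * x))) =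
    - a * (1 - a) * k * (c * (P * (x * x))).
  by move=> x0; field.
exact: alg.
Qed.

(** With g = (gamma / C)^p and gamma'' = c gamma one has
    g'' = (1 - q) g'^2 / g + p c g. Integrating, with J g = 1 and J g'' = 0,
    gives p c = - (1 - q) J (g'^2 / g). *)
Lemma S_AC_geodesic I (gamma : R -> M -> R) : proper_interval I ->
  S_geodesic rho lambda alpha I gamma ->
  AC_geodesic rho alpha I (fun t => Psi lambda alpha (gamma t)).
Proof.
move=> PI [Sg [D [[D0 Dd] geo]]]; split=> [t /Sg|]; first exact: Psi_Prob.
have sD k : smooth_family A I (D k) by move=> r Ir; have [] := Dd k r Ir.
have dD k : curve_deriv A I (D k) (D k.+1) by move=> r Ir; have [] := Dd k r Ir.
pose base := [set b | exists k, b = D k].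
have eD k : curve_expr rho lambda I base (D k) by apply: CurveBase; exists k.
have bs u : base u -> smooth_family A I u by move=> [k ->].
have bd u : base u -> exists2 v, curve_expr rho lambda I base v &
  curve_deriv A I u v.
  by move=> [k ->]; exists (D k.+1).
have D00 r m : I r -> 0 < D 0%N r m by move=> Ir; rewrite D0//; have [] :=
  Sg r Ir.
have [E [[E0 Ed] E1 E2]] := power_curve bs bd (C `^ p)^-1 p (eD 0%N) (eD 1%N)
  (eD 2) (dD 0%N) (dD 1%N) D00.
have PsiE t : I t -> Psi lambda alpha (gamma t) = fmul (E 0%N t) lambda.
  move=> It; rewrite E0// /Psi; congr fmul; apply/funext => m.
  have gt : 0 < gamma t m by have [] := Sg t It.
  by rewrite (powR_div p gt C0) mulrC D0.
have sE k : smooth_family A I (E k) by move=> r Ir; have [] := Ed k r Ir.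
exists (fun k t => fmul (E k t) lambda); split.
  split=> [t It|k t It]; first by rewrite PsiE.
  split; first by apply: Omega_fmul => //; exact: sE.
  have OE j r : I r -> Omega (fmul (E j r) lambda).
    by move=> Ir; apply: Omega_fmul => //; exact: sE.
  apply/(form_derivP lambda_smooth lambda_pos (OE k) (OE k.+1 t It) It).
  rewrite rn_fmul//; have [_] := Ed k t It.
  congr frechet_deriv.
  by apply/funext => r; rewrite rn_fmul.
have JE r : I r -> J (E 0%N r) = 1.
  move=> Ir; have [_ _ JP _] := Prob_rn lambda_smooth lambda_pos
    (Psi_Prob compactM lambda_smooth lambda_pos alpha_neq1 (Sg r Ir)).
  by rewrite -JP PsiE// rn_fmul.
have dJ k r : I r -> real_deriv I (fun t => J (E k t)) r (J (E k.+1 r)).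
  move=> Ir; apply: fderiv_integral => //; first exact: sE.
  by have [] := Ed k r Ir.
have J1 r : I r -> J (E 1%N r) = 0.
  move=> Ir; apply: (real_deriv_unique PI Ir (dJ 0%N r Ir)).
  by apply: eq_real_deriv (real_deriv_cst I r 1) => // s Is; rewrite JE.
have J2 r : I r -> J (E 2%N r) = 0.
  move=> Ir; apply: (real_deriv_unique PI Ir (dJ 1%N r Ir)).
  by apply: eq_real_deriv (real_deriv_cst I r 0) => // s Is; rewrite J1.
move=> t It; rewrite PsiE//.
have E00 m : 0 < E 0%N t m by rewrite E0// mulr_gt0 ?invr_gt0 ?powR_gt0// D00.
rewrite AC_nabla_fmul//; apply/fmul_eq0.
have [_ [c cE]] := geo t It.
have DE m : D 2 t m = c * D 0%N t m.
  by have := congr1 (fun h : M -> R => h m) cE; rewrite subr0 D0.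
have EE m : E 2 t m = (1 - q) * (E 1%N t m ^+ 2 / E 0%N t m) + p * c * E 0%N t
  m.
  rewrite E2 E1 (E0 t It) DE.
  have Dm := D00 t m It; have /gt_eqF/negbT Dm0 := Dm.
  have /gt_eqF/negbT P0 := powR_gt0 (p - 1 - 1) Dm.
  have /gt_eqF/negbT Cp0 := powR_gt0 p C0.
  have -> : D 0%N t m `^ p = D 0%N t m `^ (p - 1 - 1) * (D 0%N t m * D 0%N t m).
    by rewrite -{3 4}(powRr1 (ltW Dm)) -!powR_add//; congr (_ `^ _); ring.
  have -> : D 0%N t m `^ (p - 1) = D 0%N t m `^ (p - 1 - 1) * D 0%N t m.
    by rewrite -{3}(powRr1 (ltW Dm)) -powR_add//; congr (_ `^ _); ring.
  have alg (b a P k x y : R) : x != 0 -> P != 0 -> k != 0 -> b * a = 1 ->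
      k^-1 * (a * ((a - 1) * P * y) * y + a * (P * x) * (c * x)) =
      (1 - b) * ((k^-1 * (a * (P * x) * y)) ^+ 2 / (k^-1 * (P * (x * x)))) +
      a * c * (k^-1 * (P * (x * x))).
    move=> x0 P00 k0 ba; have a0 : a != 0.
      by apply/eqP => a0; move: ba; rewrite a0 mulr0 => /eqP;
        rewrite eq_sym oner_eq0.
    have -> : b = a^-1 by apply: (mulIf a0); rewrite ba mulVf.
    by field; rewrite a0 k0 P00 x0.
  exact: alg.
have sE0 := sE 0%N t It; have sE1 := sE 1%N t It.
have sEE : Cinfty A (fun m => E 1%N t m ^+ 2 / E 0%N t m).
  have := CinftyM (CinftyM sE1 sE1) (Cinfty_powR (-1) sE0 E00).
  by congr (Cinfty _ _); apply/funext => m; rewrite powR_inv1// ltW.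
set K := J (fun m => _ / _).
have pcE : p * c = - (1 - q) * K.
  have := J2 t It; rewrite (eq_integral_fun _ _ EE).
  rewrite (integral_fun_lin compactM)//; last exact: CinftyZ.
  rewrite (integral_funZ compactM)// JE// mulr1 -/K => /eqP.
  by rewrite addrC addr_eq0 -mulNr => /eqP.
by move=> m; rewrite EE pcE; ring.
Qed.

End Geodesics.

(** * Projected straight lines are geodesics *)

(** The Wronskian of z and y is constant, hence 0, so that z / y is constant. *)
Lemma linear_ode_zero (R : realType) (I : set R) (t0 : R) (y y1 z z1 c : R -> R)
  :
  is_interval I -> I t0 -> (forall t, I t -> 0 < y t) ->
  (forall t, I t -> real_deriv I y t (y1 t)) ->
  (forall t, I t -> real_deriv I y1 t (c t * y t)) ->
  (forall t, I t -> real_deriv I z t (z1 t)) ->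
  (forall t, I t -> real_deriv I z1 t (c t * z t)) ->
  z t0 = 0 -> z1 t0 = 0 -> forall t, I t -> z t = 0.
Proof.
move=> II It0 y0 dy dy1 dz dz1 z0 z10 t It.
have W0 s : I s -> z1 s * y s - z s * y1 s = 0.
  move=> Is; rewrite -[RHS](_ : z1 t0 * y t0 - z t0 * y1 t0 = 0); last first.
    by rewrite z0 z10 !mul0r subrr.
  apply: (@real_deriv0_cst _ I (fun s => z1 s * y s - z s * y1 s)) => // r Ir.
  have := real_derivB (real_derivM (dz1 r Ir) (dy r Ir))
    (real_derivM (dz r Ir) (dy1 r Ir)).
  by apply: eq_real_deriv => //; ring.
have : z t * (y t)^-1 = z t0 * (y t0)^-1.
  apply: (@real_deriv0_cst _ I (fun s => z s * (y s)^-1)) => // r Ir.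
  have := real_derivM (dz r Ir) (real_derivV (y0 r Ir) y0 Ir (dy r Ir)).
  apply: eq_real_deriv => //; have /gt_eqF/negbT yr0 := y0 r Ir.
  have -> : z1 r / y r + z r * (- y1 r / y r ^+ 2) = (z1 r * y r - z r * y1 r)
    / y r ^+ 2.
    by field.
  by rewrite W0// mul0r.
have /gt_eqF/negbT yt0 := y0 t It.
by rewrite z0 mul0r => /eqP; rewrite mulf_eq0 invr_eq0 (negbTE yt0) orbF
  => /eqP.
Qed.

Section Solutions.
Variables (R : realType) (n : nat) (M : topologicalType).
Variable A : oriented_atlas R n M.
Hypothesis compactM : compact [set: M].
Variables (rho : partition_of_unity A) (lambda : topform A).
Hypotheses (lambda_smooth : Omega lambda) (lambda_pos : form_pos lambda).
Variable alpha : R.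
Hypothesis alpha_neq1 : alpha != 1.
Implicit Types (f g h xi : M -> R) (m : M) (I : set R) (tau : R -> R).

Local Notation J := (integral_fun rho lambda).
Local Notation p := (2 / (1 - alpha)).
Local Notation q := ((1 - alpha) / 2).
Local Notation C := (2 / `|1 - alpha|).
Local Notation S_geo := (S_geodesic rho lambda alpha).
Local Notation explicit := (explicit_geodesic rho lambda alpha).

Let oneBalpha : 1 - alpha != 0. Proof. by rewrite subr_eq0 eq_sym. Qed.
Let C0 : 0 < C. Proof. exact: C_gt0. Qed.
Let qp : q * p = 1. Proof. exact: mulqp. Qed.
Let pq : p * q = 1. Proof. exact: mulpq. Qed.

Section Line.
Variables f xi : M -> R.
Hypotheses (sf : Cinfty A f) (sxi : Cinfty A xi) (J1 : 0 < J (fun=> 1)).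

Definition line (s : R) : M -> R := fun m => f m + s * xi m.
(** The function G of the parameter; the constraint of S_alpha is
    G = C^p. *)
Definition line_volume (s : R) := J (fun m => line s m `^ p).
(** The function N of the parameter, with p N = dG/ds. *)
Definition line_pairing (s : R) := J (fun m => xi m * line s m `^ (p - 1)).
Definition line_pos (s : R) := forall m, 0 < line s m.
Local Notation G := line_volume.
Local Notation N := line_pairing.

Definition tau_equation I tau tau1 tau2 := forall t, I t ->
  [/\ real_deriv I tau t (tau1 t), real_deriv I tau1 t (tau2 t),
    line_pos (tau t) & tau2 t = 2 * (N (tau t) / G (tau t)) * tau1 t ^+ 2].

Lemma tau_solutionE I tau : tau_solution rho lambda alpha f xi I tau <->
  exists tau1 tau2, [/\ tau 0 = 0, tau1 0 = 1 & tau_equation I tau tau1 tau2].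
Proof.
have NE s : integral_form rho (fmul xi
  (powl lambda (f + s *: xi) ((1 + alpha) / (1 - alpha)))) = N s.
  by rewrite integral_fmul /N (_ : (1 + alpha) / (1 - alpha) = p - 1)//; field.
by split=> -[tau1 [tau2 [? ? eqn]]]; exists tau1, tau2;
  split=> // t /eqn[? ? ? E];
  split=> //; rewrite E NE.
Qed.

Lemma line_smooth s : Cinfty A (line s).
Proof. by apply: CinftyD => //; exact: CinftyZ. Qed.

Lemma line_volume_gt0 s : line_pos s -> 0 < G s.
Proof.
move=> w0; apply: (integral_fun_gt0 compactM lambda_smooth lambda_pos J1).
  by apply: Cinfty_powR => //; exact: line_smooth.
by move=> m; rewrite powR_gt0.
Qed.

Lemma fderiv_line I tau t d : I t -> real_deriv I tau t d ->
  fderiv A I (fun r => line (tau r)) t (fun m => d * xi m).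
Proof.
move=> It dtau; have sc (a : R) : Cinfty A (fun=> a) by exact: Cinfty_cst.
have h := fderivM (fun r _ => sc (tau r)) (fun _ _ => sxi) (sc d) (sc 0) It
  (fderiv_scalar It dtau) (fderiv_cst sxi It).
have sh : Cinfty A (fun m => d * xi m + tau t * 0) by apply: CinftyD;
  exact: CinftyM.
have := fderivD (fun _ _ => sf) (fun r _ => CinftyZ (tau r) sxi) (sc 0) sh It
  (fderiv_cst sf It) h.
apply: eq_fderiv => //.
- by move=> r Ir; exact: line_smooth.
- exact: CinftyD.
- by apply/funext => m; rewrite mulr0 addr0 add0r.
Qed.

Lemma line_volume_deriv I tau t d : (forall r, I r -> line_pos (tau r)) ->
  I t ->
  real_deriv I tau t d ->
  real_deriv I (fun r => G (tau r)) t (p * N (tau t) * d).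
Proof.
move=> w0 It dtau; have sl r : I r -> Cinfty A (line (tau r)) by move=> _;
  exact: line_smooth.
have sd : Cinfty A (fun m => d * xi m) by exact: CinftyZ.
have sp a : Cinfty A (fun m => line (tau t) m `^ a).
  by apply: Cinfty_powR => [|m]; [exact: sl|exact: w0].
have fd := fderiv_powR p sl (fun r m Ir => w0 r Ir m) sd It
  (fderiv_line It dtau).
have spl : smooth_family A I (fun r m => line (tau r) m `^ p).
  by move=> r Ir; apply: Cinfty_powR => [|m]; [exact: sl|exact: w0].
have spd : Cinfty A (fun m => p * line (tau t) m `^ (p - 1) * (d * xi m)).
  by apply: CinftyM => //; exact: CinftyZ.
have := @fderiv_integral _ _ _ _ compactM rho _ lambda_smooth lambda_pos _ _ _ _
  spl spd It fd.
apply: eq_real_deriv => //; rewrite /N mulrAC -(integral_funZ compactM)//;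
  last exact: CinftyM.
by apply: eq_integral_fun => m; ring.
Qed.

Lemma real_deriv_volume_powR I tau t d a : (forall r, I r -> line_pos (tau r))
  ->
  I t -> real_deriv I tau t d ->
  real_deriv I (fun r => G (tau r) `^ a) t
    (a * G (tau t) `^ (a - 1) * (p * N (tau t) * d)).
Proof.
move=> w0 It dtau; apply: (@real_deriv_powR _ _ _ (fun r => G (tau r))).
  exact/line_volume_gt0/w0.
exact: line_volume_deriv.
Qed.

(** The derivative of tau1 G^(-2q) vanishes by the equation of tau, as
    G' = p N tau1 and q p = 1. *)
Lemma first_integral I tau tau1 tau2 t0 t : is_interval I ->
  tau_equation I tau tau1 tau2 -> I t0 -> I t ->
  tau1 t = tau1 t0 / G (tau t0) `^ (2 * q) * G (tau t) `^ (2 * q).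
Proof.
move=> II eqn It0 It.
have w0 r : I r -> line_pos (tau r) by move=> /eqn[].
have G0 r : I r -> 0 < G (tau r) by move=> /w0/line_volume_gt0.
have : tau1 t * G (tau t) `^ (- (2 * q)) = tau1 t0 * G (tau t0) `^ (- (2 * q)).
  apply: (@real_deriv0_cst _ I (fun r => tau1 r * G (tau r) `^ (- (2 * q))))
    => // r Ir.
  have [dtau dtau1 _ tau2E] := eqn r Ir.
  have := real_derivM dtau1 (real_deriv_volume_powR (a := - (2 * q)) w0 Ir
    dtau).
  apply: eq_real_deriv => //.
  have Gr := G0 r Ir; have /gt_eqF/negbT Gr0 := Gr.
  rewrite tau2E powR_add// powR_inv1 ?(ltW Gr)//.
  have -> : - (2 * q) * (G (tau r) `^ (- (2 * q)) / G (tau r)) *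
    (p * N (tau r) * tau1 r) =
      - (2 * (q * p)) * (G (tau r) `^ (- (2 * q)) / G (tau r)) *
          (N (tau r) * tau1 r) by ring.
  by rewrite qp; move: (_ `^ _) => P; field.
rewrite !powRN => E; have /gt_eqF/negbT Gt := powR_gt0 (2 * q) (G0 t It).
by rewrite -E divfK.
Qed.

(** The equation of tau after one integration. *)
Definition first_order (k : R) I tau := forall t, I t ->
  line_pos (tau t) /\ real_deriv I tau t (k * G (tau t) `^ (2 * q)).

Lemma first_order_tau_equation k I tau : first_order k I tau ->
  tau_equation I tau (fun t => k * G (tau t) `^ (2 * q))
    (fun t => 2 * (N (tau t) / G (tau t)) * (k * G (tau t) `^ (2 * q)) ^+ 2).
Proof.
move=> fo t It; have w0 r : I r -> line_pos (tau r) by move=> /fo[].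
have [wt dtau] := fo t It; split=> //.
have := real_derivZ (c := k) (real_deriv_volume_powR (a := 2 * q) w0 It dtau).
apply: eq_real_deriv => //.
have Gt := line_volume_gt0 wt; have /gt_eqF/negbT Gt0 := Gt.
rewrite powR_add// powR_inv1 ?(ltW Gt)//.
have -> : 2 * (N (tau t) / G (tau t)) * (k * G (tau t) `^ (2 * q)) ^+ 2 =
  2 * (q * p) * (N (tau t) / G (tau t)) * (k * G (tau t) `^ (2 * q)) ^+ 2.
  by rewrite qp mulr1.
by ring.
Qed.

Lemma explicitE s m : explicit f xi s m = C * (line s m * G s `^ (- q)).
Proof. by rewrite powRN. Qed.

Lemma explicit_S s : line_pos s -> S_alpha rho lambda alpha (explicit f xi s).
Proof.
move=> ws; have G0 := line_volume_gt0 ws.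
have sl : Cinfty A (fun m => line s m `^ p) by apply: Cinfty_powR => //;
  exact: line_smooth.
have -> : explicit f xi s = (fun m => C * (line s m * G s `^ (- q))).
  by apply/funext => m; rewrite explicitE.
split.
- by apply: CinftyZ; apply: CinftyM; [exact: line_smooth|exact: Cinfty_cst].
- by move=> m; rewrite mulr_gt0// mulr_gt0// ?ws// powR_gt0.
- rewrite /powl -/(J _) (eq_integral_fun _ _
    (k := fun m => C `^ p / G s * line s m `^ p)).
    by rewrite (integral_funZ compactM)// -/(G s) divfK// gt_eqF.
  move=> m; rewrite !powRM ?mulr_ge0 ?powR_ge0 ?(ltW C0) ?(ltW (ws m))//.
  rewrite -(powRrM _ _ p) mulNr qp powR_inv1 ?(ltW G0)//.
  by rewrite [RHS]mulrAC mulrA.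
Qed.

(** Since q p = 1 the factor p of G' cancels the exponent of G^(-q), and tau'
    contributes G^(2q). *)
Lemma explicit_deriv k I tau t : first_order k I tau -> I t ->
  fderiv A I (fun r => explicit f xi (tau r)) t
    (fun m => C * k * (xi m * G (tau t) `^ q +
      -1 * (line (tau t) m * (G (tau t) `^ (q - 1) * N (tau t))))).
Proof.
move=> fo It; have w0 r : I r -> line_pos (tau r) by move=> /fo[].
have [wt dtau] := fo t It; have Gt := line_volume_gt0 wt.
have /gt_eqF/negbT Gt0 := Gt.
have sl r : I r -> Cinfty A (line (tau r)) by move=> _; exact: line_smooth.
have sc (a : R) : Cinfty A (fun=> a) by exact: Cinfty_cst.
have sd : Cinfty A (fun m => k * G (tau t) `^ (2 * q) * xi m) by exact: CinftyZ.
have h := fderivM sl (fun r _ => sc (G (tau r) `^ (- q))) sd (sc _) It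
  (fderiv_line It dtau)
  (fderiv_scalar It (real_deriv_volume_powR (a := - q) w0 It dtau)).
have sm r : I r -> Cinfty A (fun m => line (tau r) m * G (tau r) `^ (- q)).
  by move=> Ir; apply: CinftyM; [exact: sl|exact: sc].
have sd2 : Cinfty A (fun m => k * G (tau t) `^ (2 * q) * xi m * G (tau t) `^
  (- q) +
    line (tau t) m * (- q * G (tau t) `^ (- q - 1) *
      (p * N (tau t) * (k * G (tau t) `^ (2 * q))))).
  by apply: CinftyD; apply: CinftyM => //; exact: sl.
have := fderivZ C sm sd2 It h; apply: eq_fderiv => //.
- by move=> r Ir; apply: CinftyZ; exact: sm.
- exact: CinftyZ.
- by move=> r Ir; apply/funext => m; rewrite explicitE.
- apply/funext => m; rewrite !(powR_add _ (-1)) ?powR_inv1 ?(ltW Gt)//.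
  have E1 : G (tau t) `^ (2 * q) = G (tau t) `^ q * G (tau t) `^ q.
    by rewrite -powR_add//; congr (_ `^ _); ring.
  rewrite E1 powRN; have /gt_eqF/negbT P0 := powR_gt0 q Gt.
  have alg (c a b P g d x y : R) : P != 0 -> g != 0 -> a * b = 1 ->
      c * (k * (P * P) * x / P + y *
        (- a * (P^-1 / g) * (b * d * (k * (P * P))))) =
      c * k * (x * P + -1 * (y * (P / g * d))).
    move=> P00 g0 ab; have -> : - a * (P^-1 / g) * (b * d * (k * (P * P))) =
      - (a * b) * (P^-1 / g) * (d * (k * (P * P))) by ring.
    by rewrite ab; field; rewrite P00 g0.
  exact: alg.
Qed.

(** With Q = G^(q-1) N the first derivative is C k (xi G^q - w Q). In the second
    one, (G^q)' = q G^(q-1) p N tau' = Q tau' cancels the contribution of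
    w' = tau' xi, and - C k w Q' remains, which is a multiple of w. *)
Lemma explicit_S_geodesic k I tau : proper_interval I -> first_order k I tau ->
  S_geo I (fun t => explicit f xi (tau t)).
Proof.
move=> PI fo; have w0 r : I r -> line_pos (tau r) by move=> /fo[].
split=> [t /w0|]; first exact: explicit_S.
have G0 r : I r -> 0 < G (tau r) by move=> /w0/line_volume_gt0.
pose base := [set b : R -> M -> R | b = fun r _ => tau r].
have bs u : base u -> smooth_family A I u by move=> -> r _; exact: Cinfty_cst.
pose expr := curve_expr rho lambda I base.
have ecst a : expr (fun _ _ => a) by exact/CurveCst/Cinfty_cst.
have exi : expr (fun _ => xi) by exact: CurveCst.
have ew : expr (fun r => line (tau r)).
  by apply: CurveAdd; [exact: CurveCst|apply: CurveMul => //; exact: CurveBase].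
have ewp a : expr (fun r m => line (tau r) m `^ a).
  by apply: CurvePow => // r m Ir; exact: w0.
have eG a : expr (fun r _ => G (tau r) `^ a).
  by apply: (CurvePow (u := fun r _ => G (tau r))) => [|r _];
    [exact/CurveInt/ewp|exact: G0].
have eN : expr (fun r _ => N (tau r)) by apply: CurveInt;
  exact: (CurveMul exi (ewp _)).
have bd u : base u -> exists2 v, expr v & curve_deriv A I u v.
  move=> ->; exists (fun r _ => k * G (tau r) `^ (2 * q)).
    exact: (CurveMul (ecst k) (eG _)).
  by move=> t It; have [_ dtau] := fo t It; exact: (fderiv_scalar It dtau).
have fam u : expr u -> smooth_family A I u by exact: curve_expr_family.
pose Q r (_ : M) := G (tau r) `^ (q - 1) * N (tau r).
have eQ : expr Q by exact: (CurveMul (eG _) eN).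
have [Q' eQ' QQ'] : exists2 v, expr v & curve_deriv A I Q v.
  exact: (curve_expr_deriv compactM lambda_smooth lambda_pos bs bd).
pose E0 r m := C * (line (tau r) m * G (tau r) `^ (- q)).
pose E1 r m := C * k * (xi m * G (tau r) `^ q + -1 * (line (tau r) m * Q r m)).
pose E2 r m := - (C * k) * (line (tau r) m * Q' r m).
have eE0 : expr E0 by exact: (CurveMul (ecst C) (CurveMul ew (eG _))).
have eE1' : expr (fun r m => xi m * G (tau r) `^ q + -1 *
  (line (tau r) m * Q r m)).
  exact: (CurveAdd (CurveMul exi (eG _))
    (CurveMul (ecst (-1)) (CurveMul ew eQ))).
have eE1 : expr E1 by exact: (CurveMul (ecst (C * k)) eE1').
have eE2 : expr E2 by exact: (CurveMul (ecst (- (C * k))) (CurveMul ew eQ')).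
have EX r : explicit f xi (tau r) = E0 r by apply/funext => m;
  rewrite explicitE.
have dE0 : curve_deriv A I E0 E1.
  move=> t It; have := explicit_deriv fo It; congr frechet_deriv.
  by apply/funext => r; rewrite EX.
have dE1 : curve_deriv A I E1 E2.
  move=> t It; have [wt dtau] := fo t It; have Gt := G0 t It.
  have /gt_eqF/negbT Gt0 := Gt; set t1 := k * _ in dtau.
  have sc (a : R) : Cinfty A (fun=> a) by exact: Cinfty_cst.
  have h1 := fderivM (fun _ _ => sxi) (fun r _ => sc (G (tau r) `^ q)) (sc 0)
    (sc _) It
    (fderiv_cst sxi It) (fderiv_scalar It
      (real_deriv_volume_powR (a := q) w0 It dtau)).
  have sd : Cinfty A (fun m => t1 * xi m) by exact: CinftyZ.
  have h2 := fderivM (fam _ ew) (fam _ eQ) sd (fam _ eQ' t It) It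
    (fderiv_line It dtau) (QQ' t It).
  have swQ : smooth_family A I (fun r m => line (tau r) m * Q r m)
    by apply: fam; exact: (CurveMul ew eQ).
  have sdwQ : Cinfty A (fun m => t1 * xi m * Q t m + line (tau t) m * Q' t m).
    apply: CinftyD; apply: CinftyM => //;
      [exact: fam eQ t It|exact: line_smooth|exact: fam eQ' t It].
  have h3 := fderivZ (-1) swQ sdwQ It h2.
  have s1 : smooth_family A I (fun r m => xi m * G (tau r) `^ q).
    by apply: fam; exact: (CurveMul exi (eG _)).
  have s2 : smooth_family A I (fun r m => -1 * (line (tau r) m * Q r m)).
    by move=> r Ir; apply: CinftyZ; exact: swQ.
  have s3 : Cinfty A (fun m => 0 * G (tau t) `^ q + xi m *
    (q * G (tau t) `^ (q - 1) * (p * N (tau t) * t1))).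
    by apply: CinftyD => //; apply: CinftyM.
  have h4 := fderivD s1 s2 s3 (CinftyZ (-1) sdwQ) It h1 h3.
  have := fderivZ (C * k) (fam _ eE1') (CinftyD s3 (CinftyZ (-1) sdwQ)) It h4.
  apply: eq_fderiv => //.
  - exact: fam.
  - by apply: CinftyZ; apply: CinftyD => //; exact: CinftyZ.
  - apply/funext => m; rewrite /E2 /Q.
    have alg (c a b P d x y z : R) : a * b = 1 ->
        c * (0 * y + x * (a * P * (b * d * t1)) + -1 * (t1 * x * (P * d) + z)) =
          - c * z.
      move=> ab; have -> : a * P * (b * d * t1) = (a * b) * (P * (d * t1))
        by ring.
      by rewrite ab; ring.
    exact: alg.
have [D [[D0 Dd] _ D2]] := curve_expr_smooth_curve compactM lambda_smooth
  lambda_pos bs bd eE2 eE0 eE1 dE0 dE1.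
exists D; split; first by split=> // t It; rewrite D0.
move=> t It; split.
  split; first exact: Cinfty_cst.
  rewrite (_ : fmul 0 _ = fmul (fun=> 0) lambda); first exact: integral_fun0.
  by apply/funext => i; apply/funext => m;
    rewrite /fmul -[(0 : M -> R) m]/(0 : R) !mul0r.
(* Q' t is constant on M, since Q is *)
have [c Q'c] : exists c, forall m, Q' t m = c.
  have [[m0]|noM] := pselect (exists m : M, True); last by exists 0 => m;
    case: noM; exists m.
  exists (Q' t m0) => m; have d m' :=
    fderiv_at compactM rho (m := m') (fam _ eQ) (fam _ eQ' t It) It (QQ' t It).
  exact: real_deriv_unique PI It (d m) (d m0).
exists (- k * c * G (tau t) `^ q); rewrite subr0 D2 EX; apply/funext => m.
rewrite -[RHS]/(- k * c * G (tau t) `^ q * E0 t m) /E2 /E0 Q'c powRN.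
have /gt_eqF/negbT P0 := powR_gt0 q (G0 t It).
have alg (b P y : R) : P != 0 -> - (b * k) * (y * c) = - k * c * P *
  (b * (y / P)).
  by move=> P00; field.
exact: alg.
Qed.

End Line.
End Solutions.

(** * Geodesics are projected straight lines *)

Section GeodesicsAreExplicit.
Variables (R : realType) (n : nat) (M : topologicalType).
Variable A : oriented_atlas R n M.
Hypothesis compactM : compact [set: M].
Variables (rho : partition_of_unity A) (lambda : topform A).
Hypotheses (lambda_smooth : Omega lambda) (lambda_pos : form_pos lambda).
Variable alpha : R.
Hypothesis alpha_neq1 : alpha != 1.
Implicit Types (f g h xi : M -> R) (m : M) (I : set R) (tau : R -> R).

Local Notation J := (integral_fun rho lambda).
Local Notation p := (2 / (1 - alpha)).
Local Notation q := ((1 - alpha) / 2).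
Local Notation C := (2 / `|1 - alpha|).
Local Notation explicit := (explicit_geodesic rho lambda alpha).
Local Notation G := (line_volume rho lambda alpha).
Local Notation N := (line_pairing rho lambda alpha).
Local Notation tau_eqn := (tau_equation rho lambda alpha).
Local Notation first_order := (first_order rho lambda alpha).

Let oneBalpha : 1 - alpha != 0. Proof. by rewrite subr_eq0 eq_sym. Qed.
Let C0 : 0 < C. Proof. exact: C_gt0. Qed.
Let qp : q * p = 1. Proof. exact: mulqp. Qed.
Let pq : p * q = 1. Proof. exact: mulpq. Qed.
Let p0 : p != 0. Proof. exact: p_neq0. Qed.

Section Span.
Variables (I : set R) (t0 : R) (D : nat -> R -> M -> R).
Hypotheses (PI : proper_interval I) (It0 : I t0).
Hypothesis SD : forall t, I t -> S_alpha rho lambda alpha (D 0%N t).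
Hypothesis sD : forall k t, I t -> Cinfty A (D k t).
Hypothesis dD : forall k t, I t -> fderiv A I (D k) t (D k.+1 t).
Hypothesis geoD : forall t, I t -> exists c : R, forall m,
  D 2 t m = c * D 0%N t m.

Let II : is_interval I. Proof. by case: PI. Qed.
Let D0 t m : I t -> 0 < D 0%N t m. Proof. by move=> /SD[]. Qed.
Let dDm k m t : I t -> real_deriv I (fun r => D k r m) t (D k.+1 t m).
Proof. by move=> It; exact: (fderiv_at compactM rho (sD k) (sD k.+1 It) It
  (dD k It)). Qed.

(** The velocity is tangent to S_alpha: differentiate the constraint. *)
Lemma S_tangent t : I t -> J (fun m => D 1%N t m * D 0%N t m `^ (p - 1)) = 0.
Proof.
move=> It; have fd := fderiv_powR p (sD 0) (fun r m => @D0 r m) (sD 1 It) It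
  (dD 0 It).
have sp a r : I r -> Cinfty A (fun m => D 0%N r m `^ a).
  by move=> Ir; apply: Cinfty_powR => [|m]; [exact: sD|exact: D0].
have sd : Cinfty A (fun m => p * D 0%N t m `^ (p - 1) * D 1%N t m).
  by apply: CinftyM; [apply: CinftyZ; exact: sp|exact: sD].
have h := @fderiv_integral _ _ _ _ compactM rho _ lambda_smooth lambda_pos _ _ _
  _ (sp p) sd It fd.
have h0 : real_deriv I (fun r => J (fun m => D 0%N r m `^ p)) t 0.
  by apply: eq_real_deriv (real_deriv_cst I t (C `^ p)) => // r Ir; have [] :=
    SD Ir.
have := real_deriv_unique PI It h h0.
rewrite (eq_integral_fun _ _ (k := fun m => p *
  (D 1%N t m * D 0%N t m `^ (p - 1)))); last first.
  by move=> m; ring.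
rewrite (integral_funZ compactM)//; last by apply: CinftyM;
  [exact: sD|exact: sp].
by move=> /eqP; rewrite mulf_eq0 (negbTE p0) => /eqP.
Qed.

Local Notation f := (D 0%N t0).
Local Notation xi := (D 1%N t0).

(** If f and xi are not proportional, the coefficients are found by Cramer's
    rule at two points m0 and m1 where the determinant is nonzero, and
    linear_ode_zero shows that the decomposition holds at every point. If they
    are proportional, tangency forces xi = 0, the curve is constant and b is
    arbitrary; it is chosen so that the Wronskian a b1 - a1 b is 1 again. *)
Lemma geodesic_span : exists a a1 b b1 : R -> R, [/\ a t0 = 1, b t0 = 0 &
  forall t, I t -> [/\ real_deriv I a t (a1 t), real_deriv I b t (b1 t),
    a t * b1 t - a1 t * b t = 1 & forall m,
      D 0%N t m = a t * f m + b t * xi m]].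
Proof.
have [c cE] : exists c : R -> R, forall t, I t -> forall m,
  D 2 t m = c t * D 0%N t m.
  have /choice[c cP] : forall t, exists c : R, I t -> forall m,
    D 2 t m = c * D 0%N t m.
    move=> t; have [/geoD[c cE]|] := pselect (I t); first by exists c.
    by exists 0.
  by exists c.
have dD1 m t : I t -> real_deriv I (fun r => D 1%N r m) t (c t * D 0%N t m).
  by move=> It; rewrite -cE//; exact: dDm.
have [[m0 [m1 w0]]|indep] := pselect
  (exists m0 m1, xi m1 * f m0 - xi m0 * f m1 != 0).
  pose w := xi m1 * f m0 - xi m0 * f m1.
  have comb k (x y : R) d0 d1 t : real_deriv I (fun r => D k r m0) t d0 ->
      real_deriv I (fun r => D k r m1) t d1 ->
      real_deriv I (fun r => w^-1 * (x * D k r m0 - y * D k r m1)) t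
        (w^-1 * (x * d0 - y * d1)).
    by move=> h0 h1; apply: real_derivZ; apply: real_derivB; exact: real_derivZ.
  pose a k r := w^-1 * (xi m1 * D k r m0 - xi m0 * D k r m1).
  pose b k r := w^-1 * (- f m1 * D k r m0 - - f m0 * D k r m1).
  have a0 : a 0%N t0 = 1 by rewrite /a -/w mulVf.
  have b0 : b 0%N t0 = 0 by rewrite /b; ring.
  have a10 : a 1%N t0 = 0 by rewrite /a; ring.
  have b10 : b 1%N t0 = 1.
    by rewrite /b -[RHS](mulVf w0) /w; congr (_ * _); ring.
  have da t : I t -> real_deriv I (a 0%N) t (a 1%N t) by move=> It; apply: comb;
    exact: dDm.
  have db t : I t -> real_deriv I (b 0%N) t (b 1%N t) by move=> It; apply: comb;
    exact: dDm.
  have da1 t : I t -> real_deriv I (a 1%N) t (c t * a 0%N t).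
    move=> It; have := comb 1%N (xi m1) (xi m0) _ _ _ (dD1 m0 t It)
      (dD1 m1 t It).
    by apply: eq_real_deriv => //; rewrite /a; ring.
  have db1 t : I t -> real_deriv I (b 1%N) t (c t * b 0%N t).
    move=> It; have := comb 1%N (- f m1) (- f m0) _ _ _ (dD1 m0 t It)
      (dD1 m1 t It).
    by apply: eq_real_deriv => //; rewrite /b; ring.
  exists (a 0%N), (a 1%N), (b 0%N), (b 1%N); split=> // t It; split.
  - exact: da.
  - exact: db.
  - rewrite -[RHS](_ : a 0%N t0 * b 1%N t0 - a 1%N t0 * b 0%N t0 = 1);
      last first.
      by rewrite a0 b10 a10 mul0r subr0 mulr1.
    apply: (@real_deriv0_cst _ I (fun t => a 0%N t * b 1%N t - a 1%N t * b 0%N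
      t)) => // s Is.
    have := real_derivB (real_derivM (da s Is) (db1 s Is))
      (real_derivM (da1 s Is) (db s Is)).
    by apply: eq_real_deriv => //; ring.
  - move=> m; apply/eqP; rewrite -subr_eq0; apply/eqP.
    pose z k t := D k t m - (f m * a k t + xi m * b k t).
    have zE : z 0%N t = 0.
      apply: (@linear_ode_zero _ I t0 (fun t => D 0%N t m0)
        (fun t => D 1%N t m0) (z 0%N) (z 1%N) c) => //.
      + by move=> s Is; exact: D0.
      + by move=> s Is; exact: dDm.
      + by move=> s Is; exact: dD1.
      + move=> s Is; apply: real_derivB; first exact: dDm.
        by apply: real_derivD; apply: real_derivZ; [exact: da|exact: db].
      + move=> s Is; have h := real_derivD (real_derivZ (c := f m) (da1 s Is))
          (real_derivZ (c := xi m) (db1 s Is)).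
        by have := real_derivB (dD1 m s Is) h; apply: eq_real_deriv => //;
          rewrite /z; ring.
      + by rewrite /z a0 b0; ring.
      + by rewrite /z a10 b10; ring.
    by rewrite -[RHS]zE /z; ring.
have {}indep m0 m1 : xi m1 * f m0 = xi m0 * f m1.
  apply/eqP; rewrite -subr_eq0; apply/negP => /negP w0; apply: indep.
  by exists m0, m1.
have J1 := S_integral1_gt0 compactM lambda_smooth lambda_pos alpha_neq1
  (SD It0).
have [m0 _] : exists m : M, True.
  apply: contrapT => noM; move: J1; rewrite (eq_integral_fun _ _
    (k := fun=> 0)).
    by rewrite integral_fun0// ltxx.
  by move=> m; case: noM; exists m.
have f0 m : 0 < f m := D0 m It0.
have sp a : Cinfty A (fun m => f m `^ a) by apply: Cinfty_powR => //; exact: sD.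
have xi0 m : xi m = 0.
  have fm0 : f m0 != 0 by rewrite gt_eqF.
  have kE m' : xi m' = xi m0 / f m0 * f m' by rewrite mulrAC -indep mulfK.
  have := S_tangent It0.
  rewrite (eq_integral_fun _ _ (k := fun m => xi m0 / f m0 * f m `^ p));
    last first.
    move=> m'; rewrite {1}kE -mulrA; congr (_ * _).
    by rewrite -{1}(powRr1 (ltW (f0 m'))) -powR_add//; congr (_ `^ _); ring.
  rewrite (integral_funZ compactM)// => /eqP; rewrite mulf_eq0.
  have /gt_eqF -> : 0 < J (fun m => f m `^ p).
    by apply: (integral_fun_gt0 compactM) => // m'; rewrite powR_gt0.
  by rewrite orbF => /eqP k0; rewrite kE k0 mul0r.
have fE t m : I t -> D 0%N t m = f m.
  move=> It; pose a r := (f m0)^-1 * D 0%N r m0.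
  have fm0 : f m0 != 0 by rewrite gt_eqF.
  have at_ m' : D 0%N t m' = f m' * a t.
    apply/eqP; rewrite -subr_eq0; apply/eqP.
    apply: (@linear_ode_zero _ I t0 (fun t => D 0%N t m0) (fun t => D 1%N t m0)
      (fun r => D 0%N r m' - f m' * a r)
        (fun r => D 1%N r m' - f m' * ((f m0)^-1 * D 1%N r m0)) c) => //.
    + by move=> s Is; exact: D0.
    + by move=> s Is; exact: dDm.
    + by move=> s Is; exact: dD1.
    + move=> s Is; apply: real_derivB; first exact: dDm.
      by apply: real_derivZ; apply: real_derivZ; exact: dDm.
    + move=> s Is; have := real_derivB (dD1 m' s Is)
        (real_derivZ (c := f m') (real_derivZ (c := (f m0)^-1) (dD1 m0 s Is))).
      by apply: eq_real_deriv => //; rewrite /a; ring.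
    + by rewrite /a mulVf// mulr1 subrr.
    + by rewrite !xi0; ring.
  have a0 : 0 < a t by rewrite mulr_gt0 ?invr_gt0// D0.
  suff a1 : a t = 1 by rewrite at_ a1 mulr1.
  have [_ _ Jt] := SD It; have [_ _ Jf] := SD It0.
  have apE : J (fun m => D 0%N t m `^ p) = a t `^ p * J (fun m => f m `^ p).
    rewrite -(integral_funZ compactM)//; apply: eq_integral_fun => m'.
    by rewrite at_ mulrC powRM ?ltW.
  have ap1 : a t `^ p = 1.
    have Cp0 : C `^ p != 0 by rewrite gt_eqF// powR_gt0.
    by apply: (mulIf Cp0); rewrite mul1r -[in LHS]Jf -[RHS]Jt -[LHS]apE.
  by rewrite -(powR_mulK a0 pq) ap1 powR1.
exists (fun=> 1), (fun=> 0), (fun t => t - t0), (fun=> 1); split=> [//||t It];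
  first by rewrite subrr.
split=> [|||m].
- exact: real_deriv_cst.
- by have := real_derivB (real_deriv_id I t) (real_deriv_cst I t t0);
    rewrite subr0.
- by rewrite mul0r mulr1 subr0.
- by rewrite fE// xi0 mulr0 addr0 mul1r.
Qed.

(** With tau = b / a the Wronskian relation gives tau' = a^(-2), and the
    tangency of the velocity gives N / G = - a1 a. *)
Lemma geodesic_tau : exists tau tau1 tau2 : R -> R,
  [/\ tau t0 = 0, tau1 t0 = 1, tau_eqn f xi I tau tau1 tau2
    & forall t, I t -> D 0%N t = explicit f xi (tau t)].
Proof.
have [a [a1 [b [b1 [at0 bt0 H]]]]] := geodesic_span.
have J1 := S_integral1_gt0 compactM lambda_smooth lambda_pos alpha_neq1
  (SD It0).
have f0 m : 0 < f m := D0 m It0.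
have sp r x : I r -> Cinfty A (fun m => D 0%N r m `^ x).
  by move=> Ir; apply: Cinfty_powR => [|m]; [exact: sD|exact: D0].
have sxi : Cinfty A xi by exact: sD.
have sf : Cinfty A f by exact: sD.
(* pairing with f^(p-1), which annihilates xi, isolates a *)
have a0 t : I t -> 0 < a t.
  move=> It; have [_ _ _ E] := H t It.
  have JE : J (fun m => D 0%N t m * f m `^ (p - 1)) = a t * J
    (fun m => f m `^ p).
    have T0 := S_tangent It0.
    rewrite (eq_integral_fun _ _ (k :=
      fun m => a t * f m `^ p + b t * (xi m * f m `^ (p - 1)))).
      rewrite (integral_fun_lin compactM)//; last 2 first.
      - exact: sp.
      - by apply: CinftyZ; apply: CinftyM => //; exact: sp.
      rewrite (integral_funZ compactM)//; last by apply: CinftyM => //;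
        exact: sp.
      by rewrite T0 mulr0 addr0.
    move=> m; have -> : f m `^ p = f m * f m `^ (p - 1).
      by rewrite -{2}(powRr1 (ltW (f0 m))) -powR_add//; congr (_ `^ _); ring.
    by rewrite E; ring.
  have Jp : 0 < J (fun m => f m `^ p).
    by apply: (integral_fun_gt0 compactM) => // [|m];
      [exact: sp|rewrite powR_gt0].
  rewrite -(pmulr_lgt0 _ Jp) -JE; apply: (integral_fun_gt0 compactM) => //.
    by apply: CinftyM; [exact: sD|exact: sp].
  by move=> m; rewrite mulr_gt0 ?powR_gt0// D0.
pose tau t := b t / a t.
have lineE t m : I t -> line f xi (tau t) m = D 0%N t m / a t.
  move=> It; have [_ _ _ ->] := H t It; have at_ := a0 t It.
  by rewrite /line /tau; field; rewrite gt_eqF.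
have line0 t : I t -> line_pos f xi (tau t).
  by move=> It m; rewrite lineE// divr_gt0 ?a0// D0.
have dtau t : I t -> real_deriv I tau t ((a t)^-1 ^+ 2).
  move=> It; have [da db W _] := H t It; have at_ := a0 t It.
  have := real_derivM db (real_derivV at_ a0 It da); apply: eq_real_deriv => //.
  have -> : b1 t / a t + b t * (- a1 t / a t ^+ 2) = (a t * b1 t - a1 t * b t)
    / a t ^+ 2.
    by field; rewrite gt_eqF.
  by rewrite W mul1r exprVn.
have GE t : I t -> G f xi (tau t) = C `^ p / a t `^ p.
  move=> It; have [_ _ Jt] := SD It; rewrite /line_volume.
  rewrite (eq_integral_fun _ _ (k := fun m => (a t `^ p)^-1 * D 0%N t m `^ p));
    last first.
    by move=> m; rewrite lineE// powR_div ?a0 ?D0// mulrC.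
  rewrite (integral_funZ compactM)//; last exact: sp.
  by rewrite [J _]Jt mulrC.
(* the tangency of the velocity determines a1 *)
have NE t : I t -> N f xi (tau t) / G f xi (tau t) = - (a1 t * a t).
  move=> It; have [da db W E] := H t It; have at_ := a0 t It.
  have at0' : a t != 0 by rewrite gt_eqF.
  have D1E m : D 1%N t m = a1 t * f m + b1 t * xi m.
    have d1 : real_deriv I (fun r => D 0%N r m) t (D 1%N t m) by exact: dDm.
    apply: (real_deriv_unique PI It d1).
    have := real_derivD (real_derivZ (c := f m) da)
      (real_derivZ (c := xi m) db).
    apply: eq_real_deriv => // [r Ir|]; last by ring.
    by have [_ _ _ ->] := H r Ir; ring.
  have sl : Cinfty A (line f xi (tau t)) by exact: line_smooth.
  have slp x : Cinfty A (fun m => line f xi (tau t) m `^ x).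
    by apply: Cinfty_powR => // m; exact: line0.
  have := S_tangent It.
  rewrite (eq_integral_fun _ _ (k :=
    fun m => a t `^ (p - 1) * (a1 t * line f xi (tau t) m `^ p +
      (a t)^-1 * (xi m * line f xi (tau t) m `^ (p - 1))))); last first.
    move=> m; have lm := line0 t It m; rewrite D1E.
    have -> : D 0%N t m = a t * line f xi (tau t) m by rewrite lineE// mulrC
      divfK.
    rewrite powRM ?ltW//.
    have -> : line f xi (tau t) m `^ p = line f xi (tau t) m * line f xi (tau t)
      m `^ (p - 1).
      by rewrite -{2}(powRr1 (ltW lm)) -powR_add//; congr (_ `^ _); ring.
    have -> : a1 t * f m + b1 t * xi m = a1 t * line f xi (tau t) m + (a t)^-1 *
      xi m.
      have -> : (a t)^-1 = (a t)^-1 * (a t * b1 t - a1 t * b t) by rewrite W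
        mulr1.
      by rewrite /line /tau; field.
    by ring.
  rewrite (integral_funZ compactM)//; last first.
    by apply: CinftyD; apply: CinftyZ => //; exact: CinftyM.
  rewrite (integral_fun_lin compactM)//; last by apply: CinftyZ; exact: CinftyM.
  rewrite (integral_funZ compactM)//; last exact: CinftyM.
  rewrite -/(line_volume rho lambda alpha f xi (tau t))
    -/(line_pairing rho lambda alpha f xi (tau t)).
  move=> /eqP; rewrite mulf_eq0 (gt_eqF (powR_gt0 (p - 1) at_))/= => /eqP E0.
  have G0 : G f xi (tau t) != 0 by rewrite gt_eqF//;
    apply: line_volume_gt0 => //; exact: line0.
  apply: (mulIf G0); rewrite divfK//.
  have -> : N f xi (tau t) = a t * ((a t)^-1 * N f xi (tau t))
    by rewrite mulVKf.
  have -> : (a t)^-1 * N f xi (tau t) = - (a1 t * G f xi (tau t)).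
    by apply/eqP; rewrite -addr_eq0 addrC E0.
  by ring.
exists tau, (fun t => (a t)^-1 ^+ 2), (fun t => - 2 * a1 t * (a t)^-1 ^+ 3);
  split.
- by rewrite /tau bt0 mul0r.
- by rewrite at0 invr1 expr1n.
- move=> t It; have [da db W E] := H t It; have at_ := a0 t It.
  split; [exact: dtau| |exact: line0|].
    have dV := real_derivV at_ a0 It da.
    have := real_derivM dV dV; apply: eq_real_deriv => // [].
    by field; rewrite gt_eqF.
  by rewrite NE//; field; rewrite gt_eqF.
- move=> t It; apply/funext => m; have at_ := a0 t It.
  rewrite explicitE lineE// GE// powRN powR_div ?powR_gt0//.
  rewrite (powR_mulK C0 pq) (powR_mulK at_ pq) invf_div.
  by field; rewrite normr_eq0 oneBalpha gt_eqF.
Qed.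

End Span.
End GeodesicsAreExplicit.

(** * Existence and uniqueness of the parametrization *)

Section Clock.
Variables (R : realType) (n : nat) (M : topologicalType).
Variable A : oriented_atlas R n M.
Hypothesis compactM : compact [set: M].
Variables (rho : partition_of_unity A) (lambda : topform A).
Hypotheses (lambda_smooth : Omega lambda) (lambda_pos : form_pos lambda).
Variable alpha : R.
Hypothesis alpha_neq1 : alpha != 1.

Local Notation J := (integral_fun rho lambda).
Local Notation p := (2 / (1 - alpha)).
Local Notation q := ((1 - alpha) / 2).

Variables f xi : M -> R.
Hypotheses (sf : Cinfty A f) (sxi : Cinfty A xi) (J1 : 0 < J (fun=> 1)).
Hypothesis f0 : forall m, 0 < f m.
Implicit Types (I : set R) (tau sigma : R -> R).

Local Notation G := (line_volume rho lambda alpha f xi).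
Local Notation N := (line_pairing rho lambda alpha f xi).
Local Notation tau_eqn := (tau_equation rho lambda alpha f xi).
Local Notation first_order := (first_order rho lambda alpha f xi).
Local Notation pos := (line_pos f xi).

(** The constant for which the initial speed is 1. *)
Definition unit_rate : R := (G 0 `^ (2 * q))^-1.
Local Notation kappa := unit_rate.

Lemma line_pos0 : pos 0.
Proof. by move=> m; rewrite /line mul0r addr0. Qed.

Lemma volume_gt0 s : pos s -> 0 < G s.
Proof. exact: line_volume_gt0. Qed.

Lemma unit_rate_gt0 : 0 < kappa.
Proof. by rewrite invr_gt0 powR_gt0// volume_gt0//; exact: line_pos0. Qed.

Lemma tau_equation_first_order I tau tau1 tau2 t0 : is_interval I ->
  tau_eqn I tau tau1 tau2 -> I t0 -> tau t0 = 0 -> tau1 t0 = 1 ->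
  first_order kappa I tau.
Proof.
move=> II eqn It0 tau0 tau10 t It; have [dtau _ post _] := eqn t It; split=> //.
have := first_integral compactM lambda_smooth lambda_pos alpha_neq1 sf sxi J1 II
  eqn It0 It.
by rewrite tau0 tau10 div1r => <-.
Qed.

(** The set of admissible parameters is convex, the condition being affine. *)
Lemma line_pos_between a b s : pos a -> pos b -> a <= s <= b -> pos s.
Proof.
move=> pa pb /andP[as_ sb] m; have pam := pa m; have pbm := pb m.
rewrite /line in pam pbm *; have [x0|x0] := leP 0 (xi m).
  by apply: (lt_le_trans pam); rewrite lerD2l ler_wpM2r.
by apply: (lt_le_trans pbm); rewrite lerD2l ler_wnM2r// ltW.
Qed.

(** The set of admissible parameters is open, by compactness of M. *)
Lemma line_pos_pad s : pos s -> exists2 e, 0 < e & pos (s - e) /\ pos (s + e).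
Proof.
move=> ps; have sl : Cinfty A (line f xi s) by exact: line_smooth.
have [c c0 cl] := Cinfty_pos_lower compactM rho sl ps.
have [B B0 xB] := Cinfty_bounded compactM rho sxi.
exists (c / (2 * B)); first by rewrite divr_gt0// mulr_gt0.
have bnd m : `|c / (2 * B) * xi m| < c.
  rewrite normrM gtr0_norm ?divr_gt0 ?mulr_gt0// mulrAC ltr_pdivrMr ?mulr_gt0//.
  rewrite ltr_pM2l//; apply: le_lt_trans (xB m) _.
  by rewrite mulr_natl mulr2n ltrDr.
split=> m; have := bnd m; have := cl m; rewrite /line ltr_norml.
  by move=> h1 /andP[h2 h3]; rewrite mulrBl; lra.
by move=> h1 /andP[h2 h3]; rewrite mulrDl; lra.
Qed.

Lemma first_order_incr k I tau x y : 0 < k -> is_interval I ->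
  first_order k I tau -> I x -> I y -> x <= y -> tau x <= tau y.
Proof.
move=> k0 II fo Ix Iy; rewrite le_eqVlt => /predU1P[->//|xy]; apply: ltW.
apply: (real_deriv_incr II (d := fun t => k * G (tau t) `^ (2 * q))) => // t It.
  by have [] := fo t It.
by rewrite mulr_gt0// powR_gt0// volume_gt0//; have [] := fo t It.
Qed.

(** Theta x is the time at which the solution with initial speed 1 reaches the
    parameter x. Any solution at rate r satisfies (Theta o sigma)' = r. *)
Lemma clock lo hi : lo <= 0 <= hi -> pos lo -> pos hi ->
  exists (Theta tau : R -> R) a b, [/\ (a < lo) && (hi < b), Theta 0 = 0,
    (forall x, x \in `]a, b[ -> pos x /\ tau (Theta x) = x),
    (forall x y, x \in `]a, b[ -> y \in `]a, b[ -> x < y ->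
      Theta x < Theta y /\ forall t, Theta x <= t <= Theta y ->
        [/\ x <= tau t <= y, Theta (tau t) = t
          & is_derive t 1 tau (kappa * G (tau t) `^ (2 * q))]) &
    (forall r I sigma s t, is_interval I -> (forall t, I t -> sigma t \in `]a,
      b[) ->
      first_order (r * kappa) I sigma -> I s -> I t ->
      Theta (sigma t) - Theta (sigma s) = r * (t - s))].
Proof.
move=> /andP[lo0 hi0] plo phi.
have [e e0 [pa _]] := line_pos_pad plo; have [d d0 [_ pb]] := line_pos_pad phi.
pose a := lo - e; pose b := hi + d.
have posab x : x \in `[a, b] -> pos x.
  by rewrite in_itv/=; exact: line_pos_between.
have a0 : a < 0 by rewrite /a; lra.
have b0 : 0 < b by rewrite /b; lra.
pose H s := kappa * G s `^ (2 * q).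
have H0 x : x \in `[a, b] -> 0 < H x.
  by move=> /posab px; rewrite mulr_gt0 ?unit_rate_gt0// powR_gt0// volume_gt0.
pose dH x := kappa * (2 * q * G x `^ (2 * q - 1) * (p * N x * 1)).
have Hd x : x \in `[a, b] -> real_deriv `[a, b] H x (dH x).
  move=> xab; apply: real_derivZ.
  apply: (real_deriv_volume_powR compactM lambda_smooth lambda_pos sf sxi J1
    (tau := id)) => //.
  exact: real_deriv_id.
have [Th [tau [Th0 tauK Thd flow]]] := autonomous_ode a0 b0 H0 Hd.
exists Th, tau, a, b; split=> //.
- by rewrite /a /b ltrBlDr !ltrDl e0.
- move=> x xab; split; last exact: tauK.
  by apply: posab; exact: subset_itv_oo_cc.
move=> r I sigma s t II sab fo Is It; apply/eqP.
have -> : (Th (sigma t) - Th (sigma s) == r * (t - s)) =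
    (Th (sigma t) - r * t == Th (sigma s) - r * s).
  by apply/eqP/eqP => E; lra.
apply/eqP; apply: (@real_deriv0_cst _ I (fun t => Th (sigma t) - r * t)) => // u
  Iu.
have [pu du] := fo u Iu.
have h := real_deriv_comp (Thd _ (sab u Iu)) du.
have := real_derivB h (real_derivZ (c := r) (real_deriv_id I u)).
apply: eq_real_deriv => //.
have /gt_eqF/negbT Hu := H0 _ (subset_itv_oo_cc (sab u Iu)).
by rewrite -mulrA -/(H (sigma u)) mulrCA mulVf// subrr.
Qed.

(** Solutions are increasing, so that on the interval between t0 and t both stay
    in the range where Theta is defined; there Theta (sigma t) = t - t0. *)
Lemma first_order_unique I t0 sigma tau : is_interval I -> I t0 ->
  first_order kappa I sigma -> first_order kappa I tau ->
  sigma t0 = 0 -> tau t0 = 0 -> forall t, I t -> sigma t = tau t.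
Proof.
move=> II It0 fos fot s0 t00 t It; have k0 := unit_rate_gt0.
pose x := Num.min t0 t; pose y := Num.max t0 t.
have Ix : I x by rewrite /x; case: ltP.
have Iy : I y by rewrite /y; case: ltP.
have x0 : x <= t0 by rewrite ge_min lexx.
have y0 : t0 <= y by rewrite le_max lexx.
have xt : x <= t by rewrite ge_min lexx orbT.
have ty : t <= y by rewrite le_max lexx orbT.
pose I' := `[x, y]%classic.
have II' : is_interval I' by exact: interval_is_interval.
have I'I : I' `<=` I by exact: sub_interval.
have restrict u : first_order kappa I u -> first_order kappa I' u.
  move=> fo r I'r; have [pr dr] := fo r (I'I _ I'r); split=> //.
  exact: real_derivS I'I dr.
pose lo := Num.min (sigma x) (tau x); pose hi := Num.max (sigma y) (tau y).
have plo : pos lo.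
  by rewrite /lo; case: ltP => _; [have [] := fos x Ix|have [] := fot x Ix].
have phi : pos hi.
  by rewrite /hi; case: ltP => _; [have [] := fot y Iy|have [] := fos y Iy].
have lohi : lo <= 0 <= hi.
  rewrite /lo /hi ge_min le_max -{1 3}s0; apply/andP; split; apply/orP; left.
    exact: (first_order_incr k0 II fos).
  exact: (first_order_incr k0 II fos).
have [Th [cl [a [b [/andP[alo hib] Th0 inv _ flow]]]]] := clock lohi plo phi.
have range u r : first_order kappa I u -> lo <= u x -> u y <= hi -> I' r ->
  u r \in `]a, b[.
  move=> fo lou uhi I'r; have := I'r; rewrite /I' /= in_itv/= => /andP[xr ry].
  have Ir := I'I _ I'r; rewrite in_itv/=; apply/andP; split.
    by apply: (lt_le_trans alo); apply: (le_trans lou);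
      exact: first_order_incr k0 II fo Ix Ir xr.
  by apply: le_lt_trans hib; apply: le_trans uhi;
    exact: first_order_incr k0 II fo Ir Iy ry.
have I't : I' t by rewrite /I' /= in_itv/= xt.
have I't0 : I' t0 by rewrite /I' /= in_itv/= x0.
have rs r : I' r -> sigma r \in `]a, b[.
  by apply: range => //; [rewrite ge_min lexx|rewrite le_max lexx].
have rt r : I' r -> tau r \in `]a, b[.
  by apply: range => //; [rewrite ge_min lexx orbT|rewrite le_max lexx orbT].
have fs : first_order (1 * kappa) I' sigma by rewrite mul1r; exact: restrict.
have ft : first_order (1 * kappa) I' tau by rewrite mul1r; exact: restrict.
have E1 := flow _ _ _ _ _ II' rs fs I't0 I't.
have E2 := flow _ _ _ _ _ II' rt ft I't0 I't.
have E : Th (sigma t) = Th (tau t) by move: E1 E2; rewrite s0 t00 => <- /addIr.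
by have [_ <-] := inv _ (rs t I't); have [_ <-] := inv _ (rt t I't); rewrite E.
Qed.

Lemma first_order_local : exists2 e, 0 < e &
  exists2 tau, tau 0 = 0 & first_order kappa `]-e, e[ tau.
Proof.
have h0 : 0 <= (0 : R) <= 0 by rewrite lexx.
have [Th [cl [a [b [/andP[a0 b0] Th0 inv flow _]]]]] :=
  clock h0 line_pos0 line_pos0.
have a2 : a / 2 \in `]a, b[ by rewrite in_itv/=; apply/andP; split; lra.
have b2 : b / 2 \in `]a, b[ by rewrite in_itv/=; apply/andP; split; lra.
have z0 : 0 \in `]a, b[ by rewrite in_itv/= a0.
have a20 : a / 2 < 0 by lra.
have b20 : 0 < b / 2 by lra.
have [Tha _] := flow _ _ a2 z0 a20; have [Thb _] := flow _ _ z0 b2 b20.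
rewrite Th0 in Tha Thb.
have [_ ab] := flow _ _ a2 b2 (lt_trans a20 b20).
exists (Num.min (- Th (a / 2)) (Th (b / 2)));
  first by rewrite lt_min oppr_gt0 Tha.
exists cl; first by rewrite -{1}Th0; have [_] := inv _ z0.
move=> t /=; rewrite in_itv/= => /andP[t1 t2].
have tab : Th (a / 2) <= t <= Th (b / 2).
  apply/andP; split; apply: ltW; last by apply: (lt_le_trans t2);
    rewrite ge_min lexx orbT.
  by apply: le_lt_trans t1; rewrite lerNr ge_min lexx.
have [tr _ dt] := ab t tab; split; last exact: is_derive_real_deriv.
apply: (inv _ _).1; move: a2 b2 tr; rewrite !in_itv/= => /andP[h1 _] /andP[_ h2]
  /andP[h3 h4].
by rewrite (lt_le_trans h1 h3) (le_lt_trans h4 h2).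
Qed.

(** The solution of speed T = Theta 1 reaches 1 at time 1. For a solution u on
    [s, t] from 0 to 1, the rate is T / (t - s), and comparing the values of
    Theta identifies u with an affine reparametrization. *)
Lemma first_order_reach : pos 1 -> exists T sigma,
  [/\ 0 < T, sigma 0 = 0, sigma 1 = 1, first_order (T * kappa) `[0, 1] sigma &
    forall k s t u, 0 < k -> s < t -> first_order (k * kappa) `[s, t] u ->
      u s = 0 -> u t = 1 -> forall r, s <= r <= t ->
        u r = sigma ((r - s) / (t - s))].
Proof.
move=> p1; have h01 : 0 <= (0 : R) <= 1 by rewrite lexx ler01.
have [Th [cl [a [b [/andP[a0 b1] Th0 inv flow clk]]]]] :=
  clock h01 line_pos0 p1.
have z0 : 0 \in `]a, b[ by rewrite in_itv/= a0 (lt_trans ltr01 b1).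
have o1 : 1 \in `]a, b[ by rewrite in_itv/= b1 (lt_trans a0 ltr01).
have [Th01 fl] := flow _ _ z0 o1 ltr01; pose T := Th 1.
have T0 : 0 < T by rewrite /T -Th0.
have Tt t : 0 <= t <= 1 -> Th 0 <= T * t <= Th 1.
  move=> /andP[t0 t1]; rewrite Th0 -/T mulr_ge0 ?(ltW T0)//=.
  by rewrite ler_piMr ?(ltW T0).
exists T, (fun t => cl (T * t)); split=> //.
- by rewrite mulr0 -{1}Th0; have [_] := inv _ z0.
- by rewrite mulr1; have [_] := inv _ o1.
- move=> t /=; rewrite in_itv/= => /Tt/fl[/andP[h1 h2] _ dt]; split.
    by apply: (inv _ _).1; rewrite in_itv/= (lt_le_trans a0 h1)
      (le_lt_trans h2 b1).
  have h := real_deriv_comp dt (real_derivZ (c := T) (real_deriv_id `[0, 1] t)).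
  move: h; rewrite mulr1; congr real_deriv; ring.
move=> k s t u k0 st fo us ut r srt.
have II : is_interval `[s, t] by exact: interval_is_interval.
have Is : `[s, t]%classic s by rewrite /= in_itv/= lexx ltW.
have It : `[s, t]%classic t by rewrite /= in_itv/= lexx ltW.
have Ir : `[s, t]%classic r by rewrite /= in_itv.
have kk : 0 < k * kappa by rewrite mulr_gt0// unit_rate_gt0.
have range v : `[s, t]%classic v -> u v \in `]a, b[.
  move=> Iv; have := Iv; rewrite /= in_itv/= => /andP[sv vt].
  rewrite in_itv/=; apply/andP; split.
    by apply: (lt_le_trans a0); rewrite -us;
      exact: first_order_incr kk II fo Is Iv sv.
  by apply: le_lt_trans b1; rewrite -ut;
    exact: first_order_incr kk II fo Iv It vt.
have Et := clk _ _ _ _ _ II range fo Is It; have Er :=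
  clk _ _ _ _ _ II range fo Is Ir.
rewrite us ut Th0 subr0 -/T in Et; rewrite us Th0 subr0 in Er.
have ts0 : t - s != 0 by rewrite subr_eq0 gt_eqF.
have -> : T * ((r - s) / (t - s)) = Th (u r).
  by rewrite Et Er; field.
by have [_ ->] := inv _ (range r Ir).
Qed.

End Clock.

(** * Initial value problem and geodesic convexity *)

Section Main.
Variables (R : realType) (n : nat) (M : topologicalType).
Variable A : oriented_atlas R n M.
Hypothesis compactM : compact [set: M].
Variables (rho : partition_of_unity A) (lambda : topform A).
Hypotheses (lambda_smooth : Omega lambda) (lambda_pos : form_pos lambda).
Variable alpha : R.
Hypothesis alpha_neq1 : alpha != 1.
Implicit Types (f g h xi : M -> R) (m : M) (I : set R) (tau : R -> R).
Implicit Types (mu nu : R -> topform A) (a : topform A).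

Local Notation J := (integral_fun rho lambda).
Local Notation p := (2 / (1 - alpha)).
Local Notation q := ((1 - alpha) / 2).
Local Notation C := (2 / `|1 - alpha|).
Local Notation S_geo := (S_geodesic rho lambda alpha).
Local Notation explicit := (explicit_geodesic rho lambda alpha).
Local Notation Phi := (Phi lambda alpha).
Local Notation TPhi := (TPhi lambda alpha).
Local Notation Phi_inv := (Phi_inv rho lambda alpha).
Local Notation tau_eqn := (tau_equation rho lambda alpha).
Local Notation first_order := (first_order rho lambda alpha).

Let oneBalpha : 1 - alpha != 0. Proof. by rewrite subr_eq0 eq_sym. Qed.
Let C0 : 0 < C. Proof. exact: C_gt0. Qed.
Let qp : q * p = 1. Proof. exact: mulqp. Qed.
Let pq : p * q = 1. Proof. exact: mulpq. Qed.

Lemma eq_AC_geodesic I mu nu : (forall t, I t -> mu t = nu t) ->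
  AC_geodesic rho alpha I mu -> AC_geodesic rho alpha I nu.
Proof.
move=> E [P [D [[D0 Dd] ac]]]; split=> [t It|]; first by rewrite -E//; exact: P.
exists D; split=> [|t It]; last by rewrite -E//; exact: ac.
by split=> // t It; rewrite D0// E.
Qed.

Lemma eq_frechet_deriv (V : lmodType R) (rep : V -> idx A -> 'rV[R]_n -> R) I
  (c c' : R -> V) t d : I t -> (forall r, I r -> c r = c' r) ->
  frechet_deriv rep I c t d -> frechet_deriv rep I c' t d.
Proof.
move=> It E fd i K s e cK Ki e0; have := fd i K s e cK Ki e0.
apply: filterS2 (near_slope_domain I t) => r [Ir _] h.
by rewrite -!E.
Qed.

Lemma S_geodesic_AC I (gamma : R -> M -> R) : proper_interval I ->
  S_geo I gamma -> AC_geodesic rho alpha I (fun t => Phi_inv (gamma t)).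
Proof.
move=> PI Sg; have := S_AC_geodesic compactM lambda_smooth lambda_pos alpha_neq1
  PI Sg.
by apply: eq_AC_geodesic => t It; rewrite Phi_invE//; have [/(_ t It)] := Sg.
Qed.

Lemma AC_geodesic_iff I mu : proper_interval I ->
  AC_geodesic rho alpha I mu <-> exists gamma : R -> M -> R,
    S_geo I gamma /\ forall t, I t -> mu t = Phi_inv (gamma t).
Proof.
move=> PI; split=> [ac|[gamma [Sg E]]].
  exists (fun t => Phi (mu t)); split.
    exact: (AC_S_geodesic compactM lambda_smooth lambda_pos alpha_neq1 PI).
  by move=> t It; rewrite Phi_invK//; have [/(_ t It)] := ac.
by apply: eq_AC_geodesic (S_geodesic_AC PI Sg) => t It; rewrite E.
Qed.

Lemma TPhi_Cinfty (mu0 a : topform A) : Prob rho mu0 -> Omega a ->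
  Cinfty A (TPhi mu0 a).
Proof.
move=> P0 Oa; have [sg g0 _ _] := Prob_rn lambda_smooth lambda_pos P0.
apply: CinftyM; last exact: Cinfty_rn.
by apply: CinftyZ; exact: Cinfty_powR.
Qed.

Lemma TPhi_inj (mu0 a b : topform A) : Prob rho mu0 -> Omega a -> Omega b ->
  TPhi mu0 a = TPhi mu0 b -> a = b.
Proof.
move=> P0 Oa Ob E; have [_ g0 _ _] := Prob_rn lambda_smooth lambda_pos P0.
rewrite -(rnK lambda_smooth lambda_pos Oa) -(rnK lambda_smooth lambda_pos Ob).
congr fmul; apply/funext => m; have := congr1 (fun h => h m) E;
  rewrite /Defs.TPhi.
by apply: mulfI; rewrite mulf_neq0 ?sgr_eq0// gt_eqF// powR_gt0.
Qed.

(** The powers of the density cancel, since q (p - 1) = 1 - q. *)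
Lemma TPhi_tangent (mu0 a : topform A) : Prob rho mu0 -> TProb rho a ->
  J (fun m => TPhi mu0 a m * Phi mu0 m `^ (p - 1)) = 0.
Proof.
move=> P0 [Oa Ja]; have [_ g0 _ _] := Prob_rn lambda_smooth lambda_pos P0.
have sh : Cinfty A (rn a lambda) by exact: Cinfty_rn.
rewrite (eq_integral_fun _ _ (k := fun m => Num.sg (1 - alpha) * C `^ (p - 1) *
  rn a lambda m)).
  by rewrite (integral_funZ compactM)// -integral_formE// Ja mulr0.
move=> m; rewrite /Defs.TPhi /Defs.Phi (powRM (p - 1) (ltW C0) (powR_ge0 _ _))
  -powRrM.
have gP : rn mu0 lambda m `^ (- ((1 + alpha) / 2)) * rn mu0 lambda m `^
  (q * (p - 1)) = 1.
  rewrite -powR_add// (_ : _ + _ = 0) ?powRr0//.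
  by field.
by rewrite -[RHS]mulr1 -[X in _ = _ * X]gP; ring.
Qed.

Lemma line0 f xi : line f xi 0 = f.
Proof. by apply/funext => m; rewrite /line mul0r addr0. Qed.

Lemma explicit0 f xi : S_alpha rho lambda alpha f -> explicit f xi 0 = f.
Proof.
move=> [_ f0 Jf]; apply/funext => m; rewrite explicitE /line_volume line0.
by rewrite [J _]Jf powRN (powR_mulK C0 pq) mulrCA divff ?mulr1// gt_eqF.
Qed.

Lemma explicit_line f xi eta s t : line f xi s = line f eta t ->
  explicit f xi s = explicit f eta t.
Proof. by move=> E; apply/funext => m; rewrite !explicitE /line_volume E. Qed.

(** The base time t0 is arbitrary, which avoids reparametrizing curves of forms
    in the two-point problem. *)
Lemma AC_geodesic_tau I nu t0 : proper_interval I -> I t0 ->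
  AC_geodesic rho alpha I nu -> exists xi tau tau1 tau2,
  [/\ Cinfty A xi, J (fun m => xi m * Phi (nu t0) m `^ (p - 1)) = 0,
    tau t0 = 0 /\ tau1 t0 = 1,
    tau_eqn (Phi (nu t0)) xi I tau tau1 tau2 &
    (forall t, I t -> nu t = Phi_inv (explicit (Phi (nu t0)) xi (tau t))) /\
    (forall a, Omega a -> AC_velocity I nu t0 a -> xi = TPhi (nu t0) a)].
Proof.
move=> PI It0 ac; have [Pnu _] := ac.
have [SS [D [[D0 Dd] geo]]] := AC_S_geodesic compactM lambda_smooth lambda_pos
  alpha_neq1 PI ac.
have SD t : I t -> S_alpha rho lambda alpha (D 0%N t) by move=> It;
  rewrite D0//; exact: SS.
have sD k t : I t -> Cinfty A (D k t) by move=> It; have [] := Dd k t It.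
have dD k t : I t -> fderiv A I (D k) t (D k.+1 t) by move=> It; have [] :=
  Dd k t It.
have geoD t : I t -> exists c, forall m, D 2 t m = c * D 0%N t m.
  move=> It; have [_ [c cE]] := geo t It; exists c => m.
  by have := congr1 (fun h : M -> R => h m) cE; rewrite subr0 D0.
have [tau [tau1 [tau2 [tau0 tau10 eqn E]]]] :=
  geodesic_tau compactM lambda_smooth lambda_pos alpha_neq1 PI It0 SD sD dD
    geoD.
have T0 := S_tangent compactM lambda_smooth lambda_pos alpha_neq1 PI SD sD dD
  It0.
rewrite D0// in eqn E T0.
exists (D 1%N t0), tau, tau1, tau2; split=> //; first exact: sD.
split=> [t It|a Oa va].
  by rewrite -E// D0// Phi_invK//; exact: Pnu.
have sPhi : smooth_family A I (fun r => Phi (nu r)) by move=> r Ir; have [] :=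
  SS r Ir.
have fd := Phi_deriv lambda_smooth lambda_pos alpha_neq1 Pnu It0 Oa va.
have sT : Cinfty A (TPhi (nu t0) a) by apply: TPhi_Cinfty => //; exact: Pnu.
apply: (fderiv_unique compactM rho PI sPhi (sD 1%N t0 It0) sT It0 _ fd).
by apply: eq_fderiv (dD 0%N t0 It0) => //; exact: sD.
Qed.

Section InitialValue.
Variables mu0 a : topform A.
Hypotheses (P0 : Prob rho mu0) (Ta : TProb rho a).
Local Notation f := (Phi mu0).
Local Notation xi := (TPhi mu0 a).
Local Notation tau_sol := (tau_solution rho lambda alpha f xi).

Let Sf : S_alpha rho lambda alpha f. Proof. exact: Phi_S. Qed.
Let sf : Cinfty A f. Proof. by case: Sf. Qed.
Let f0 m : 0 < f m. Proof. by case: Sf. Qed.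
Let Oa : Omega a. Proof. by case: Ta. Qed.
Let sxi : Cinfty A xi. Proof. exact: TPhi_Cinfty. Qed.
Let J1 : 0 < J (fun=> 1).
Proof. exact: (S_integral1_gt0 compactM lambda_smooth lambda_pos alpha_neq1 Sf).
  Qed.
Local Notation kappa := (unit_rate rho lambda alpha f xi).

Lemma tau_solution_first_order I tau : proper_interval I -> I 0 ->
  tau_sol I tau -> tau 0 = 0 /\ first_order f xi kappa I tau.
Proof.
move=> [II _] I0 /(tau_solutionE rho lambda alpha_neq1)[tau1
  [tau2 [t0 t10 eqn]]]; split=> //.
exact: (tau_equation_first_order compactM lambda_smooth lambda_pos alpha_neq1 sf
  sxi J1 II eqn I0 t0 t10).
Qed.

Lemma tau_solution_exists : exists2 e : R, 0 < e & exists tau, tau_sol `]-e,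
  e[ tau.
Proof.
have [e e0 [tau t0 fo]] := first_order_local compactM lambda_smooth lambda_pos
  alpha sf sxi J1 f0.
exists e => //; exists tau; apply/(tau_solutionE rho lambda alpha_neq1).
have eqn := first_order_tau_equation compactM lambda_smooth lambda_pos
  alpha_neq1 sf sxi J1 fo.
refine (ex_intro _ _ (ex_intro _ _ (And3 t0 _ eqn))).
have pos0 : line_pos f xi 0 by exact: line_pos0.
have G0 := line_volume_gt0 compactM lambda_smooth lambda_pos alpha sf sxi J1
  pos0.
by rewrite /= t0 mulVf// gt_eqF// powR_gt0.
Qed.

Lemma tau_solution_unique I tau tau' : proper_interval I -> I 0 ->
  tau_sol I tau -> tau_sol I tau' -> forall t, I t -> tau t = tau' t.
Proof.
move=> PI I0 /(tau_solution_first_order PI I0)[t0 fo]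
  /(tau_solution_first_order PI I0)[t0' fo'].
have [II _] := PI.
exact: (first_order_unique compactM lambda_smooth lambda_pos sf sxi J1 f0 II I0
  fo fo' t0 t0').
Qed.

(** The velocity of the form is recovered from that of its image under Phi, as
    TPhi is injective. *)
Lemma explicit_solves I tau : proper_interval I -> I 0 -> tau_sol I tau ->
  let sol t := Phi_inv (explicit f xi (tau t)) in
  [/\ AC_geodesic rho alpha I sol, sol 0 = mu0 & AC_velocity I sol 0 a].
Proof.
move=> PI I0 ts sol; have [t0 fo] := tau_solution_first_order PI I0 ts.
have Sg := explicit_S_geodesic compactM lambda_smooth lambda_pos alpha_neq1 sf
  sxi J1 PI fo.
have ac : AC_geodesic rho alpha I sol by exact: S_geodesic_AC.
have sol0 : sol 0 = mu0 by rewrite /sol t0 explicit0// Phi_invK.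
split=> //; have [Psol [D [[D0 Dd] _]]] := ac.
have OD : Omega (D 1%N 0) by have [] := Dd 1%N 0 I0.
have v1 : frechet_deriv (@loc_form R n M A) I sol 0 (D 1%N 0).
  have [_] := Dd 0%N 0 I0; apply: eq_frechet_deriv => //.
have fd := Phi_deriv lambda_smooth lambda_pos alpha_neq1 Psol I0 OD v1.
have PhiE r : I r -> Phi (sol r) = explicit f xi (tau r).
  move=> Ir; have [/(_ r Ir) Sr _] := Sg; rewrite /sol Phi_invE//.
  by apply: Phi_Psi => //; case: Sr.
have fe := explicit_deriv compactM lambda_smooth lambda_pos alpha_neq1 sf sxi J1
  fo I0.
have sE : smooth_family A I (fun r => explicit f xi (tau r)).
  by move=> r Ir; have [/(_ r Ir)[]] := Sg.
have N0 : line_pairing rho lambda alpha f xi 0 = 0.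
  by rewrite /line_pairing line0; exact: TPhi_tangent.
have G0 : line_volume rho lambda alpha f xi 0 = C `^ p.
  by rewrite /line_volume line0; case: Sf.
have xiE : TPhi (sol 0) (D 1%N 0) = xi.
  have sT : Cinfty A (TPhi (sol 0) (D 1%N 0)).
    by apply: TPhi_Cinfty => //; exact: Psol.
  have sS : smooth_family A I (fun r => Phi (sol r)).
    by move=> r Ir; rewrite PhiE//; exact: sE.
  apply: (fderiv_unique compactM rho PI sS sT sxi I0 fd).
  apply: eq_fderiv fe => //.
  - by apply: CinftyZ; apply: CinftyD; [apply: CinftyM => //; exact: Cinfty_cst|
      apply: CinftyZ; apply: CinftyM; [exact: line_smooth|exact: Cinfty_cst]].
  - by move=> r Ir; rewrite PhiE.
  - apply/funext => m; rewrite t0 N0 !mulr0 addr0 /unit_rate G0.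
    have -> : (C `^ p) `^ q = C by rewrite powR_mulK.
    have -> : (C `^ p) `^ (2 * q) = C * C.
      by rewrite (_ : 2 * q = q + q) ?powR_add ?powR_gt0// ?powR_mulK//; ring.
    have /gt_eqF/negbT := C0; move: C => c c0; by field.
rewrite sol0 in xiE; have <- := TPhi_inj P0 OD Oa xiE.
exact: v1.
Qed.

Lemma geodesic_explicit I nu : proper_interval I -> I 0 ->
  AC_geodesic rho alpha I nu -> nu 0 = mu0 -> AC_velocity I nu 0 a ->
  exists2 tau, tau_sol I tau & forall t, I t ->
    nu t = Phi_inv (explicit f xi (tau t)).
Proof.
move=> PI I0 ac nu0 va.
have [eta [tau [tau1 [tau2 [_ _ [t0 t10] eqn [nuE vE]]]]]] :=
  AC_geodesic_tau PI I0 ac.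
have etaE := vE a Oa va; rewrite nu0 in etaE; subst eta; rewrite nu0 in eqn nuE.
exists tau => //; apply/(tau_solutionE rho lambda alpha_neq1).
by exists tau1, tau2.
Qed.

End InitialValue.

(** The direction xi = k f1 - f0 has k chosen such that xi is tangent at f0. For
    another connecting geodesic with velocity eta one gets f1 = c (f0 + tau eta)
    for a scalar c; pairing with f0^(p-1) shows c = 1 / k, so that
    xi = tau eta. *)
Lemma geodesic_between (mu0 mu1 : topform A) : Prob rho mu0 -> Prob rho mu1 ->
  exists mu : R -> topform A,
    [/\ AC_geodesic rho alpha `[0, 1] mu, mu 0 = mu0, mu 1 = mu1
      & forall (s t : R) (nu : R -> topform A), s < t ->
          AC_geodesic rho alpha `[s, t] nu -> nu s = mu0 -> nu t = mu1 ->
          forall r, s <= r <= t -> nu r = mu ((r - s) / (t - s))].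
Proof.
move=> P0 P1; pose f0 := Phi mu0; pose f1 := Phi mu1.
have S0 : S_alpha rho lambda alpha f0 by exact: Phi_S.
have S1 : S_alpha rho lambda alpha f1 by exact: Phi_S.
have [sf0 pf0 Jf0] := S0; have [sf1 pf1 Jf1] := S1.
have J1 := S_integral1_gt0 compactM lambda_smooth lambda_pos alpha_neq1 S0.
have sp x : Cinfty A (fun m => f0 m `^ x) by exact: Cinfty_powR.
pose D0 := J (fun m => f0 m `^ p); pose D1 :=
  J (fun m => f1 m * f0 m `^ (p - 1)).
have D0p : 0 < D0.
  by apply: (integral_fun_gt0 compactM) => // m; rewrite powR_gt0.
have D1p : 0 < D1.
  apply: (integral_fun_gt0 compactM) => //; first exact: CinftyM.
  by move=> m; rewrite mulr_gt0// powR_gt0.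
pose k := D0 / D1; have k0 : 0 < k by rewrite divr_gt0.
pose xi m := k * f1 m + -1 * f0 m.
have sxi : Cinfty A xi by apply: CinftyD; exact: CinftyZ.
have xi1 : line f0 xi 1 = (fun m => k * f1 m).
  by apply/funext => m; rewrite /line /xi; ring.
have pos1 : line_pos f0 xi 1 by move=> m; rewrite xi1 mulr_gt0.
have [T [sigma [T0 sg0 sg1 fo uniq]]] :=
  first_order_reach compactM lambda_smooth lambda_pos alpha sf0 sxi J1 pf0 pos1.
have PI01 : proper_interval `[0, 1 : R]%classic.
  split; first exact: interval_is_interval.
  by exists 0, 1; split; rewrite /= ?in_itv/= ?lexx ?ler01 ?ltr01.
have Sg := explicit_S_geodesic compactM lambda_smooth lambda_pos alpha_neq1 sf0
  sxi J1 PI01 fo.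
have explicit1 : explicit f0 xi 1 = f1.
  apply/funext => m; rewrite explicitE /line_volume xi1.
  rewrite (eq_integral_fun _ _ (k := fun m => k `^ p * f1 m `^ p)); last first.
    by move=> m'; rewrite powRM// ltW.
  rewrite (integral_funZ compactM)//; last exact: Cinfty_powR.
  rewrite [J _]Jf1 powRN powRM ?powR_ge0// !powR_mulK//.
  have kn : k != 0 by rewrite gt_eqF.
  have Cn : C != 0 by rewrite gt_eqF.
  have alg (c y z : R) : c != 0 -> y != 0 -> c * (y * z * (y * c)^-1) = z.
    by move=> c0 y0; field; rewrite c0 y0.
  exact: alg.
exists (fun t => Phi_inv (explicit f0 xi (sigma t))); split.
- exact: S_geodesic_AC.
- by rewrite sg0 explicit0// Phi_invK.
- by rewrite sg1 explicit1 Phi_invK.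
move=> s t nu st ac nus nut r srt.
have PI : proper_interval `[s, t]%classic.
  split; first exact: interval_is_interval.
  by exists s, t; split=> //; rewrite /= in_itv/= lexx ltW.
have Is : `[s, t]%classic s by rewrite /= in_itv/= lexx ltW.
have It : `[s, t]%classic t by rewrite /= in_itv/= lexx ltW.
have Ir : `[s, t]%classic r by rewrite /= in_itv.
have [eta [tau [tau1 [tau2 [seta Teta [t0 t10] eqn [nuE _]]]]]] :=
  AC_geodesic_tau PI Is ac.
rewrite nus -/f0 in Teta eqn nuE.
have [II _] := PI.
have fo' := tau_equation_first_order compactM lambda_smooth lambda_pos
  alpha_neq1 sf0 seta J1 II eqn Is t0 t10.
have post : line_pos f0 eta (tau t) by have [] := fo' t It.
have Gt := line_volume_gt0 compactM lambda_smooth lambda_pos alpha sf0 seta J1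
  post.
have rate0 := unit_rate_gt0 compactM lambda_smooth lambda_pos alpha sf0 seta J1
  pf0.
have taut : 0 < tau t.
  rewrite -t0; apply: (real_deriv_incr II
    (d := fun t => unit_rate rho lambda alpha f0 eta *
    line_volume rho lambda alpha f0 eta (tau t) `^ (2 * q))) => // u Iu.
    by have [] := fo' u Iu.
  rewrite mulr_gt0// powR_gt0//.
  by apply: (line_volume_gt0 compactM lambda_smooth lambda_pos alpha sf0 seta
    J1); have [] := fo' u Iu.
(* the velocities eta and xi are positively proportional *)
have f1E : f1 = explicit f0 eta (tau t).
  have Se := explicit_S compactM lambda_smooth lambda_pos alpha_neq1 sf0 seta J1
    post.
  have [_ pe _] := Se; have E := nuE t It; rewrite nut in E.
  by rewrite /f1 E (Phi_invE compactM lambda_smooth lambda_pos alpha_neq1 Se)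
    Phi_Psi.
pose c := C * line_volume rho lambda alpha f0 eta (tau t) `^ (- q).
have c0 : 0 < c by rewrite mulr_gt0// powR_gt0.
have f1c m : f1 m = c * (f0 m + tau t * eta m).
  have E : f1 m = explicit f0 eta (tau t) m :=
    congr1 (fun h : M -> R => h m) f1E.
  by rewrite E explicitE [LHS]mulrA [LHS]mulrAC.
have ck : c * k = 1.
  suff D1E : D1 = c * D0 by rewrite /k D1E mulrA mulfV// gt_eqF// mulr_gt0.
  rewrite /D1 (eq_integral_fun _ _ (k := fun m => c * f0 m `^ p +
      c * tau t * (eta m * f0 m `^ (p - 1)))); last first.
    move=> m; have -> : f0 m `^ p = f0 m * f0 m `^ (p - 1).
      by rewrite -{2}(powRr1 (ltW (pf0 m))) -powR_add//; congr (_ `^ _); ring.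
    by rewrite f1c; ring.
  rewrite (integral_fun_lin compactM)//; last by apply: CinftyZ; exact: CinftyM.
  by rewrite (integral_funZ compactM)//;
    [rewrite Teta mulr0 addr0|exact: CinftyM].
have xiE m : xi m = tau t * eta m.
  by rewrite /xi f1c mulrA [k * c]mulrC ck; ring.
have tn : tau t != 0 by rewrite gt_eqF.
pose u v := tau v / tau t.
have lineE v : line f0 eta (tau v) = line f0 xi (u v).
  by apply/funext => m; rewrite /line xiE /u; field.
have rateE : unit_rate rho lambda alpha f0 eta = unit_rate rho lambda alpha f0
  xi.
  by rewrite /unit_rate /line_volume !line0.
have fou : first_order f0 xi ((tau t)^-1 * unit_rate rho lambda alpha f0 xi)
  `[s, t]%classic u.
  move=> v Iv; have [pv dv] := fo' v Iv; split=> [m|]; first by rewrite -lineE.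
  apply: (eq_real_deriv Iv _ _ (real_derivZ (c := (tau t)^-1) dv)).
    by move=> w _; rewrite /u mulrC.
  by rewrite mulrA rateE; congr (_ * _ `^ _); rewrite /line_volume lineE.
have us : u s = 0 by rewrite /u t0 mul0r.
have ut : u t = 1 by rewrite /u divff.
have tinv : 0 < (tau t)^-1 by rewrite invr_gt0.
have sigmaE := uniq _ _ _ _ tinv st fou us ut r srt.
have E := etrans (explicit_line (lineE r)) (congr1 (explicit f0 xi) sigmaE).
have nurE := nuE r Ir.
by rewrite -E -nurE.
Qed.

End Main.

Theorem corollary4p10 (R : realType) (n : nat) (M : topologicalType)
    (A : oriented_atlas R n M) (hausdorffM : hausdorff_space M)
    (compactM : compact [set: M]) (rho : partition_of_unity A)
    (lambda : topform A) (lambda_smooth : Omega lambda)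
    (lambda_pos : form_pos lambda) (alpha : R) (alpha_neq1 : alpha != 1) :
  [/\
   (* geodesics are the pull-backs of those of S_alpha *)
   forall (I : set R) (mu : R -> topform A), proper_interval I ->
     AC_geodesic rho alpha I mu <->
     exists gamma : R -> M -> R,
       S_geodesic rho lambda alpha I gamma /\
       forall t, I t -> mu t = Phi_inv rho lambda alpha (gamma t),
   (* (1) *)
   forall mu0 a : topform A, Prob rho mu0 -> TProb rho a ->
     let f := Phi lambda alpha mu0 in
     let xi := TPhi lambda alpha mu0 a in
     let sol (tau : R -> R) (t : R) :=
       Phi_inv rho lambda alpha
         (explicit_geodesic rho lambda alpha f xi (tau t)) in
     [/\ exists2 e : R, 0 < e &
           exists tau, tau_solution rho lambda alpha f xi `]-e, e[ tau,
         forall (I : set R) (tau : R -> R), proper_interval I -> I 0 ->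
           tau_solution rho lambda alpha f xi I tau ->
           [/\ AC_geodesic rho alpha I (sol tau), sol tau 0 = mu0
             & AC_velocity I (sol tau) 0 a],
         forall (I : set R) (nu : R -> topform A), proper_interval I -> I 0 ->
           AC_geodesic rho alpha I nu -> nu 0 = mu0 -> AC_velocity I nu 0 a ->
           exists2 tau, tau_solution rho lambda alpha f xi I tau &
             forall t, I t -> nu t = sol tau t
       & forall (I : set R) (tau tau' : R -> R), proper_interval I -> I 0 ->
           tau_solution rho lambda alpha f xi I tau ->
           tau_solution rho lambda alpha f xi I tau' ->
           forall t, I t -> tau t = tau' t]
   & (* (2) *)
   forall mu0 mu1 : topform A, Prob rho mu0 -> Prob rho mu1 ->
     exists mu : R -> topform A,
       [/\ AC_geodesic rho alpha `[0, 1] mu, mu 0 = mu0, mu 1 = mu1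
         & forall (s t : R) (nu : R -> topform A), s < t ->
             AC_geodesic rho alpha `[s, t] nu -> nu s = mu0 -> nu t = mu1 ->
             forall r, s <= r <= t -> nu r = mu ((r - s) / (t - s))]].
Proof.
split.
- by move=> I mu PI; exact: AC_geodesic_iff.
- move=> mu0 a P0 Ta f xi sol; split.
  + exact: tau_solution_exists.
  + by move=> I tau PI I0 ts; exact: explicit_solves.
  + by move=> I nu PI I0 ac nu0 va; exact: geodesic_explicit.
  + by move=> I tau tau' PI I0; exact: tau_solution_unique.
- by move=> mu0 mu1 P0 P1;
  exact: (geodesic_between compactM lambda_smooth lambda_pos alpha_neq1 P0 P1).
Qed.
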